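(* Let $\alpha\ge1$ be an integer and consider infinite-dimensional integration over $\mathcal H_\gamma$ based on the anchored Sobolev space $H(K_{\alpha,c})$ on $D=[0,1]$ with Lebesgue measure. Let $\$(k)=O(k^s)$ for some $s\ge0$. Let the weights $\gamma$ have finite algorithmic dimension, and let $\mathrm{decay}_\gamma>1$. Then the exponent of strong tractability in the unrestricted subspace sampling model satisfies $$p^{\mathrm{unr}}\le\max\left\{\frac1\alpha,\frac{2\min\{1,s\}}{\mathrm{decay}_\gamma-1}\right\}.$$
   Context: Setting. $\mathbb N=\{1,2,\dots\}$, $\mathbb N_0=\mathbb N\cup\{0\}$, $[n]=\{1,\dots,n\}$; $\mathcal U$ is the set of all finite subsets of $\mathbb N$. $D=[0,1]$, $\rho$ is Lebesgue measure on $[0,1]$, $c\in[0,1]$. $H=H(K_{\alpha,c})$ is the Hilbert space of functions $f:[0,1]\to\mathbb R$ with $f(c)=0$, $f^{(\alpha-1)}$ absolutely continuous and $f^{(\alpha)}\in L_2[0,1]$, with inner product $\langle f,g\rangle=\sum_{r=1}^{\alpha-1}f^{(r)}(c)g^{(r)}(c)+\int_0^1f^{(\alpha)}g^{(\alpha)}\,dx$ (empty sum $=0$); $K=K_{\alpha,c}$ is its reproducing kernel. $M:=\int_0^1K(x,x)\,dx$, $C_0:=\int_0^1\int_0^1K(x,y)\,dx\,dy$. For $u\in\mathcal U$ put $K_u(x,y)=\prod_{j\in u}K(x_j,y_j)$ ($K_\emptyset\equiv1$), $H_u=H(K_u)$ its reproducing kernel Hilbert space (RKHS). Weights are families $\gamma=(\gamma_u)_{u\in\mathcal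 U}$ of non-negative reals with $\sum_u\gamma_uM^{|u|}<\infty$; $\mathcal A=\{u:\gamma_u>0\}$ is assumed to contain a non-empty set. Let $\mathfrak X=\{x\in D^{\mathbb N}:\sum_{u\in\mathcal A}\gamma_u\prod_{j\in u}K(x_j,x_j)<\infty\}$ and let $\mathcal H_\gamma$ be the RKHS on $\mathfrak X$ with kernel $\sum_{u\in\mathcal A}\gamma_uK_u$; every $f\in\mathcal H_\gamma$ is uniquely $f=\sum_{u\in\mathcal A}f_u$, $f_u\in H_u$, with $\|f\|_\gamma^2=\sum_{u\in\mathcal A}\gamma_u^{-1}\|f_u\|_{H_u}^2$. $\mu$ is the product of $\rho$ on $D^{\mathbb N}$ and $I(f)=\int_{\mathfrak X}f\,d\mu$. Algorithms and errors. $(x;c)$, for $x\in D^u$, is the point of $D^{\mathbb N}$ with coordinates $x_j$ for $j\in u$ and $c$ otherwise. Admissible algorithms: $Q(f)=\sum_{i=1}^na_if(t_{v_i};c)$ with $n\in\mathbb N_0$, $a_i\in\mathbb R$, $v_i\in\mathcal U$, $t_{v_i}\in(D\setminus\{c\})^{v_i}$. $e(Q;\mathcal H_\gamma)=\sup_{\|f\|_\gamma\le1}|I(f)-Q(f)|$. Cost (unrestricted subspace sampling). $\$:\mathbb N_0\to[1,\infty)$ is a non-decreasing cost function and $\mathrm{cost}_{\mathrm{unr}}(Q)=\sum_{i=1}^n\$(|v_i|)$. Tractability. $\mathrm{comp}_{\mathrm{unr}}(\varepsilon)=\inf\{\mathrm{cost}_{\mathrm{unr}}(Q): Q\text{ admissible},\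 e(Q;\mathcal H_\gamma)\le\varepsilon\}$; $p^{\mathrm{unr}}$ is the infimum of all $p\ge0$ for which there is $C\ge0$ with $\mathrm{comp}_{\mathrm{unr}}(\varepsilon)\le C\varepsilon^{-p}$ for all $\varepsilon>0$. Algorithmic dimension. Weights $\gamma$ have finite algorithmic dimension if there are $d\in\mathbb N$ and a map $\phi:\mathbb N\to[d]$ whose restriction to each $u$ with $\gamma_u>0$ is injective. Decay. $\widehat\gamma_u=\gamma_uC_0^{|u|}$; $u_1,u_2,\dots$ are the distinct non-empty $u$ with $\gamma_u>0$, ordered so that $\widehat\gamma_{u_1}\ge\widehat\gamma_{u_2}\ge\cdots$; $\mathrm{decay}_\gamma=\sup\{p\in\mathbb R:\lim_{j\to\infty}\widehat\gamma_{u_j}j^p=0\}$ (equal to $\infty$ if there are only finitely many $u_j$). *)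

(* Defs.v *)
From mathcomp Require Export all_boot all_order all_algebra finmap.
From mathcomp Require Export all_classical all_reals all_analysis.
Export Order.TTheory GRing.Theory Num.Theory.
Export numFieldNormedType.Exports.

Set Implicit Arguments.
Unset Strict Implicit.
Unset Printing Implicit Defensive.

Local Open Scope classical_set_scope.
Local Open Scope ring_scope.

(** A space of real functions on a subset [X] of [T] is given by a set [H] of
    functions [T -> R] and a form [ip] that is meaningful on [H] only; functions
    on [X] are represented by their extension by zero to [T]. *)
Section FunctionSpaces.
Context {R : realType} {T : Type}.
Implicit Types (X : set T) (H : set (T -> R)) (k : T -> T -> R).
Implicit Types (ip : (T -> R) -> (T -> R) -> R).

Definition ip_norm ip (f : T -> R) : R := Num.sqrt (ip f f).

Record hilbert_function_space X H ip : Prop := {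
  hfs_support : forall f, H f -> forall x, ~ X x -> f x = 0;
  hfs_zero : H (fun=> 0);
  hfs_lin : forall (a : R) f g, H f -> H g -> H (fun x => a * f x + g x);
  hfs_ipC : forall f g, H f -> H g -> ip f g = ip g f;
  hfs_ip_lin : forall (a : R) f g h, H f -> H g -> H h ->
    ip (fun x => a * f x + g x) h = a * ip f h + ip g h;
  hfs_ip_ge0 : forall f, H f -> 0 <= ip f f;
  hfs_ip_eq0 : forall f, H f -> ip f f = 0 -> f = (fun=> 0);
  hfs_complete : forall u : nat -> T -> R, (forall n, H (u n)) ->
    (forall e : R, 0 < e -> exists N : nat, forall m n : nat,
      (N <= m)%N -> (N <= n)%N -> ip_norm ip (u m \- u n) < e) ->
    exists2 f, H f & ip_norm ip (u n \- f) @[n --> \oo] --> (0 : R)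
}.

(** The values of [k] off [X * X] are immaterial; [_ \_ X] extends by zero. *)
Record reproducing_kernel X H ip k : Prop := {
  rk_mem : forall y, X y -> H ((k ^~ y) \_ X);
  rk_eval : forall f y, H f -> X y -> f y = ip f ((k ^~ y) \_ X)
}.

(** By the Moore-Aronszajn theorem, every positive semidefinite [k] determines
    [H] uniquely, and [ip] uniquely on [H]. *)
Definition is_rkhs X H ip k :=
  hilbert_function_space X H ip /\ reproducing_kernel X H ip k.

End FunctionSpaces.

Section AnchoredSobolev.
Variable R : realType.
Implicit Types (f g : R -> R).

Definition unitI : set R := `[0, 1]%classic.

(** Derivatives of functions on [0, 1], one-sided at the end points. *)
Definition diffq f (x y : R) : R := (f y - f x) / (y - x).

Definition derivable_unitI f (x : R) : Prop :=
  cvg (diffq f x y @[y --> within (unitI `\ x) (nbhs x)]).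

(** Equal to the default value [0] where the derivative does not exist. *)
Definition deriv_unitI f (x : R) : R :=
  lim (diffq f x y @[y --> within (unitI `\ x) (nbhs x)]).

Definition derivn_unitI (r : nat) f : R -> R := iter r deriv_unitI f.

Definition abs_continuous_unitI f : Prop :=
  forall e : R, 0 < e -> exists2 d : R, 0 < d &
    forall (n : nat) (a b : 'I_n -> R),
      (forall i, 0 <= a i /\ a i <= b i /\ b i <= 1) ->
      trivIset setT (fun i => `]a i, b i[%classic) ->
      \sum_(i < n) (b i - a i) < d ->
      \sum_(i < n) `|f (b i) - f (a i)| < e.

Definition sobolev (alpha : nat) (c : R) : set (R -> R) :=
  [set f | [/\ forall x, ~ unitI x -> f x = 0,
               f c = 0,
               forall r x, (r < alpha.-1)%N -> unitI x ->
                 derivable_unitI (derivn_unitI r f) x,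
               abs_continuous_unitI (derivn_unitI alpha.-1 f) &
               (derivn_unitI alpha f) \_ unitI
                 \in Lfun (@lebesgue_measure R) 2%:E ] ].

Definition sobolev_ip (alpha : nat) (c : R) f g : R :=
  \sum_(1 <= r < alpha) derivn_unitI r f c * derivn_unitI r g c +
  \int[@lebesgue_measure R]_(x in unitI)
     (derivn_unitI alpha f x * derivn_unitI alpha g x).

Definition kernel_M (K : R -> R -> R) : R :=
  \int[@lebesgue_measure R]_(x in unitI) K x x.

Definition kernel_C0 (K : R -> R -> R) : R :=
  \int[@lebesgue_measure R]_(x in unitI)
    (\int[@lebesgue_measure R]_(y in unitI) K x y).

End AnchoredSobolev.

(** Coordinates and variable sets are indexed by [nat], i.e. from [0]. *)
Section InfiniteDimensional.
Variable R : realType.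
Implicit Types (K : R -> R -> R) (gam : {fset nat} -> R).

Definition cylinders : set (set (nat -> R)) :=
  [set C | exists (j : nat) (B : set R), measurable B /\ C = [set x | B (x j)]].

(** R^N with the product sigma-algebra. *)
Definition seqspace := g_sigma_algebraType cylinders.

(** The product of the uniform laws on [0, 1], as a measure on R^N. *)
Definition is_product_uniform (mu : set seqspace -> \bar R) : Prop :=
  forall (u : {fset nat}) (B : nat -> set R), (forall j, measurable (B j)) ->
    mu [set x : seqspace | forall j, j \in u -> B j (x j)] =
    (\prod_(j <- u) fine (lebesgue_measure (B j `&` @unitI R)))%:E.

Definition tensor_kernel K (u : {fset nat}) (x y : nat -> R) : R :=
  \prod_(j <- u) K (x j) (y j).

Definition active gam : set {fset nat} := [set u | 0 < gam u].

Definition weighted_domain K gam : set (nat -> R) :=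
  [set x | (forall j, unitI (x j)) /\
    (\esum_(u in active gam) (gam u * tensor_kernel K u x x)%:E < +oo)%E].

(** Unconditional sum of an absolutely summable family of reals. *)
Definition abs_sum (I : choiceType) (A : set I) (a : I -> R) : R :=
  fine (\esum_(i in A) (Num.max (a i) 0)%:E) -
  fine (\esum_(i in A) (Num.max (- a i) 0)%:E).

Definition weighted_kernel K gam (x y : nat -> R) : R :=
  abs_sum (active gam) (fun u => gam u * tensor_kernel K u x y).

Definition is_weights K gam : Prop :=
  [/\ forall u, 0 <= gam u,
      (\esum_(u in [set: {fset nat}]) (gam u * kernel_M K ^+ #|` u|)%:E < +oo)%E &
      exists u, active gam u /\ u != fset0].

Definition finite_algorithmic_dimension gam : Prop :=
  exists (d : nat) (phi : nat -> 'I_d), forall u : {fset nat}, 0 < gam u ->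
    {in u &, injective phi}.

Definition gam_hat K gam (u : {fset nat}) : R := gam u * kernel_C0 K ^+ #|` u|.

Definition active_nonempty gam : set {fset nat} := active gam `\ fset0.

Definition decreasing_enum K gam (e : nat -> {fset nat}) : Prop :=
  set_bij [set: nat] (active_nonempty gam) e /\
  nonincreasing_seq (gam_hat K gam \o e).

(** The sequence [e] is indexed from [0], whence the shift in [j.+1]. *)
Definition decay K gam : \bar R :=
  if pselect (finite_set (active_nonempty gam)) then +oo%E
  else ereal_sup [set p%:E | p in [set p : R |
    exists2 e, decreasing_enum K gam e &
      gam_hat K gam (e j) * j.+1%:R `^ p @[j --> \oo] --> (0 : R)]].

(** Only the coordinates [alg_node i j] with [j \in alg_act i] are used. *)
Record algorithm := Algorithm {
  alg_size : nat;
  alg_coef : 'I_alg_size -> R;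
  alg_act : 'I_alg_size -> {fset nat};
  alg_node : 'I_alg_size -> nat -> R
}.

Definition admissible (c : R) (Q : algorithm) : Prop :=
  forall (i : 'I_(alg_size Q)) j, j \in alg_act i ->
    unitI (alg_node i j) /\ alg_node i j <> c.

Definition anchored_pt (c : R) (v : {fset nat}) (t : nat -> R) : nat -> R :=
  fun j => if j \in v then t j else c.

Definition alg_apply (c : R) (Q : algorithm) (f : (nat -> R) -> R) : R :=
  \sum_(i < alg_size Q)
    alg_coef i * f (anchored_pt c (alg_act i) (alg_node i)).

Definition cost_unr (cost : nat -> R) (Q : algorithm) : R :=
  \sum_(i < alg_size Q) cost #|` alg_act i|.

Section Complexity.
Variables (mu : {measure set seqspace -> \bar R}) (c : R) (X : set (nat -> R)).
Variables (H : set ((nat -> R) -> R)).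
Variables (ip : ((nat -> R) -> R) -> ((nat -> R) -> R) -> R).
Variable cost : nat -> R.

Definition integral_mu (f : (nat -> R) -> R) : R :=
  \int[mu]_(x in (X : set seqspace)) f x.

Definition wc_error (Q : algorithm) : \bar R :=
  ereal_sup [set (`|integral_mu f - alg_apply c Q f|)%:E |
    f in [set f | H f /\ ip_norm ip f <= 1]].

Definition comp_unr (eps : R) : \bar R :=
  ereal_inf [set (cost_unr cost Q)%:E |
    Q in [set Q | admissible c Q /\ (wc_error Q <= eps%:E)%E]].

Definition p_unr : \bar R :=
  ereal_inf [set p%:E | p in [set p : R | 0 <= p /\
    exists2 C : R, 0 <= C & forall eps : R, 0 < eps ->
      (comp_unr eps <= (C * eps `^ (- p))%:E)%E]].

End Complexity.
End InfiniteDimensional.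

(* Main.v *)
Require Import Defs.
From mathcomp Require Import measurable_realfun ring lra.

(** The kernel of the anchored Sobolev space is a pairing
    [K(x, y) = sum_r p_r(x) p_r(y) + int g(x, t) g(y, t) dt] of explicit features:
    the monomials [p_r(x) = (x - c)^r / r!] and the Peano kernels [g(., t)].
    Hence an algorithm that integrates every product over [u] of features up to an
    error [B] has squared worst case error at most [alpha^|u| B^2] on [H(K_u)], and
    the problem is reduced to a scalar, pointwise one.

    Finite algorithmic dimension provides [phi] into [D] classes, injective on every
    active set, so that a [D]-variate Smolyak rule based on composite rules of
    order [alpha], copied along [phi], is a [|u|]-variate Smolyak rule on every
    active [u] at once.  The active sets are split into dyadic levels by decreasing
    weight.  The first [2^l] of them are isolated either by the anchored projection on
    their union, at cost [2^(s l)] per node, or by inclusion-exclusion over their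
    subsets, at cost [2^l] per node, which gives [sg = min(1, s)].  Level [l] uses
    a Smolyak rule of accuracy [2^(l th - t)]; any [th < (q - 1) / 2] with [q < decay]
    gives a total error [2^-t], and the cost is [2^(p t)] up to a constant as soon as
    [p > 1 / alpha] and [p th > sg]. *)

Set Implicit Arguments.
Unset Strict Implicit.
Unset Printing Implicit Defensive.

Local Open Scope classical_set_scope.
Local Open Scope ring_scope.

(** * Integration of bounded functions *)

(** [H] is given only abstractly, so the components [f_u] of a member are never produced. The error
    functional is represented inside [H] by Riesz; the squared norm of the representer is the
    functional applied to both variables of the weighted kernel, a uniform limit of finite sums over
    [u]. The index set of the features has total mass [alpha] ([alpha - 1] degrees and an interval
    of length 1), hence [alpha^|u|].

    [K] is known only through the reproducing property. Its explicit form is extracted by testing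
    that property on monomials and on splines of degree [alpha].

    One Smolyak rule can serve all active sets because a class missed by [u] carries the constant 1,
    which the univariate rules integrate exactly.

    The factor 2 in the exponent comes from squaring: with error of order [i^th 2^-t] at rank [i],
    the sum of [i^(2 th - q)] must converge, whereas isolating the sets up to the last useful rank
    [2^(t/th)] costs [2^(sg t/th)]. Logarithmic factors are absorbed in strict inequalities between
    exponents. *)

Section BoundedMeasurable.
Context {d : measure_display} {T : measurableType d} {R : realType}.
Variables (mu : {measure set T -> \bar R}) (D : set T).
Hypotheses (mD : measurable D) (D1 : mu D = 1%E).
Implicit Types f g : T -> R.

(** Boundedness is asked instead of integrability because it survives products; on a set of measure
    1 it implies integrability. *)
Definition bmf f := measurable_fun D f /\ exists B, forall x, D x -> `|f x| <= B.

Lemma bmf_integrable f : bmf f -> mu.-integrable D (EFin \o f).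
Proof.
move=> [mf [B fB]]; apply: measurable_bounded_integrable => //.
  by rewrite D1 ltry.
exists B; split; first exact: num_real.
by move=> y By x Dx; apply: le_trans (fB x Dx) (ltW By).
Qed.

Lemma bmf_cst (a : R) : bmf (fun=> a).
Proof. by split; [exact: measurable_cst | exists `|a|]. Qed.

Lemma bmfD f g : bmf f -> bmf g -> bmf (fun x => f x + g x).
Proof.
move=> [mf [B fB]] [mg [B' gB]]; split; first exact: measurable_funD.
exists (B + B') => x Dx; apply: le_trans (ler_normD _ _) _.
by apply: lerD; [exact: fB | exact: gB].
Qed.

Lemma bmfM f g : bmf f -> bmf g -> bmf (fun x => f x * g x).
Proof.
move=> [mf [B fB]] [mg [B' gB]]; split; first exact: measurable_funM.
exists (B * B') => x Dx; rewrite normrM.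
by apply: ler_pM => //; [exact: fB | exact: gB].
Qed.

Lemma bmfZ (a : R) f : bmf f -> bmf (fun x => a * f x).
Proof. by move=> bf; apply: bmfM => //; exact: bmf_cst. Qed.

Lemma bmfB f g : bmf f -> bmf g -> bmf (fun x => f x - g x).
Proof.
move=> bf bg; have := bmfD bf (bmfZ (-1) bg).
by under eq_fun do rewrite mulN1r.
Qed.

Lemma bmf_sum (I : Type) (s : seq I) (F : I -> T -> R) :
  (forall i, bmf (F i)) -> bmf (fun x => \sum_(i <- s) F i x).
Proof.
move=> bF; elim: s => [|i s IH].
  by under eq_fun do rewrite big_nil; exact: bmf_cst.
under eq_fun do rewrite big_cons.
by apply: bmfD => //; exact: bF.
Qed.

Lemma bmf_prod (I : Type) (s : seq I) (F : I -> T -> R) :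
  (forall i, bmf (F i)) -> bmf (fun x => \prod_(i <- s) F i x).
Proof.
move=> bF; elim: s => [|i s IH].
  by under eq_fun do rewrite big_nil; exact: bmf_cst.
under eq_fun do rewrite big_cons.
by apply: bmfM => //; exact: bF.
Qed.

Notation int f := (\int[mu]_(x in D) f x).

Lemma bmf_intD f g : bmf f -> bmf g ->
  \int[mu]_(x in D) (f x + g x) = int f + int g.
Proof. by move=> bf bg; rewrite RintegralD //; exact: bmf_integrable. Qed.

Lemma bmf_intB f g : bmf f -> bmf g ->
  \int[mu]_(x in D) (f x - g x) = int f - int g.
Proof. by move=> bf bg; rewrite RintegralB //; exact: bmf_integrable. Qed.

Lemma bmf_intZ (a : R) f : bmf f ->
  \int[mu]_(x in D) (a * f x) = a * int f.
Proof. by move=> bf; rewrite RintegralZl //; exact: bmf_integrable. Qed.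

Lemma bmf_int_cst (a : R) : \int[mu]_(x in D) a = a.
Proof. by rewrite Rintegral_cst // D1 mulr1. Qed.

Lemma bmf_int_sum (I : Type) (s : seq I) (F : I -> T -> R) :
  (forall i, bmf (F i)) ->
  \int[mu]_(x in D) (\sum_(i <- s) F i x) = \sum_(i <- s) int (F i).
Proof.
move=> bF; elim: s => [|i s IH].
  by rewrite big_nil; under eq_Rintegral do rewrite big_nil; rewrite bmf_int_cst.
rewrite big_cons; under eq_Rintegral do rewrite big_cons.
by rewrite bmf_intD ?IH //; apply: bmf_sum.
Qed.

Lemma bmf_int_le f B : bmf f -> (forall x, D x -> `|f x| <= B) -> `|int f| <= B.
Proof.
move=> bf fB; apply: le_trans (le_normr_Rintegral mD (bmf_integrable bf)) _.
rewrite -[leRHS]bmf_int_cst; apply: le_Rintegral => //.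
  apply: bmf_integrable; case: bf => mf [B' fB']; split.
    exact: measurableT_comp.
  by exists B' => x Dx; rewrite normr_id fB'.
by apply: bmf_integrable; exact: bmf_cst.
Qed.

Lemma eq_bmf f g : (forall x, D x -> f x = g x) -> bmf f -> bmf g.
Proof.
move=> fg [mf [B fB]]; split.
  by apply: eq_measurable_fun mf => x /set_mem; exact: fg.
by exists B => x Dx; rewrite -fg ?fB.
Qed.

Lemma eq_Rint f g : (forall x, D x -> f x = g x) -> int f = int g.
Proof. by move=> fg; apply: eq_Rintegral => x /set_mem; exact: fg. Qed.

End BoundedMeasurable.

(** * Hilbert spaces of functions *)

(** Besides Cauchy-Schwarz, this yields in [riesz] the near-stationarity of almost minimisers, with
    [e] bounding the gap to the infimum. The case [a = 0] is included since [ip g g] may vanish. *)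
Lemma discriminant_le0 (R : realType) (a b e : R) : 0 <= a ->
  (forall t, 0 <= e + 2 * t * b + t ^+ 2 * a) -> b ^+ 2 <= a * e.
Proof.
move=> a0 h; have [a_0|an0] := eqVneq a 0.
  rewrite a_0 mul0r; have [->|bn0] := eqVneq b 0; first by rewrite expr0n.
  have := h (- (e + 1) / (2 * b)); rewrite a_0 mulr0 addr0.
  have -> : e + 2 * (- (e + 1) / (2 * b)) * b = -1 by field.
  by rewrite ler0N1.
have ap : 0 < a by rewrite lt_def an0.
have := h (- b / a).
have -> : e + 2 * (- b / a) * b + (- b / a) ^+ 2 * a = (a * e - b ^+ 2) / a.
  by field.
by rewrite pmulr_lge0 ?invr_gt0 // subr_ge0.
Qed.

Section Hilbert.
Context {R : realType} {T : Type}.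
Variables (X : set T) (H : set (T -> R)) (ip : (T -> R) -> (T -> R) -> R).
Hypothesis hH : hilbert_function_space X H ip.
Implicit Types f g : T -> R.

Lemma hfsZD (a : R) f g : H f -> H g -> H (fun x => a * f x + g x).
Proof. exact: hfs_lin hH a f g. Qed.

Lemma hfsB f g : H f -> H g -> H (f \- g).
Proof.
move=> Hf Hg; have := hfsZD (-1) Hg Hf.
by congr H; apply/funext => x /=; rewrite mulN1r addrC.
Qed.

Lemma ipZDl (a : R) f g k : H f -> H g -> H k ->
  ip (fun x => a * f x + g x) k = a * ip f k + ip g k.
Proof. exact: hfs_ip_lin hH a f g k. Qed.

Lemma ipZDr (a : R) f g k : H f -> H g -> H k ->
  ip k (fun x => a * f x + g x) = a * ip k f + ip k g.
Proof.
move=> Hf Hg Hk.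
by rewrite (hfs_ipC hH) ?ipZDl // ?(hfs_ipC hH Hk) //; exact: hfsZD.
Qed.

Lemma ipBl f g k : H f -> H g -> H k -> ip (f \- g) k = ip f k - ip g k.
Proof.
move=> Hf Hg Hk; rewrite (_ : f \- g = fun x => (-1) * g x + f x).
  by rewrite ipZDl // mulN1r addrC.
by apply/funext => x /=; rewrite mulN1r addrC.
Qed.

Lemma ip_sqZD (a : R) f g : H f -> H g ->
  ip (fun x => a * g x + f x) (fun x => a * g x + f x) =
  ip f f + 2 * a * ip f g + a ^+ 2 * ip g g.
Proof.
move=> Hf Hg; have HZ := hfsZD a Hg Hf.
rewrite ipZDl // !ipZDr // (hfs_ipC hH Hg Hf); ring.
Qed.

Lemma cauchy_schwarz f g : H f -> H g -> `|ip f g| <= ip_norm ip f * ip_norm ip g.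
Proof.
move=> Hf Hg; have f0 := hfs_ip_ge0 hH Hf; have g0 := hfs_ip_ge0 hH Hg.
rewrite -(@ler_pXn2r _ 2) ?nnegrE ?mulr_ge0 ?sqrtr_ge0 //.
rewrite exprMn !sqr_sqrtr // real_normK ?num_real // mulrC.
apply: discriminant_le0 => // t; rewrite -ip_sqZD //.
by apply: (hfs_ip_ge0 hH); exact: hfsZD.
Qed.

Section Riesz.
Variables (nu : (T -> R) -> R) (B : R).
Hypothesis nu_lin : forall (a : R) f g, H f -> H g ->
  nu (fun x => a * f x + g x) = a * nu f + nu g.
Hypothesis nu_bounded : forall f, H f -> `|nu f| <= B * ip_norm ip f.

Let J f := ip f f - 2 * nu f.

Let J_lbound f : H f -> - B ^+ 2 <= J f.
Proof.
move=> Hf; have f0 := hfs_ip_ge0 hH Hf.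
have := nu_bounded Hf; rewrite ler_norml => /andP[_ h].
have := sqr_ge0 (ip_norm ip f - B).
have : ip_norm ip f ^+ 2 = ip f f by rewrite sqr_sqrtr.
rewrite /J; nra.
Qed.

Let JZD (a : R) f g : H f -> H g -> J (fun x => a * g x + f x) =
  J f + 2 * a * (ip f g - nu g) + a ^+ 2 * ip g g.
Proof. by move=> Hf Hg; rewrite /J ip_sqZD // nu_lin //; ring. Qed.

(** The representer minimises [J f = ip f f - 2 nu f], which boundedness of [nu] keeps above
    [- B^2]; completeness gives it as the limit of a minimising sequence. *)
Lemma riesz : exists2 xi, H xi & forall f, H f -> nu f = ip f xi.
Proof.
pose S := [set J f | f in H].
have hS : has_inf S.
  split; first by exists (J (fun=> 0)), (fun=> 0) => //; exact: (hfs_zero hH).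
  by exists (- B ^+ 2) => _ [f Hf <-]; exact: J_lbound.
have infJ f : H f -> inf S <= J f.
  by move=> Hf; apply: ge_inf; [case: hS | exists f].
have /choice [u hu] : forall n : nat, exists f, H f /\ J f < inf S + n.+1%:R^-1.
  move=> n; have e0 : 0 < n.+1%:R^-1 :> R by rewrite invr_gt0 ltr0n.
  by have [_ [f Hf <-] h] := inf_adherent e0 hS; exists f.
have Hu n : H (u n) by case: (hu n).
(* For every [t], [J (u n + t g) >= inf S]: a quadratic in [t] whose value at 0 exceeds the infimum
   by less than [1/(n+1)], so its linear coefficient is small. *)
have nearu n g : H g -> (ip (u n) g - nu g) ^+ 2 <= ip g g * n.+1%:R^-1.
  move=> Hg; apply: discriminant_le0; first exact: (hfs_ip_ge0 hH).
  move=> t; have := infJ _ (hfsZD t Hg (Hu n)); rewrite JZD //.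
  have [_] := hu n; move: (J (u n)) (ip (u n) g - nu g) => j b h1 h2.
  by rewrite -(lerD2l (inf S)) addr0; apply: le_trans h2 _; rewrite !addrA !lerD2r ltW.
(* Near-stationarity is tested on [g = u m - u n] itself: [ip g g] is a difference of two quantities
   whose squares are at most [ip g g / (m+1)] and [ip g g / (n+1)]. *)
have cauchy_u m n : ip (u m \- u n) (u m \- u n) <=
    4 * (m.+1%:R^-1 + n.+1%:R^-1).
  set g := u m \- u n; have Hg : H g by exact: hfsB.
  have i0 k : 0 <= k.+1%:R^-1 :> R by rewrite invr_ge0 ler0n.
  have hm := nearu m g Hg; have hn := nearu n g Hg.
  have -> : ip g g = ip (u m) g - ip (u n) g by rewrite {1}/g ipBl.
  rewrite -/g in hm hn *.
  have e : ip g g = (ip (u m) g - nu g) - (ip (u n) g - nu g).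
    by rewrite {1}/g ipBl //; ring.
  have g0 := hfs_ip_ge0 hH Hg.
  have -> : ip (u m) g - ip (u n) g = ip g g by rewrite e; ring.
  move: hm hn e g0 (i0 m) (i0 n); set x := ip (u m) g - nu g.
  set y := ip (u n) g - nu g; set z := ip g g.
  set a := m.+1%:R^-1; set b := n.+1%:R^-1.
  move=> hm hn e z0 a0 b0.
  have : z ^+ 2 <= 2 * (z * a + z * b).
    by rewrite {1}e; have := sqr_ge0 (x + y); nra.
  by have [->|zn0] := eqVneq z 0; [nra | have : 0 < z by rewrite lt_def zn0]; nra.
have [] := hfs_complete hH Hu.
  move=> e e0.
  have [N _ hN] : \forall n \near \oo, n.+1%:R^-1 < e ^+ 2 / 8.
    by apply: (near_infty_natSinv_lt (PosNum _)); rewrite divr_gt0 ?exprn_gt0.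
  exists N => m n Nm Nn.
  rewrite -(@ltr_pXn2r _ 2) ?nnegrE ?sqrtr_ge0 // ?ltW //.
  rewrite sqr_sqrtr; last by apply: (hfs_ip_ge0 hH); exact: hfsB.
  apply: le_lt_trans (cauchy_u m n) _.
  have := hN m Nm; have := hN n Nn => /=.
  move: m.+1%:R^-1 n.+1%:R^-1 (e ^+ 2) => a b c h1 h2; lra.
move=> xi Hxi cvg_xi; exists xi => // f Hf; rewrite (hfs_ipC hH) //.
apply/esym/eqP; rewrite -subr_eq0 -normr_le0; apply/ler_addgt0Pr => e e0.
rewrite add0r.
have /cvgrPdist_lt/(_ (e / (2 * (ip_norm ip f + 1)))) := cvg_xi.
have nf0 : 0 <= ip_norm ip f by exact: sqrtr_ge0.
case; first by rewrite divr_gt0 // mulr_gt0 // ltr_wpDl.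
move=> N1 _ hN1.
have [N2 _ hN2] : \forall n \near \oo,
    n.+1%:R^-1 < (e / (2 * (ip_norm ip f + 1))) ^+ 2.
  apply: (near_infty_natSinv_lt (PosNum _)).
  by rewrite exprn_gt0 // divr_gt0 // mulr_gt0 // ltr_wpDl.
pose n := maxn N1 N2.
have := hN1 n (leq_maxl _ _); rewrite /= sub0r normrN ger0_norm ?sqrtr_ge0 //.
have := hN2 n (leq_maxr _ _); rewrite /=.
set k := e / _ => h2 h1.
have k0 : 0 < k by rewrite divr_gt0 // mulr_gt0 // ltr_wpDl.
have -> : ip xi f - nu f = (ip (u n) f - nu f) - ip (u n \- xi) f.
  by rewrite ipBl //; ring.
apply: le_trans (ler_normB _ _) _.
have -> : e = k * (ip_norm ip f + 1) + k * (ip_norm ip f + 1).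
  by rewrite /k; field; lra.
apply: lerD.
  have kf0 : 0 <= k * (ip_norm ip f + 1) by rewrite mulr_ge0 ?addr_ge0 // ltW.
  rewrite -(@ler_pXn2r _ 2) ?nnegrE // real_normK ?num_real //; apply: le_trans (nearu n f Hf) _.
  have e2 : ip_norm ip f ^+ 2 = ip f f.
    by rewrite sqr_sqrtr // (hfs_ip_ge0 hH).
  rewrite exprMn mulrC -e2; apply: ler_pM; rewrite ?invr_ge0 ?sqr_ge0 ?ler0n //.
    exact: ltW.
  by rewrite ler_pXn2r ?nnegrE ?addr_ge0 // lerDl.
apply: le_trans (cauchy_schwarz (hfsB (Hu n) Hxi) Hf) _.
apply: ler_pM; rewrite ?sqrtr_ge0 ?lerDl //; exact: ltW.
Qed.

End Riesz.
End Hilbert.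

(** * Reproducing kernels: pointwise limits and induction from kernel sections *)

Section RKHS.
Context {R : realType} {T : Type}.
Variables (X : set T) (H : set (T -> R)) (ip : (T -> R) -> (T -> R) -> R).
Variable k : T -> T -> R.
Hypotheses (hH : hilbert_function_space X H ip) (hk : reproducing_kernel X H ip k).

Lemma rkhs_cvg_pointwise (u : nat -> T -> R) f : (forall n, H (u n)) -> H f ->
  ip_norm ip (u n \- f) @[n --> \oo] --> (0 : R) ->
  forall x, u n x @[n --> \oo] --> f x.
Proof.
move=> Hu Hf uf x; have [Xx|nXx] := pselect (X x); last first.
  have -> : (fun n => u n x) = fun=> f x.
    by apply/funext => n; rewrite !(hfs_support hH).
  exact: cvg_cst.
apply/cvgrPdist_le => e e0.
set c := ip_norm ip ((k ^~ x) \_ X).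
have c0 : 0 <= c by exact: sqrtr_ge0.
have /cvgrPdist_le/(_ (e / (c + 1))) := uf.
case; first by rewrite divr_gt0 // ltr_wpDl.
move=> N _ hN; exists N => // n /hN /=; rewrite sub0r normrN ger0_norm ?sqrtr_ge0 //.
rewrite ler_pdivlMr ?ltr_wpDl // => h; rewrite distrC.
have -> : u n x - f x = (u n \- f) x by [].
rewrite (rk_eval hk (hfsB hH (Hu n) Hf) Xx).
apply: le_trans (cauchy_schwarz hH (hfsB hH (Hu n) Hf) (rk_mem hk Xx)) _.
apply: le_trans _ h; rewrite ler_wpM2l ?sqrtr_ge0 // lerDl.
exact: ler01.
Qed.

(* The members of H satisfying P form a closed subspace whose orthogonal
   complement vanishes, since it contains the kernel sections. *)
Lemma rkhs_ind (P : (T -> R) -> Prop) :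
  P (fun=> 0) ->
  (forall (a : R) f g, P f -> P g -> P (fun x => a * f x + g x)) ->
  (forall (u : nat -> T -> R) f, (forall n, P (u n)) ->
    (forall x, u n x @[n --> \oo] --> f x) -> P f) ->
  (forall y, X y -> P ((k ^~ y) \_ X)) ->
  forall f, H f -> P f.
Proof.
move=> P0 Plin Plim Pk f Hf.
pose V := H `&` [set f | P f].
have hV : hilbert_function_space X V ip.
  split.
  - by move=> g [Hg _]; exact: (hfs_support hH).
  - by split => //; exact: (hfs_zero hH).
  - move=> a g1 g2 [H1 P1] [H2 P2]; split; first exact: (hfs_lin hH).
    exact: Plin.
  - by move=> g1 g2 [H1 _] [H2 _]; exact: (hfs_ipC hH).
  - by move=> a g1 g2 g3 [H1 _] [H2 _] [H3 _]; exact: (hfs_ip_lin hH).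
  - by move=> g [Hg _]; exact: (hfs_ip_ge0 hH).
  - by move=> g [Hg _]; exact: (hfs_ip_eq0 hH).
  - move=> u Vu uc; have Hu n : H (u n) by case: (Vu n).
    have [g Hg ug] := hfs_complete hH Hu uc.
    exists g => //; split => //; apply: (Plim u).
      by move=> n; case: (Vu n).
    exact: rkhs_cvg_pointwise ug.
(* Riesz within [V] for the functional [ip^~ f] plays the role of the projection theorem: [v] is the
   projection of [f], and pairing with the kernel sections shows [f = v]. *)
have [|g [Hg _]|v [Hv Pv] fv] := @riesz _ _ _ _ _ hV (ip^~ f) (ip_norm ip f).
- by move=> a g1 g2 [H1 _] [H2 _]; exact: (hfs_ip_lin hH).
- by rewrite mulrC; exact: (cauchy_schwarz hH).
suff -> : f = v by [].
apply/funext => y; have [Xy|nXy] := pselect (X y); last first.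
  by rewrite !(hfs_support hH).
have Hk := rk_mem hk Xy.
rewrite !(rk_eval hk) // (hfs_ipC hH) // fv; last by split => //; exact: Pk.
exact: (hfs_ipC hH).
Qed.

End RKHS.

(** * Composite quadrature rules *)

Section Quadrature.
Variable R : realType.
Implicit Types (f : R -> R) (x t z : R).

(* [x_+^m], with the convention [0_+^0 = 0] *)
Definition tpow (m : nat) x : R := if 0 < x then x ^+ m else 0.

(** The interpolatory rule on the unit interval with nodes [i/a], exact below degree [a]. The right
    end point is not a node, so all nodes of a composite rule lie in half-open cells. The signs of
    [w] are not controlled, whence [weight_sum]. *)
Definition moment_weights (a : nat) (w : 'I_a -> R) := forall r, (r < a)%N ->
  \sum_(i < a) w i * (i%:R / a%:R) ^+ r = r.+1%:R^-1.

Lemma moment_weights_exist (a : nat) : (0 < a)%N ->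
  exists w : 'I_a -> R, moment_weights w.
Proof.
move=> a0.
pose v : 'rV[R]_a := \row_j (j%:R / a%:R).
have Vunit : Vandermonde a v \in unitmx.
  rewrite unitmxE det_Vandermonde unitfE; apply/prodf_neq0 => i _.
  apply/prodf_neq0 => j ij; rewrite !mxE subr_eq0.
  rewrite -subr_eq0 -mulrBl mulf_neq0 ?invr_eq0 ?pnatr_eq0 -?lt0n //.
  by rewrite subr_eq0 eqr_nat; apply: contraTneq ij => ->; rewrite ltnn.
pose b : 'cV[R]_a := \col_i i.+1%:R^-1.
exists (fun i => (invmx (Vandermonde a v) *m b) i 0) => r ra.
have := mulKVmx Vunit b => /matrixP/(_ (Ordinal ra) 0).
rewrite [RHS]mxE /= mxE => <-; apply: eq_bigr => i _.
by rewrite [RHS]mulrC; congr (_ * _); rewrite !mxE.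
Qed.

Section Rule.
Variables (a : nat) (w : 'I_a -> R).
Hypotheses (a0 : (0 < a)%N) (hw : moment_weights w).

Definition rule_node (n q : nat) (i : 'I_a) : R := (q%:R + i%:R / a%:R) / n%:R.

Definition cell_rule (n q : nat) f : R :=
  \sum_(i < a) w i / n%:R * f (rule_node n q i).

Definition composite_rule (n : nat) f : R := \sum_(q < n) cell_rule n q f.

Let aR0 : 0 < a%:R :> R. Proof. by rewrite ltr0n. Qed.

Lemma node_fracP (i : 'I_a) : 0 <= i%:R / a%:R :> R /\ i%:R / a%:R < 1 :> R.
Proof.
by split; [rewrite divr_ge0 ?ler0n | rewrite ltr_pdivrMr // mul1r ltr_nat].
Qed.

Lemma rule_nodeP (n q : nat) (i : 'I_a) : (0 < n)%N ->
  q%:R / n%:R <= rule_node n q i /\ rule_node n q i < q.+1%:R / n%:R.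
Proof.
move=> n0; have nR0 : 0 < n%:R :> R by rewrite ltr0n.
have [i0 i1] := node_fracP i; rewrite /rule_node; split.
  by rewrite ler_pM2r ?invr_gt0 // lerDl.
by rewrite ltr_pM2r ?invr_gt0 // -natr1 ltrD2l.
Qed.

Lemma rule_node_unit (n q : nat) (i : 'I_a) : (q < n)%N ->
  0 <= rule_node n q i <= 1.
Proof.
move=> qn; have n0 : (0 < n)%N by exact: leq_trans qn.
have nR0 : 0 < n%:R :> R by rewrite ltr0n.
have [h1 h2] := rule_nodeP q i n0; apply/andP; split.
  by apply: le_trans h1; rewrite divr_ge0 ?ler0n.
by apply: le_trans (ltW h2) _; rewrite ler_pdivrMr // mul1r ler_nat.
Qed.

(** Expanding in powers of [z] leaves the moments; the identity [C(r,s)/(s+1) = C(r+1,s+1)/(r+1)]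
    sums the result back to the integral of [x^r] over [[z, z+1]]. *)
Lemma moment_shift r z : (r < a)%N ->
  \sum_(i < a) w i * (z + i%:R / a%:R) ^+ r =
  ((z + 1) ^+ r.+1 - z ^+ r.+1) / r.+1%:R.
Proof.
move=> ra.
transitivity (\sum_(s < r.+1) z ^+ (r - s) / s.+1%:R *+ 'C(r, s)).
  under eq_bigr do rewrite exprDn mulr_sumr.
  rewrite exchange_big /=; apply: eq_bigr => s _.
  have sa : (s < a)%N by apply: leq_ltn_trans ra; rewrite -ltnS.
  rewrite -(hw sa) mulr_sumr -sumrMnl; apply: eq_bigr => i _.
  by rewrite !mulrnAr; congr (_ *+ _); ring.
have -> : (z + 1) ^+ r.+1 =
    \sum_(i < r.+2) z ^+ (r.+1 - i) * 1 ^+ i *+ 'C(r.+1, i) by exact: exprDn.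
rewrite [in RHS]big_ord_recl /= subn0 bin0 expr0 mulr1 mulr1n addrAC subrr add0r.
rewrite mulr_suml; apply: eq_bigr => s _; rewrite /bump /= add1n subSS expr1n mulr1.
have : (s.+1%:R * 'C(r.+1, s.+1)%:R = r.+1%:R * 'C(r, s)%:R :> R).
  by rewrite -!natrM -mul_bin_diag.
have s0 : s.+1%:R != 0 :> R by rewrite pnatr_eq0.
have r0 : r.+1%:R != 0 :> R by rewrite pnatr_eq0.
rewrite -[_ / _ *+ 'C(r, s)]mulr_natr -[_ ^+ _ *+ 'C(r.+1, _)]mulr_natr.
move: s.+1%:R r.+1%:R 'C(r.+1, s.+1)%:R 'C(r, s)%:R (z ^+ _) s0 r0.
move=> x y u v zz x0 y0 h.
apply: (mulfI x0); apply: (mulfI y0).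
have -> : y * (x * (zz / x * v)) = zz * (y * v) by field.
have -> : y * (x * (zz * u / y)) = zz * (x * u) by field.
by rewrite h.
Qed.

Lemma cell_rule_poly (n q r : nat) t : (0 < n)%N -> (r < a)%N ->
  cell_rule n q (fun x => (x - t) ^+ r) =
  ((q.+1%:R / n%:R - t) ^+ r.+1 - (q%:R / n%:R - t) ^+ r.+1) / r.+1%:R.
Proof.
move=> n0 ra; have nR0 : n%:R != 0 :> R by rewrite pnatr_eq0 -lt0n.
rewrite /cell_rule /rule_node.
transitivity (n%:R^-1 ^+ r.+1 *
    \sum_(i < a) w i * (q%:R - t * n%:R + i%:R / a%:R) ^+ r).
  rewrite mulr_sumr; apply: eq_bigr => i _.
  have -> : (q%:R + i%:R / a%:R) / n%:R - t =
    n%:R^-1 * (q%:R - t * n%:R + i%:R / a%:R) by field; rewrite nR0 gt_eqF.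
  by rewrite exprMn exprS; ring.
rewrite moment_shift // mulrA mulrBr -!exprMn; congr ((_ ^+ _ - _ ^+ _) / _).
  by rewrite -natr1; field.
by field.
Qed.

Lemma composite_rule_poly (n r : nat) t : (0 < n)%N -> (r < a)%N ->
  composite_rule n (fun x => (x - t) ^+ r) =
  ((1 - t) ^+ r.+1 - (- t) ^+ r.+1) / r.+1%:R.
Proof.
move=> n0 ra; have nR0 : n%:R != 0 :> R by rewrite pnatr_eq0 -lt0n.
rewrite /composite_rule; under eq_bigr do rewrite cell_rule_poly //.
rewrite -mulr_suml.
rewrite -(big_mkord xpredT (fun q => (q.+1%:R / n%:R - t) ^+ r.+1 -
  (q%:R / n%:R - t) ^+ r.+1)) telescope_sumr //.
by rewrite divff // mul0r sub0r.
Qed.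

Lemma tpow_ge0 m x : 0 <= tpow m x.
Proof. by rewrite /tpow; case: ifP => // /ltW; exact: exprn_ge0. Qed.

Lemma tpow_le m x y : 0 <= y -> x <= y -> tpow m x <= y ^+ m.
Proof.
rewrite /tpow => y0 xy; case: ifP => [x0|_]; last exact: exprn_ge0.
by rewrite lerXn2r ?nnegrE // ltW.
Qed.

Definition weight_sum : R := \sum_(i < a) `|w i|.

(** On a cell that misses [t] the truncated power is zero or a polynomial of degree [a - 1], hence
    integrated exactly. On the cell of [t] the integral and the rule are bounded separately: values
    at most [n^-(a-1)], length [1/n]. *)
Lemma cell_rule_tpow (n q : nat) t : (0 < n)%N ->
  `|(tpow a (q.+1%:R / n%:R - t) - tpow a (q%:R / n%:R - t)) / a%:R -
    cell_rule n q (fun x => tpow a.-1 (x - t))| <=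
  (if q%:R / n%:R <= t < q.+1%:R / n%:R then
     (weight_sum + 1) * n%:R^-1 ^+ a else 0).
Proof.
move=> n0; have nR0 : 0 < n%:R :> R by rewrite ltr0n.
have nn : n%:R != 0 :> R by rewrite gt_eqF.
have qq : q%:R / n%:R < q.+1%:R / n%:R :> R.
  by rewrite ltr_pM2r ?invr_gt0 // ltr_nat.
have [tq|qt] := ltP t (q%:R / n%:R); last have [tq|qt'] := ltP t (q.+1%:R / n%:R).
- rewrite andFb /tpow !subr_gt0 tq (lt_trans tq qq).
  have -> : cell_rule n q (fun x => if 0 < x - t then (x - t) ^+ a.-1 else 0) =
      cell_rule n q (fun x => (x - t) ^+ a.-1).
    apply: eq_bigr => i _; have [h _] := rule_nodeP q i n0.
    by rewrite subr_gt0 (lt_le_trans tq h).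
  by rewrite cell_rule_poly ?prednK // subrr normr0.
- rewrite andTb /=; apply: le_trans (ler_normB _ _) _.
  rewrite [leRHS]mulrDl mul1r [leLHS]addrC.
  have hn : q.+1%:R / n%:R - q%:R / n%:R = n%:R^-1 :> R by rewrite -natr1; field.
  apply: lerD; last first.
    have -> : tpow a (q%:R / n%:R - t) = 0.
      by rewrite /tpow subr_gt0 ltNge qt.
    rewrite subr0 ger0_norm ?divr_ge0 ?tpow_ge0 ?ler0n //.
    rewrite ler_pdivrMr //; apply: le_trans (_ : n%:R^-1 ^+ a <= _).
      by apply: tpow_le; [rewrite invr_ge0 ler0n | rewrite -hn; lra].
    by rewrite ler_peMr ?exprn_ge0 ?invr_ge0 ?ler0n // ler1n.
  apply: le_trans (ler_norm_sum _ _ _) _; rewrite mulr_suml.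
  apply: ler_sum => i _; rewrite !normrM -mulrA ler_wpM2l ?normr_ge0 //.
  rewrite -(prednK a0) exprS ger0_norm ?invr_ge0 ?ler0n //.
  rewrite ler_wpM2l ?invr_ge0 ?ler0n // (prednK a0) ger0_norm ?tpow_ge0 //.
  apply: tpow_le; first by rewrite invr_ge0 ler0n.
  by have [_ h] := rule_nodeP q i n0; rewrite -hn; lra.
- rewrite andbF /tpow !subr_gt0 !ltNge qt' (ltW (lt_le_trans qq qt')) /=.
  rewrite subrr mul0r sub0r normrN /cell_rule big1 ?normr0 // => i _.
  have [_ h] := rule_nodeP q i n0.
  by rewrite subr_gt0 ltNge (ltW (lt_le_trans h qt')) mulr0.
Qed.

(** At most one half-open cell contains [t], so the local error [n^-a] is not multiplied by the
    number of cells. *)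
Lemma composite_rule_tpow (n : nat) t : (0 < n)%N -> 0 <= t <= 1 ->
  `|(1 - t) ^+ a / a%:R - composite_rule n (fun x => tpow a.-1 (x - t))| <=
  (weight_sum + 1) * n%:R^-1 ^+ a.
Proof.
move=> n0 /andP[t0 t1]; have nR0 : 0 < n%:R :> R by rewrite ltr0n.
have B0 : 0 <= (weight_sum + 1) * n%:R^-1 ^+ a.
  by rewrite mulr_ge0 ?exprn_ge0 ?invr_ge0 ?ler0n // addr_ge0 ?sumr_ge0.
have -> : (1 - t) ^+ a / a%:R =
    \sum_(q < n) (tpow a (q.+1%:R / n%:R - t) - tpow a (q%:R / n%:R - t)) / a%:R.
  rewrite -mulr_suml -(big_mkord xpredT (fun q => tpow a (q.+1%:R / n%:R - t) -
    tpow a (q%:R / n%:R - t))) telescope_sumr //.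
  rewrite divff ?gt_eqF // mul0r sub0r [tpow a (- t)]/tpow oppr_gt0 ltNge t0 subr0.
  rewrite /tpow subr_gt0; case: ltP => // t1'.
  have -> : t = 1 by apply/eqP; rewrite eq_le t1.
  by rewrite subrr expr0n; case: a a0.
rewrite -sumrB; apply: le_trans (ler_norm_sum _ _ _) _.
apply: le_trans (ler_sum _ (fun (q : 'I_n) _ => cell_rule_tpow q t n0)) _.
have [/existsP[q0 hq0]|] := boolP
    [exists q : 'I_n, q%:R / n%:R <= t < q.+1%:R / n%:R].
  rewrite (bigD1 q0) //= hq0 big1 ?addr0 // => q qq0; case: ifP => // hq.
  move: hq hq0 => /andP[]; rewrite ler_pdivrMr // ltr_pdivlMr // => h1 h2.
  move=> /andP[]; rewrite ler_pdivrMr // ltr_pdivlMr // => h3 h4.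
  have := le_lt_trans h1 h4; have := le_lt_trans h3 h2.
  rewrite !ltr_nat !ltnS => h5 h6; case/eqP: qq0; apply/val_inj/eqP.
  by rewrite eqn_leq h5 h6.
rewrite negb_exists => /forallP h; rewrite big1 // => q _.
by rewrite (negbTE (h q)).
Qed.

End Rule.
End Quadrature.

(** * Peano kernels *)

Section UnitIntegrals.
Variable R : realType.
Notation leb := (@lebesgue_measure R).
Notation I := (@unitI R).
Notation MR := (measurableTypeR R).
Notation ubmf := (@bmf _ (measurableTypeR R) R (@unitI R)).

Lemma unitIE (x : R) : I x = (0 <= x <= 1) :> Prop.
Proof. by rewrite /unitI /= in_itv. Qed.

Lemma measurable_unitI : measurable (I : set MR). Proof. exact: measurable_itv. Qed.

Lemma lebesgue_unitI : leb I = 1%E.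
Proof. by rewrite /unitI lebesgue_measure_itv /= lte_fin ltr01 oppr0 adde0. Qed.

Let mI := measurable_unitI.
Let I1 := lebesgue_unitI.

Definition uint_integrable := @bmf_integrable _ MR R leb I mI I1.
Definition uint_D := @bmf_intD _ MR R leb I mI I1.
Definition uint_B := @bmf_intB _ MR R leb I mI I1.
Definition uint_Z := @bmf_intZ _ MR R leb I mI I1.
Definition uint_cst := @bmf_int_cst _ MR R leb I mI I1.
Definition uint_sum := @bmf_int_sum _ MR R leb I mI I1.
Definition uint_le := @bmf_int_le _ MR R leb I mI I1.

Lemma bmf2_Fubini (f : R -> R -> R) (B : R) :
  measurable_fun setT (fun z : MR * MR => f z.1 z.2) ->
  (forall x y, I x -> I y -> `|f x y| <= B) ->
  [/\ forall y, I y -> ubmf (f^~ y), forall x, I x -> ubmf (f x),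
      ubmf (fun x => \int[leb]_(y in I) f x y) &
  \int[leb]_(x in I) (\int[leb]_(y in I) f x y) =
  \int[leb]_(y in I) (\int[leb]_(x in I) f x y)].
Proof.
move=> mf fB.
have mx x : measurable_fun setT (f x).
  exact: (measurableT_comp mf (measurable_fun_pair (measurable_cst x) (@measurable_id _ _ _))).
have my y : measurable_fun setT (f^~ y).
  exact: (measurableT_comp mf (measurable_fun_pair (@measurable_id _ _ _) (measurable_cst y))).
have b1 y : I y -> ubmf (f^~ y).
  move=> Iy; split; first exact: measurable_funS (my y).
  by exists B => x Ix; exact: fB.
have b2 x : I x -> ubmf (f x).
  move=> Ix; split; first exact: measurable_funS (mx x).
  by exists B => y Iy; exact: fB.
pose F : MR * MR -> \bar R := ((EFin \o (fun z => f z.1 z.2)) \_ (I `*` I)).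
have intF : (leb \x leb)%E.-integrable setT F.
  have mII : measurable ((I : set MR) `*` (I : set MR)) by exact: measurableX.
  have := (@integrable_mkcond _ _ _ (leb \x leb)%E _ (EFin \o (fun z : MR * MR => f z.1 z.2)) mII); move=> h; apply/h => {h}; apply: measurable_bounded_integrable.
  - exact: mII.
  - rewrite [X in (X < _)%E](_ : _ = 1%E) ?ltry //; transitivity (leb I * leb I)%E; [exact: product_measure1E | by rewrite I1 mule1].
  - exact: measurable_funS mf.
  - exists B; split; first exact: num_real.
    move=> z Bz [x y] /= [Ix Iy]; apply: le_trans (fB _ _ Ix Iy) (ltW Bz).
have F1 x : (\int[leb]_y F (x, y) =
    ((EFin \o (fun x => (\int[leb]_(y in I) f x y)%R)) \_ I) x)%E.
  rewrite patchE; case: ifPn => xI; last first.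
    rewrite integral0_eq // => y _; rewrite /F patchE; case: ifPn => //.
    by rewrite inE => -[/= Ix _]; rewrite mem_set in xI.
  rewrite /= /Rintegral fineK; last first.
    exact: (integrable_fin_num mI (uint_integrable (b2 x (set_mem xI)))).
  rewrite [RHS]integral_mkcond; apply: eq_integral => y _.
  rewrite /F !patchE; congr (if _ then _ else _).
  apply/idP/idP; first by rewrite inE => -[_ /= Iy]; rewrite mem_set.
  by move=> yI; apply/mem_set; split => /=; exact: set_mem.
have F2 y : (\int[leb]_x F (x, y) =
    ((EFin \o (fun y => (\int[leb]_(x in I) f x y)%R)) \_ I) y)%E.
  rewrite patchE; case: ifPn => yI; last first.
    rewrite integral0_eq // => x _; rewrite /F patchE; case: ifPn => //.
    by rewrite inE => -[_ /= Iy]; rewrite mem_set in yI.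
  rewrite /= /Rintegral fineK; last first.
    exact: (integrable_fin_num mI (uint_integrable (b1 y (set_mem yI)))).
  rewrite [RHS]integral_mkcond; apply: eq_integral => x _.
  rewrite /F !patchE; congr (if _ then _ else _).
  apply/idP/idP; first by rewrite inE => -[/= Ix _]; rewrite mem_set.
  by move=> xI; apply/mem_set; split => /=; exact: set_mem.
split => //.
  split.
    apply/measurable_EFinP/measurable_restrictT => //.
    have := measurable_fubini_F intF; rewrite /fubini_F.
    by under eq_fun do rewrite F1.
  exists B => x Ix; apply: (uint_le (b2 x Ix)) => y Iy; exact: fB.
rewrite /Rintegral; congr fine; rewrite [LHS]integral_mkcond [RHS]integral_mkcond.
transitivity (\int[leb]_x (\int[leb]_y F (x, y)))%E.
  by apply: eq_integral => x _; rewrite F1.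
etransitivity; first exact: (Fubini intF).
by apply: eq_integral => y _; exact: F2.
Qed.

End UnitIntegrals.

Section PowerIntegrals.
Variable R : realType.
Notation leb := (@lebesgue_measure R).
Implicit Types t x : R.

Lemma is_derive_shiftX t x m :
  is_derive x (1 : R) (fun y : R => (y - t) ^+ m.+1) (m.+1%:R * (x - t) ^+ m).
Proof.
have h : is_derive x (1 : R) (fun y : R => y - t) 1.
  by apply: is_derive_eq; rewrite subr0.
have -> : (fun y : R => (y - t) ^+ m.+1) = (fun y => y - t) ^+ m.+1.
  by apply/funext => y; rewrite exprfctE.
by apply: is_derive_eq (is_deriveX m.+1 h) _; rewrite /GRing.scale /= !mulr1.
Qed.

Lemma integral_shiftX (u v t : R) m : u <= v ->
  \int[leb]_(x in `[u, v]) (x - t) ^+ m =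
  ((v - t) ^+ m.+1 - (u - t) ^+ m.+1) / m.+1%:R.
Proof.
rewrite le_eqVlt => /predU1P[->|uv].
  by rewrite subrr mul0r set_itv1 Rintegral_set1.
have m0 : m.+1%:R != 0 :> R by rewrite pnatr_eq0.
have d x : is_derive x (1 : R) (fun y : R => (y - t) ^+ m.+1 / m.+1%:R) ((x - t) ^+ m).
  have -> : (fun y : R => (y - t) ^+ m.+1 / m.+1%:R) =
      (m.+1%:R^-1 \*: (fun y : R => (y - t) ^+ m.+1)).
    by apply/funext => y; rewrite /= /GRing.scale /= mulrC.
  apply: is_derive_eq (is_deriveZ _ (is_derive_shiftX t x m)) _.
  by rewrite /GRing.scale /= mulrA mulVf // mul1r.
have cF (x : R) : {for x, continuous (fun y : R => (y - t) ^+ m.+1 / m.+1%:R)}.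
  by apply: differentiable_continuous; apply/derivable1_diffP; exact: ex_derive.
rewrite /Rintegral (@continuous_FTC2 _ _ (fun y : R => (y - t) ^+ m.+1 / m.+1%:R)) //.
- by rewrite /= mulrBl.
- apply: continuous_subspaceT => x; case: m {m0 d cF} => [|m].
    by under eq_fun do rewrite expr0; exact: cst_continuous.
  apply: differentiable_continuous; apply/derivable1_diffP.
  exact: (@ex_derive _ _ _ _ _ _ _ (is_derive_shiftX t x m)).
- split.
  + by move=> x _; exact: ex_derive.
  + by apply: cvg_at_right_filter; exact: cF.
  + by apply: cvg_at_left_filter; exact: cF.
- by move=> x _; rewrite derive1E; exact: derive_val.
Qed.
End PowerIntegrals.

(** * Monomials and Peano kernels as features *)

Section Features.
Variable R : realType.
Notation leb := (@lebesgue_measure R).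
Notation I := (@unitI R).
Notation MR := (measurableTypeR R).
Notation ubmf := (@bmf _ (measurableTypeR R) R (@unitI R)).
Implicit Types t x : R.

Lemma measurable_tpow m : measurable_fun setT (tpow m : MR -> R).
Proof.
apply: measurable_fun_ifT; last 2 first.
- exact: exprn_measurable.
- exact: measurable_cst.
by apply: (@measurable_fun_ltr _ MR R setT) => //; exact: measurable_cst.
Qed.

Lemma bmf_shiftX t m : ubmf (fun x => (x - t) ^+ m).
Proof.
split.
  apply: (@measurable_funS _ _ MR R setT) => //.
  by apply: measurable_funX; apply: measurable_funB => //; exact: measurable_cst.
exists ((1 + `|t|) ^+ m) => x; rewrite unitIE => /andP[x0 x1].
rewrite normrX lerXn2r ?nnegrE ?addr_ge0 //.
by apply: le_trans (ler_normB _ _) _; rewrite lerD2r ger0_norm.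
Qed.

Lemma integral_tpow m t : I t ->
  \int[leb]_(x in I) tpow m (x - t) = (1 - t) ^+ m.+1 / m.+1%:R.
Proof.
rewrite unitIE => /andP[t0 t1].
have e : `]t, 1]%classic = I `&` `]t, +oo[%classic.
  rewrite /unitI; apply/seteqP; split => x /=; rewrite !in_itv /= ?andbT.
    by move=> /andP[tx x1]; rewrite x1 tx (le_trans t0 (ltW tx)).
  by move=> [/andP[_ ->] ->].
transitivity (\int[leb]_(x in `[t, 1]) (x - t) ^+ m); last first.
  by rewrite integral_shiftX // subrr expr0n /= subr0.
rewrite -Rintegral_itv_obnd_cbnd; last first.
  apply: integrableS (uint_integrable (bmf_shiftX t m)).
  - exact: measurable_unitI.
  - exact: measurable_itv.
  - by rewrite e => x [].
rewrite e Rintegral_mkcondr; apply: eq_Rintegral => x _.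
rewrite patchE /tpow subr_gt0; case: ltP => tx.
  by rewrite mem_set //= in_itv /= tx.
by rewrite memNset //= in_itv /= andbT; apply/negP; rewrite -leNgt.
Qed.

Variables (a : nat) (c : R).
Hypotheses (a0 : (0 < a)%N) (Ic : I c).

(** Kernel of the Taylor remainder at [c]: the two terms cancel for [t < min x c], which leaves
    [(x-t)^(a-1)/(a-1)!] for [c <= t < x] and its negative for [x <= t < c]. *)
Definition peano x t : R :=
  (tpow a.-1 (x - t) - (if t < c then (x - t) ^+ a.-1 else 0)) / (a.-1)`!%:R.

(* An index [inl r] stands for the polynomial of degree [r], [inr t] for the Peano
   kernel at [t]. *)
Definition feature (tau : nat + R) x : R :=
  match tau with
  | inl r => (x - c) ^+ r / r`!%:R
  | inr t => peano x t
  end.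

Definition feature_index (tau : nat + R) : Prop :=
  match tau with inl r => (0 < r < a)%N | inr t => I t end.

Definition feature_mean (tau : nat + R) : R := \int[leb]_(x in I) feature tau x.

Lemma feature_anchor tau : feature_index tau -> feature tau c = 0.
Proof.
case: tau => [r|t] /=; first by case: r => //= r _; rewrite subrr expr0n mul0r.
move=> _; rewrite /peano /tpow subr_gt0; case: ltP => tc.
  by rewrite subrr mul0r.
by rewrite subrr mul0r.
Qed.

Lemma measurable_peano : measurable_fun setT (fun z : MR * MR => peano z.1 z.2).
Proof.
have mB : measurable_fun setT (fun z : MR * MR => z.1 - z.2).
  by apply: measurable_funB; [exact: measurable_fst|exact: measurable_snd].
apply: measurable_funM; last exact: measurable_cst.
apply: measurable_funB; first exact: measurableT_comp (measurable_tpow _) mB.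
apply: measurable_fun_ifT.
- apply: measurable_fun_ltr; [exact: measurable_snd|exact: measurable_cst].
- exact: measurable_funX.
- exact: measurable_cst.
Qed.

Lemma fact_ge1 n : 1 <= n`!%:R :> R.
Proof. by rewrite ler1n fact_gt0. Qed.

Lemma div_fact_le (y : R) n : 0 <= y -> y / n`!%:R <= y.
Proof.
move=> y0; rewrite ler_pdivrMr ?(lt_le_trans ltr01 (fact_ge1 n)) //.
by rewrite ler_peMr ?fact_ge1.
Qed.

Lemma unit_dist_le1 x t : I x -> I t -> `|x - t| <= 1.
Proof. by rewrite !unitIE => /andP[? ?] /andP[? ?]; rewrite ler_norml; lra. Qed.

Lemma feature_le tau x : feature_index tau -> I x -> `|feature tau x| <= 2.
Proof.
case: tau => [r|t] /= ht Ix; rewrite normrM [X in _ * X]ger0_norm ?invr_ge0 ?ler0n //;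
  apply: le_trans (div_fact_le _ (normr_ge0 _)) _.
  rewrite normrX; apply: (@le_trans _ _ 1); last by lra.
  by rewrite exprn_ile1 // unit_dist_le1.
have h1 : `|(x - t) ^+ a.-1| <= 1 by rewrite normrX exprn_ile1 // unit_dist_le1.
apply: le_trans (ler_normB _ _) _.
have -> : (2 : R) = 1 + 1 by [].
apply: lerD; rewrite /tpow.
  by case: ifP; rewrite ?normr0.
by case: ifP; rewrite ?normr0.
Qed.

Lemma feature_bmf tau : feature_index tau -> ubmf (feature tau).
Proof.
move=> ht; split; last by exists 2 => x Ix; exact: feature_le.
apply: (@measurable_funS _ _ MR R setT) => //.
case: tau ht => [r|t] /= ht.
  apply: measurable_funM; last exact: measurable_cst.
  by apply: measurable_funX; apply: measurable_funB => //; exact: measurable_cst.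
exact: (measurableT_comp measurable_peano
  (measurable_fun_pair (@measurable_id _ _ _) (measurable_cst t))).
Qed.

Lemma feature_mean_le tau : feature_index tau -> `|feature_mean tau| <= 2.
Proof.
by move=> ht; apply: (uint_le (feature_bmf ht)) => x Ix; exact: feature_le.
Qed.

Lemma feature_bmf_index x : I x -> ubmf (fun t => feature (inr t) x).
Proof.
move=> Ix; split; last by exists 2 => t It; exact: feature_le.
apply: (@measurable_funS _ _ MR R setT) => //.
exact: (measurableT_comp measurable_peano
  (measurable_fun_pair (measurable_cst x) (@measurable_id _ _ _))).
Qed.

Lemma feature_mean_inr t : I t -> feature_mean (inr t) =
  ((1 - t) ^+ a / a%:R - (if t < c then ((1 - t) ^+ a - (- t) ^+ a) / a%:R else 0))
  / (a.-1)`!%:R.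
Proof.
move=> It; rewrite /feature_mean /= /peano.
have b1 : ubmf (fun x => tpow a.-1 (x - t)).
  split.
    apply: (@measurable_funS _ _ MR R setT) => //.
    apply: measurableT_comp; first exact: measurable_tpow.
    by apply: measurable_funB => //; exact: measurable_cst.
  exists 1 => x Ix; rewrite /tpow; case: ifP; rewrite ?normr0 // normrX => _.
  by rewrite exprn_ile1 // unit_dist_le1.
have b3 : ubmf (fun x => if t < c then (x - t) ^+ a.-1 else 0).
  by case: (t < c); [exact: bmf_shiftX | exact: bmf_cst].
transitivity (\int[leb]_(x in I) ((a.-1)`!%:R^-1 * (tpow a.-1 (x - t) -
    (if t < c then (x - t) ^+ a.-1 else 0)))).
  by apply: eq_Rintegral => x _; rewrite mulrC.
rewrite uint_Z; last exact: bmfB.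
rewrite uint_B // mulrC integral_tpow // prednK //; congr ((_ - _) / _).
case: ifP => _; last exact: uint_cst.
by rewrite integral_shiftX ?prednK // sub0r.
Qed.

Variable w : 'I_a -> R.
Hypothesis hw : moment_weights w.

(** Polynomials below degree [a] are integrated exactly, so neither the monomials nor the polynomial
    correction in [peano] contribute; the error is that of a single truncated power. *)
Lemma feature_rule_error tau n : feature_index tau -> (0 < n)%N ->
  `|feature_mean tau - composite_rule w n (feature tau)| <=
  (weight_sum w + 1) * n%:R^-1 ^+ a.
Proof.
move=> ht n0; have n0R : 0 < n%:R :> R by rewrite ltr0n.
have ruleZ f (k : R) : composite_rule w n (fun x => f x / k) =
    composite_rule w n f / k.
  rewrite /composite_rule mulr_suml; apply: eq_bigr => q _.
  by rewrite /cell_rule mulr_suml; apply: eq_bigr => i _; rewrite mulrA.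
have ruleB f g : composite_rule w n (fun x => f x - g x) =
    composite_rule w n f - composite_rule w n g.
  rewrite /composite_rule -sumrB; apply: eq_bigr => q _.
  by rewrite /cell_rule -sumrB; apply: eq_bigr => i _; rewrite mulrBr.
have B0 : 0 <= (weight_sum w + 1) * n%:R^-1 ^+ a.
  by rewrite mulr_ge0 ?exprn_ge0 ?invr_ge0 ?ler0n // addr_ge0 ?sumr_ge0.
case: tau ht => [r /andP[r0 ra]|t It].
  rewrite /feature ruleZ composite_rule_poly // /feature_mean /feature.
  under eq_Rintegral do rewrite mulrC.
  rewrite uint_Z; last exact: bmf_shiftX.
  by rewrite integral_shiftX // sub0r mulrC subrr normr0.
have -> : composite_rule w n (feature (inr t)) =
   (composite_rule w n (fun x => tpow a.-1 (x - t)) -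
    (if t < c then ((1 - t) ^+ a - (- t) ^+ a) / a%:R else 0)) / (a.-1)`!%:R.
  rewrite ruleZ ruleB; congr ((_ - _) / _); case: ifP => _.
    by rewrite composite_rule_poly ?prednK.
  rewrite /composite_rule big1 // => q _; rewrite /cell_rule big1 // => i _.
  by rewrite mulr0.
rewrite feature_mean_inr // -mulrBl opprB addrA subrK normrM.
rewrite [X in _ * X]ger0_norm ?invr_ge0 ?ler0n //.
apply: le_trans (div_fact_le _ (normr_ge0 _)) _.
by apply: composite_rule_tpow => //; rewrite -unitIE.
Qed.

End Features.

(** * Pairing of features, and integration as a mean feature *)

Section FeaturePairing.
Variable R : realType.
Notation leb := (@lebesgue_measure R).
Notation I := (@unitI R).
Notation MR := (measurableTypeR R).
Notation ubmf := (@bmf _ (measurableTypeR R) R (@unitI R)).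
Variables (a : nat) (c : R).
Hypotheses (a0 : (0 < a)%N) (Ic : I c).
Implicit Types phi psi : nat + R -> R.

(** Inner product of the direct sum of [R^(a-1)] and [L2] of the unit interval, modelled on
    [sobolev_ip]. *)
Definition feature_pairing phi psi : R :=
  \sum_(1 <= r < a) phi (inl r) * psi (inl r) +
  \int[leb]_(t in I) (phi (inr t) * psi (inr t)).

Definition feature_fun phi := ubmf (fun t => phi (inr t)).

Lemma feature_pairingC phi psi : feature_pairing phi psi = feature_pairing psi phi.
Proof.
rewrite /feature_pairing; congr (_ + _).
  by apply: eq_bigr => r _; rewrite mulrC.
by apply: eq_Rintegral => t _; rewrite mulrC.
Qed.

(* Expanding the pairing in one coordinate at a time leaves an average of
   products of two signed sums, each covered by the hypotheses. *)
Lemma tensor_pairing_bound (N : nat) (u : seq nat) (Phi : 'I_N -> nat -> nat + R -> R)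
    (b b' : 'I_N -> R) (B B' : R) : uniq u ->
  (forall i j, feature_fun (Phi i j)) ->
  (forall tau : nat -> nat + R, (forall j, feature_index a (tau j)) ->
    `|\sum_(i < N) b i * \prod_(j <- u) Phi i j (tau j)| <= B) ->
  (forall tau : nat -> nat + R, (forall j, feature_index a (tau j)) ->
    `|\sum_(i < N) b' i * \prod_(j <- u) Phi i j (tau j)| <= B') ->
  `|\sum_(i < N) \sum_(k < N) b i * b' k *
    \prod_(j <- u) feature_pairing (Phi i j) (Phi k j)| <= a%:R ^+ size u * (B * B').
Proof.
move=> uu hPhi; elim: u uu b b' => [|j u IH] /=.
  move=> _ b b' hB hB'; rewrite mul1r.
  have tau0 : forall j : nat, feature_index a ((fun=> inr 0) j : nat + R).
    by move=> j /=; rewrite unitIE lexx ler01.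
  have := hB _ tau0; have := hB' _ tau0.
  under eq_bigr do rewrite big_nil mulr1.
  under [X in _ -> `|X| <= _ -> _]eq_bigr do rewrite big_nil mulr1.
  move=> h' h; under eq_bigr do under eq_bigr do rewrite big_nil mulr1.
  under eq_bigr do rewrite -mulr_sumr.
  by rewrite -mulr_suml normrM; apply: ler_pM.
move=> /andP[ju uu] b b' hB hB'.
(* The double sum with coordinate [j] frozen at the index [tau]. The features at [j] are absorbed in
   the coefficients, which brings it under the induction hypothesis. *)
pose T (tau : nat + R) := \sum_(i < N) \sum_(k < N)
  (b i * Phi i j tau) * (b' k * Phi k j tau) *
  \prod_(l <- u) feature_pairing (Phi i l) (Phi k l).
have hT tau : feature_index a tau -> `|T tau| <= a%:R ^+ size u * (B * B').
  move=> htau.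
  have upd (d : 'I_N -> R) (D : R) : (forall tau : nat -> nat + R,
      (forall j, feature_index a (tau j)) ->
      `|\sum_(i < N) d i * \prod_(l <- j :: u) Phi i l (tau l)| <= D) ->
    forall tau', (forall l, feature_index a (tau' l)) ->
    `|\sum_(i < N) d i * Phi i j tau * \prod_(l <- u) Phi i l (tau' l)| <= D.
    move=> hD tau' htau'.
    have := hD (fun l => if l == j then tau else tau' l).
    have h l : feature_index a (if l == j then tau else tau' l).
      by case: ifP.
    move=> /(_ h); congr (`|_| <= _); apply: eq_bigr => i _.
    rewrite big_cons eqxx mulrA; congr (_ * _).
    rewrite !big_seq; apply: eq_bigr => l lu.
    by case: eqP => // lj; rewrite -lj lu in ju.
  by apply: IH => //; exact: upd.
have -> : \sum_(i < N) \sum_(k < N) b i * b' k *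
    \prod_(l <- j :: u) feature_pairing (Phi i l) (Phi k l) =
  \sum_(1 <= r < a) T (inl r) + \int[leb]_(t in I) T (inr t).
  have bT i k : ubmf (fun t => (b i * Phi i j (inr t)) * (b' k * Phi k j (inr t)) *
      \prod_(l <- u) feature_pairing (Phi i l) (Phi k l)).
    apply: bmfM; last exact: bmf_cst.
    by apply: bmfM; apply: bmfZ; exact: hPhi.
  rewrite uint_sum; last by move=> i; apply: bmf_sum.
  rewrite [X in _ = X + _]exchange_big /= -big_split /=; apply: eq_bigr => i _.
  rewrite uint_sum // [X in _ = X + _]exchange_big /= -big_split /=; apply: eq_bigr => k _.
  rewrite big_cons {1}/feature_pairing mulrA mulrDr mulrDl; congr (_ + _).
    by rewrite mulr_sumr mulr_suml; apply: eq_bigr => r _; ring.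
  have -> : \int[leb]_(t in I) (b i * Phi i j (inr t) * (b' k * Phi k j (inr t)) *
     \prod_(l <- u) feature_pairing (Phi i l) (Phi k l)) = 
    \int[leb]_(t in I) ((b i * b' k * \prod_(l <- u) feature_pairing (Phi i l) (Phi k l)) *
      (Phi i j (inr t) * Phi k j (inr t))).
    by apply: eq_Rintegral => t _; ring.
  rewrite uint_Z; last by apply: bmfM; exact: hPhi.
  by ring.
have BB : 0 <= a%:R ^+ size u * (B * B').
  have tau0 : feature_index a (inr 0 : nat + R) by rewrite /= unitIE lexx ler01.
  exact: le_trans (hT _ tau0).
have -> : a%:R ^+ (size u).+1 * (B * B') =
    (a.-1)%:R * (a%:R ^+ size u * (B * B')) + a%:R ^+ size u * (B * B').
  by rewrite exprS -mulrA -{1}(prednK a0) -natr1; ring.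
apply: le_trans (ler_normD _ _) _; apply: lerD.
  apply: le_trans (ler_norm_sum _ _ _) _.
  rewrite big_nat; apply: (@le_trans _ _ (\sum_(1 <= r < a) a%:R ^+ size u * (B * B'))).
    rewrite [leRHS]big_nat; apply: ler_sum => r ra; exact: hT.
  by rewrite sumr_const_nat subn1 mulr_natl.
apply: uint_le.
  apply: bmf_sum => i; apply: bmf_sum => k; apply: bmfM; last exact: bmf_cst.
  by apply: bmfM; apply: bmfZ; exact: hPhi.
by move=> t It; apply: hT.
Qed.

Definition point_feature (x : R) : nat + R -> R := fun tau => feature a c tau x.

Definition mean_feature : nat + R -> R := feature_mean a c.

Definition pkernel (x y : R) : R := feature_pairing (point_feature x) (point_feature y).

Lemma feature_fun_point x : I x -> feature_fun (point_feature x).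
Proof. exact: feature_bmf_index. Qed.

Let peano2 (h : R -> R) : ubmf h ->
  [/\ ubmf (fun t => \int[leb]_(x in I) peano a c x t),
      ubmf (fun x => \int[leb]_(t in I) (peano a c x t * h t)) &
      \int[leb]_(x in I) (\int[leb]_(t in I) (peano a c x t * h t)) =
      \int[leb]_(t in I) (h t * \int[leb]_(x in I) peano a c x t)].
Proof.
move=> [mh [B hB]].
pose hI : MR -> R := h \_ I.
have mhI : measurable_fun setT hI.
  exact: (iffLR (measurable_restrictT (h : MR -> R) (@measurable_unitI R)) mh).
have mp := measurable_peano a c.
have mf : measurable_fun setT (fun z : MR * MR => peano a c z.1 z.2 * hI z.2).
  apply: measurable_funM => //; exact: (measurableT_comp mhI (@measurable_snd _ _ MR MR)).
have pB x t : I x -> I t -> `|peano a c x t| <= 2.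
  by move=> Ix It; exact: (@feature_le _ _ _ Ic (inr t)).
have fB x t : I x -> I t -> `|peano a c x t * hI t| <= 2 * B.
  move=> Ix It; rewrite normrM ler_pM //; first exact: pB.
  by rewrite /hI patchE mem_set // hB.
have hIE t : I t -> hI t = h t by move=> It; rewrite /hI patchE mem_set.
have [_ _ b1 e1] := bmf2_Fubini mf fB.
have mp' : measurable_fun setT (fun z : MR * MR => peano a c z.2 z.1).
  exact: (measurableT_comp mp (measurable_fun_pair (@measurable_snd _ _ MR MR) (@measurable_fst _ _ MR MR))).
have [_ _ b2 _] := bmf2_Fubini mp' (fun t x It Ix => pB x t Ix It).
split.
- exact: b2.
- apply: eq_bmf b1 => x Ix; apply: eq_Rint => t It; by rewrite hIE.
- transitivity (\int[leb]_(x in I) \int[leb]_(t in I) (peano a c x t * hI t)).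
    by apply: eq_Rint => x Ix; apply: eq_Rint => t It; rewrite hIE.
  rewrite e1; apply: eq_Rint => t It.
  rewrite -uint_Z; last exact: (@feature_bmf _ _ _ Ic (inr t) It).
  by apply: eq_Rint => x Ix; rewrite mulrC hIE.
Qed.

Lemma feature_fun_mean : feature_fun mean_feature.
Proof. by have [] := peano2 (bmf_cst I 0). Qed.

(** By Fubini, integrating in [x] acts on the feature vector alone. The integral is thus represented
    by one more vector, on a par with the point evaluations. *)
Lemma mean_pairing psi : feature_fun psi ->
  ubmf (fun x => feature_pairing (point_feature x) psi) /\
  \int[leb]_(x in I) feature_pairing (point_feature x) psi =
  feature_pairing mean_feature psi.
Proof.
move=> hpsi; have [_ b e] := peano2 hpsi.
have bm r : ubmf (fun x => point_feature x (inl r)).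
  by apply: bmfM; [exact: bmf_shiftX | exact: bmf_cst].
have bs : ubmf (fun x => \sum_(1 <= r < a) point_feature x (inl r) * psi (inl r)).
  by apply: bmf_sum => r; apply: bmfM; [exact: bm | exact: bmf_cst].
split; first exact: bmfD.
rewrite uint_D //; congr (_ + _).
  rewrite uint_sum => [|r]; last by apply: bmfM; [exact: bm | exact: bmf_cst].
  apply: eq_bigr => r _; rewrite [RHS]mulrC -uint_Z; last exact: bm.
  by apply: eq_Rint => x _; rewrite mulrC.
by rewrite e; apply: eq_Rint => t _; rewrite mulrC.
Qed.

(** The interval lies on the side of [c] where the mean is, up to factorials, a single power:
    [(1-t)^a] to the right and [(-t)^a] to the left, with base at least 1/4 in absolute value. *)
Lemma mean_feature_ge t : t \in (if c <= 2^-1 then `[2^-1, 3/4] else `[4^-1, 2^-1]) ->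
  4^-1 ^+ a / a%:R / (a.-1)`!%:R <= `|mean_feature (inr t)|.
Proof.
move=> tJ; have It : I t.
  by rewrite unitIE; move: tJ; case: ifP => _; rewrite in_itv /= => /andP[? ?]; lra.
rewrite /mean_feature feature_mean_inr // normrM [X in _ <= _ * X]ger0_norm ?invr_ge0 ?ler0n //.
rewrite ler_wpM2r ?invr_ge0 ?ler0n //.
have q0 : 0 <= 4^-1 :> R by rewrite invr_ge0.
move: tJ; case: ifP => c2; rewrite in_itv /= => /andP[t1 t2].
  rewrite ifF; last by apply/negbTE; rewrite -leNgt; lra.
  rewrite subr0 ger0_norm; last by rewrite divr_ge0 ?ler0n // exprn_ge0 //; lra.
  by rewrite ler_wpM2r ?invr_ge0 ?ler0n // lerXn2r ?nnegrE //; lra.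
rewrite ifT; last by move/negbT: c2; rewrite -ltNge; lra.
rewrite -mulrBl opprB addrC subrK normrM normrX normrN.
rewrite [X in _ <= _ * X]ger0_norm ?invr_ge0 ?ler0n //.
by rewrite ler_wpM2r ?invr_ge0 ?ler0n // lerXn2r ?nnegrE ?ger0_norm //; lra.
Qed.

(** Becomes [0 < kernel_C0 K], which allows bounds on [gam_hat] to be turned into bounds on
    [gam]. *)
Lemma mean_pairing_gt0 : 0 < feature_pairing mean_feature mean_feature.
Proof.
set J : set MR := [set` (if c <= 2^-1 then `[2^-1, 3/4] else `[4^-1, 2^-1])].
set k := 4^-1 ^+ a / a%:R / (a.-1)`!%:R : R.
have k0 : 0 < k.
  by rewrite !divr_gt0 ?exprn_gt0 ?invr_gt0 ?ltr0n ?fact_gt0.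
have JI : I `&` J = J.
  apply/setIidr => t; rewrite /J unitIE /=.
  by case: ifP => _; rewrite in_itv /= => /andP[? ?]; lra.
have mJ : measurable J by exact: measurable_itv.
have J4 : leb J = (4^-1)%:E.
  rewrite /J; case: ifP => _; rewrite lebesgue_measure_itv /= lte_fin.
    rewrite ifT; last by lra.
    by rewrite -EFinB; congr EFin; lra.
  rewrite ifT; last by lra.
  by rewrite -EFinB; congr EFin; lra.
have bmm : ubmf (fun t => mean_feature (inr t) * mean_feature (inr t)).
  by apply: bmfM; exact: feature_fun_mean.
apply: (@lt_le_trans _ _ (k ^+ 2 * 4^-1)).
  by rewrite mulr_gt0 ?exprn_gt0 // invr_gt0.
have -> : k ^+ 2 * 4^-1 = \int[leb]_(t in I) ((fun=> k ^+ 2) \_ J) t.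
  rewrite -Rintegral_mkcondr JI Rintegral_cst //.
  by transitivity (k ^+ 2 * fine (leb J)); first by rewrite J4.
rewrite /feature_pairing -[leLHS]add0r; apply: lerD.
  by apply: sumr_ge0 => r _; rewrite -expr2 sqr_ge0.
apply: le_Rintegral.
- exact: measurable_unitI.
- apply: uint_integrable; split.
    apply: (@measurable_funS _ _ MR R setT) => //.
    by apply: (iffLR (measurable_restrictT _ mJ)); exact: measurable_cst.
  exists (k ^+ 2) => t _; rewrite patchE; case: ifP => _.
    by rewrite ger0_norm // sqr_ge0.
  by rewrite normr0 sqr_ge0.
- exact: uint_integrable.
- move=> t It; rewrite patchE -expr2; case: ifPn => [tJ|_]; last exact: sqr_ge0.
  rewrite -[leRHS]real_normK ?num_real // lerXn2r ?nnegrE ?(ltW k0) //.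
  by apply: mean_feature_ge; rewrite inE in tJ.
Qed.

End FeaturePairing.

(** * The kernel of the anchored Sobolev space *)

Section UnitDerivative.
Variable R : realType.
Notation I := (@unitI R).
Implicit Types (f g : R -> R) (x t s : R).

Definition unit_deriv f x (l : R) :=
  diffq f x y @[y --> within (I `\ x) (nbhs x)] --> l.

(** Properness makes limits unique, so that [lim] in [deriv_unitI] can be computed. A step of
    [min (e/2) (1/2)], to the right or to the left of [x], stays in the interval. *)
Lemma unit_dnbhs_proper x : I x -> ProperFilter (within (I `\ x) (nbhs x)).
Proof.
rewrite unitIE => /andP[x0 x1]; apply: within_nbhs_proper => U /nbhs_ballP[e /= e0 eU].
pose d := Num.min (e / 2) 2^-1.
have d0 : 0 < d by rewrite lt_min divr_gt0 //= invr_gt0.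
have [de d2] : d <= e / 2 /\ d <= 2^-1.
  by split; rewrite ge_min lexx ?orbT.
case: (leP x 2^-1) => x2.
  exists (x + d); split.
    split; first by rewrite /= unitIE; lra.
    by move=> /= /eqP; rewrite -subr_eq0 addrC addKr => /eqP dd; rewrite dd ltxx in d0.
  by apply: eU; rewrite /ball /= opprD addNKr normrN gtr0_norm //; lra.
exists (x - d); split.
  split; first by rewrite /= unitIE; lra.
  by move=> /= /eqP; rewrite -subr_eq0 addrC addKr oppr_eq0 => /eqP dd; rewrite dd ltxx in d0.
by apply: eU; rewrite /ball /= opprB addrC subrK gtr0_norm //; lra.
Qed.

Lemma deriv_unitI_eq f x l : I x -> unit_deriv f x l ->
  deriv_unitI f x = l /\ derivable_unitI f x.
Proof.
move=> Ix fl; have := unit_dnbhs_proper Ix => ?; split.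
  exact: cvg_lim fl.
by apply/cvg_ex; exists l.
Qed.

(** Members of the space are extended by zero and so differ from their formulas off [I]; derivatives
    within [I] do not see this. *)
Lemma eq_unit_deriv f g x : (forall y, I y -> f y = g y) -> I x ->
  diffq f x @ within (I `\ x) (nbhs x) = diffq g x @ within (I `\ x) (nbhs x).
Proof.
move=> fg Ix; apply/seteqP; split => A h.
  suff : nbhs x (fun y => (I `\ x) y -> A (diffq g x y)) by [].
  have : nbhs x (fun y => (I `\ x) y -> A (diffq f x y)) by [].
  by apply: filterS => y {}h [Iy yx]; rewrite /diffq -!fg //; exact: h.
suff : nbhs x (fun y => (I `\ x) y -> A (diffq f x y)) by [].
have : nbhs x (fun y => (I `\ x) y -> A (diffq g x y)) by [].
by apply: filterS => y {}h [Iy yx]; rewrite /diffq !fg //; exact: h.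
Qed.

Lemma eq_deriv_unitI f g x : (forall y, I y -> f y = g y) -> I x ->
  deriv_unitI f x = deriv_unitI g x.
Proof. by move=> fg Ix; rewrite /deriv_unitI (eq_unit_deriv fg Ix). Qed.

Lemma eq_derivable_unitI f g x : (forall y, I y -> f y = g y) -> I x ->
  derivable_unitI f x = derivable_unitI g x.
Proof. by move=> fg Ix; rewrite /derivable_unitI (eq_unit_deriv fg Ix). Qed.

Lemma is_derive_unit f x l : is_derive x 1 f l -> unit_deriv f x l.
Proof.
case=> df dl.
have h : diffq f x y @[y --> x^'] --> l.
  rewrite -dl; move: df => /cvg_ex [k hk].
  have -> : 'D_1 f x = k by rewrite /derive; apply: cvg_lim.
  apply/cvgrPdist_lt => e e0; move/cvgrPdist_lt: hk => /(_ e e0).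
  rewrite /dnbhs /within /= => /nbhs_ballP [d /= d0 hd].
  apply/nbhs_ballP; exists d => //= y xy yx.
  have := hd (y - x); rewrite /ball /= sub0r normrN distrC => /(_ xy).
  rewrite subr_eq0 => /(_ yx); rewrite /diffq.
  by rewrite /GRing.scale /= mulr1 subrK mulrC.
apply: cvg_trans h; apply: cvg_app => A hA.
suff : nbhs x (fun y => (I `\ x) y -> A y) by [].
have : nbhs x (fun y => y != x -> A y) by [].
apply: filterS => y h [_ yx]; apply: h.
by apply/eqP => yx'; apply: yx.
Qed.

Lemma near_is_derive f g x l : is_derive x 1 f l ->
  (\forall y \near x, f y = g y) -> is_derive x 1 g l.
Proof.
move=> [df dl] fg; split; first exact: near_eq_derivable df.
by rewrite -(near_eq_derive _ fg).
Qed.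

End UnitDerivative.

(** * Splines and their derivatives within the unit interval *)

Section TruncatedPowers.
Variable R : realType.
Notation I := (@unitI R).
Implicit Types (f g : R -> R) (x t s : R).

Lemma unit_deriv_lin f g x l l' (k : R) : unit_deriv f x l -> unit_deriv g x l' ->
  unit_deriv (fun y => (f y - g y) / k) x ((l - l') / k).
Proof.
move=> hf hg; rewrite /unit_deriv.
have -> : diffq (fun y => (f y - g y) / k) x =
    (fun y => (diffq f x y - diffq g x y) * k^-1).
  by apply/funext => y; rewrite /diffq; ring.
by apply: cvgM; [exact: cvgB | exact: cvg_cst].
Qed.

Lemma is_derive_tpow m s x : x != s ->
  is_derive x (1 : R) (fun y : R => tpow m.+1 (y - s)) (m.+1%:R * tpow m (x - s)).
Proof.
move=> xs; case: (ltP s x) => sx.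
  rewrite {2}/tpow subr_gt0 sx; apply: near_is_derive (is_derive_shiftX s x m) _.
  near=> y; rewrite /tpow subr_gt0 ifT //.
  by near: y; exact: lt_nbhsr.
have {xs}xs : x < s by rewrite lt_neqAle xs.
rewrite {2}/tpow subr_gt0 ltNge sx mulr0.
apply: near_is_derive (is_derive_cst 0 x 1) _.
near=> y; rewrite /tpow subr_gt0 ifF //; apply/negbTE; rewrite -leNgt ltW //.
by near: y; exact: lt_nbhsl.
Unshelve. all: by end_near. Qed.

(** The hypothesis excludes only the kink of the first power. At its knot, a higher power has
    difference quotient [(y-s)^m] on the right and 0 on the left. *)
Lemma unit_deriv_tpow m s x : m.+1%:R != 1 :> R \/ x != s ->
  unit_deriv (fun y => tpow m.+1 (y - s)) x (m.+1%:R * tpow m (x - s)).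
Proof.
have [<-|xs _] := eqVneq x s; last by apply: is_derive_unit; exact: is_derive_tpow.
case => //; case: m => [|m _]; first by rewrite eqxx.
rewrite /unit_deriv /tpow subrr ltxx mulr0.
apply/cvgrPdist_lt => e e0.
suff : nbhs x (fun y => (I `\ x) y -> `|0 -
    diffq (fun y0 => if 0 < y0 - x then (y0 - x) ^+ m.+2 else 0) x y| < e) by [].
apply/nbhs_ballP; exists (Num.min e 1); first by rewrite /= lt_min e0 ltr01.
move=> y; rewrite /ball /= distrC lt_min => /andP[ye y1] [_ yx].
rewrite /diffq subrr ltxx subr0 sub0r normrN.
case: (ltP 0 (y - x)) => xy; last by rewrite mul0r normr0.
rewrite exprS mulrC mulKf ?gt_eqF // normrX; apply: le_lt_trans ye.
by rewrite exprS ler_piMr // exprn_ile1 // ltW.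
Qed.

Variable c : R.

(** At degree [a.-1] with knot [t] this is [peano a c x t]. Freeing the degree gives access to
    degree [a], whose [a]-th derivative is a step function: the indicator of [x > s], lowered by 1
    when [s < c]. *)
Definition spline m s x : R :=
  (tpow m (x - s) - (if s < c then (x - s) ^+ m else 0)) / m`!%:R.

Lemma spline_anchor m s : spline m s c = 0.
Proof.
rewrite /spline /tpow subr_gt0; case: ltP => sc.
  by rewrite subrr mul0r.
by rewrite subrr mul0r.
Qed.

Lemma mul_div_factS (y : R) m : m.+1%:R * y / (m.+1)`!%:R = y / m`!%:R.
Proof.
by rewrite factS natrM; field; rewrite nat1r !pnatr_eq0 -lt0n fact_gt0.
Qed.

Lemma unit_deriv_spline m s x : m.+1%:R != 1 :> R \/ x != s ->
  unit_deriv (spline m.+1 s) x (spline m s x).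
Proof.
move=> h.
have h2 : unit_deriv (fun y => if s < c then (y - s) ^+ m.+1 else 0) x
    (m.+1%:R * (if s < c then (x - s) ^+ m else 0)).
  case: (s < c); first by apply: is_derive_unit; exact: is_derive_shiftX.
  by rewrite mulr0; apply: is_derive_unit; exact: is_derive_cst.
have := unit_deriv_lin (k := (m.+1)`!%:R) (unit_deriv_tpow h) h2.
by rewrite -mulrBr mul_div_factS.
Qed.

Lemma unit_deriv_monomial m x : 
  unit_deriv (fun y => (y - c) ^+ m.+1 / (m.+1)`!%:R) x ((x - c) ^+ m / m`!%:R).
Proof.
have h : unit_deriv (fun y => (y - c) ^+ m.+1) x (m.+1%:R * (x - c) ^+ m).
  by apply: is_derive_unit; exact: is_derive_shiftX.
have h0 : unit_deriv (fun=> 0) x 0 by apply: is_derive_unit; exact: is_derive_cst.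
have := unit_deriv_lin (k := (m.+1)`!%:R) h h0; rewrite subr0.
under [X in unit_deriv X]eq_fun do rewrite subr0.
by rewrite mul_div_factS.
Qed.

End TruncatedPowers.

(** * Explicit members of the Sobolev space *)

Section SobolevMembers.
Variable R : realType.
Notation leb := (@lebesgue_measure R).
Notation I := (@unitI R).
Notation MR := (measurableTypeR R).
Notation ubmf := (@bmf _ (measurableTypeR R) R (@unitI R)).
Implicit Types (f g : R -> R) (x t s : R).

Lemma ubmf_restrict_Lfun2 (f : MR -> R) : ubmf f ->
  (f \_ I : MR -> R) \in Lfun leb 2%:E.
Proof.
move=> bf; have [mf [B fB]] := bf.
have mI := @measurable_unitI R.
have mfI : measurable_fun setT (f \_ I : MR -> R).
  exact: (iffLR (measurable_restrictT _ mI) mf).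
apply/andP; split; first by rewrite inE /=.
rewrite inE /= /finite_norm unlock.
apply: poweR_lty.
rewrite [X in (X < _)%E](_ : _ = \int[leb]_(x in I) (f x * f x)%:E)%E; last first.
  rewrite [RHS]integral_mkcond; apply: eq_integral => x _.
  rewrite /= !patchE; case: ifP => _ /=.
    by rewrite powR_mulrn // real_normK ?num_real // expr2.
  by rewrite normr0 powR0.
have h := uint_integrable (bmfM bf bf).
have := integrable_fin_num mI h.
by rewrite fin_numE => /andP[_]; rewrite lt_neqAle leey andbT.
Qed.

Lemma bmf_change_point (f g : MR -> R) s : ubmf g ->
  (forall x, I x -> x != s -> f x = g x) -> ubmf f.
Proof.
move=> bg fg.
have b1 : ubmf (\1_[set s] : MR -> R).
  split; last by exists 1 => x _; rewrite indicE ger0_norm ?ler0n // lern1 leq_b1.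
  apply: (@measurable_funS _ _ MR R setT) => //.
apply: eq_bmf (bmfD bg (bmfZ (f s - g s) b1)) => x Ix /=.
rewrite indicE; have [->|xs] := eqVneq x s.
  by rewrite mem_set // mulr1 addrC subrK.
by rewrite memNset ?mulr0 ?addr0 ?fg //; apply/eqP.
Qed.

Lemma lipschitz_abs_continuous f (L : R) : 0 <= L ->
  (forall x y, I x -> I y -> `|f x - f y| <= L * `|x - y|) ->
  abs_continuous_unitI f.
Proof.
move=> L0 fL e e0; exists (e / (L + 1)); first by rewrite divr_gt0 // ltr_wpDl.
move=> n u v huv _; rewrite ltr_pdivlMr ?ltr_wpDl // => h.
apply: le_lt_trans h; rewrite mulr_suml; apply: ler_sum => i _.
have [u0 [uv v1]] := huv i.
have := fL (v i) (u i); rewrite !unitIE => /(_ _ _)/le_trans; apply.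
- lra.
- lra.
- by rewrite ger0_norm ?subr_ge0 // mulrC ler_wpM2l ?subr_ge0 // lerDl.
Qed.

Lemma derivn_chain f (g : nat -> R -> R) n : (forall x, I x -> f x = g 0%N x) ->
  (forall j x, (j < n)%N -> I x -> unit_deriv (g j) x (g j.+1 x)) ->
  forall j, (j <= n)%N -> forall x, I x -> derivn_unitI j f x = g j x.
Proof.
move=> fg0 gS; elim => [|j IH] jn x Ix /=; first exact: fg0.
rewrite (@eq_deriv_unitI _ _ (g j)) // => [|y Iy]; last by apply: IH => //; exact: ltnW.
by have [] := deriv_unitI_eq Ix (gS j x jn Ix).
Qed.

Variables (a : nat) (c : R).
Hypotheses (a0 : (0 < a)%N) (Ic : I c).

(** [g j] plays the [j]-th derivative. The last step may fail at one point [s], as it does for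
    splines of degree [a]; the Lipschitz bound on [g a.-1] gives absolute continuity across that
    point. *)
Lemma sobolev_chain (g : nat -> R -> R) (s L : R) : 0 <= L -> g 0%N c = 0 ->
  (forall j x, (j < a.-1)%N -> I x -> unit_deriv (g j) x (g j.+1 x)) ->
  (forall x y, I x -> I y -> `|g a.-1 x - g a.-1 y| <= L * `|x - y|) ->
  (forall x, I x -> x != s -> unit_deriv (g a.-1) x (g a x)) ->
  ubmf (g a) ->
  [/\ sobolev a c (g 0%N \_ I),
      forall j x, (j < a)%N -> I x -> derivn_unitI j (g 0%N \_ I) x = g j x &
      forall x, I x -> x != s -> derivn_unitI a (g 0%N \_ I) x = g a x].
Proof.
move=> L0 g0c gS gL ga bga.
have f0 x : I x -> (g 0%N \_ I) x = g 0%N x by move=> Ix; rewrite patchE mem_set.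
have fE := derivn_chain f0 gS.
have fa x : I x -> x != s -> derivn_unitI a (g 0%N \_ I) x = g a x.
  move=> Ix xs; rewrite -{1}(prednK a0) /=.
  rewrite (@eq_deriv_unitI _ _ (g a.-1)) // => [|y Iy]; last exact: fE.
  by have [] := deriv_unitI_eq Ix (ga x Ix xs).
split => //.
- split.
  + by move=> x nIx; rewrite patchE memNset.
  + by rewrite f0.
  + move=> r x ra Ix; rewrite (@eq_derivable_unitI _ _ (g r)) //.
      by have [] := deriv_unitI_eq Ix (gS r x ra Ix).
    by move=> y Iy; apply: fE => //; exact: ltnW.
  + apply: (lipschitz_abs_continuous L0) => x y Ix Iy.
    by rewrite !fE //; exact: gL.
  + by apply: ubmf_restrict_Lfun2; exact: bmf_change_point bga fa.
- by move=> j x ja Ix; apply: fE => //; rewrite -ltnS prednK.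
Qed.

End SobolevMembers.

(** * Identification of the kernel from the reproducing property *)

Section SobolevKernel.
Variable R : realType.
Notation leb := (@lebesgue_measure R).
Notation I := (@unitI R).
Notation MR := (measurableTypeR R).
Notation ubmf := (@bmf _ (measurableTypeR R) R (@unitI R)).
Variables (a : nat) (c : R) (K : R -> R -> R).
Hypotheses (a0 : (0 < a)%N) (Ic : I c).
Hypothesis hK : reproducing_kernel I (sobolev a c) (sobolev_ip a c) K.
Implicit Types (f g : R -> R) (x y t s : R).

Let Ks y : R -> R := (K ^~ y) \_ I.
Let kap y : MR -> R := derivn_unitI a (Ks y).
Let mI := @measurable_unitI R.

#[local] Instance ae_lebesgue_filter : Filter (nbhs (almost_everywhere leb)).
Proof. exact: (ae_filter_ringOfSetsType leb). Qed.

Lemma ae_eq_Rint (f g : MR -> R) : measurable_fun I f -> measurable_fun I g ->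
  {ae leb, forall x, I x -> f x = g x} ->
  \int[leb]_(x in I) f x = \int[leb]_(x in I) g x.
Proof.
move=> mf mg fg; congr fine; apply: ae_eq_integral => //.
- exact/measurable_EFinP.
- exact/measurable_EFinP.
- by apply: filterS fg => x h Ix; rewrite (h Ix).
Qed.

Lemma ae_neq s : {ae leb, forall x, x != s}.
Proof.
exists [set s]; split; [exact: (@measurable_set1 R) | exact: lebesgue_measure_set1 |].
by move=> x /= /negP; rewrite negbK => /eqP.
Qed.

Let Ks_mem y : I y -> sobolev a c (Ks y). Proof. exact: (rk_mem hK). Qed.

Let kap_Lfun y : I y -> (kap y \_ I : MR -> R) \in Lfun leb 2%:E.
Proof. by move=> /Ks_mem[]. Qed.

Let kap_restrict_measurable y : I y -> measurable_fun setT (kap y \_ I : MR -> R).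
Proof.
by move=> /kap_Lfun/andP[]; rewrite inE.
Qed.

Let kap_measurable y : I y -> measurable_fun I (kap y).
Proof.
by move=> Iy; exact: (iffRL (measurable_restrictT _ mI) (kap_restrict_measurable Iy)).
Qed.

Let kap_integrable y : I y -> leb.-integrable setT (EFin \o (kap y \_ I : MR -> R)).
Proof.
move=> Iy; apply/Lfun1_integrable.
have h1 : ((cst 1 : MR -> R) \_ I : MR -> R) \in Lfun leb 2%:E.
  exact: ubmf_restrict_Lfun2 (bmf_cst _ _).
suff -> : (kap y \_ I : MR -> R) = (kap y \_ I) \* ((cst 1 : MR -> R) \_ I).
  exact: Lfun2_mul_Lfun1 (kap_Lfun Iy) h1.
apply/funext => x /=; rewrite !patchE.
by case: ifP => _; rewrite ?mulr1 ?mulr0.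
Qed.

(** The kernel is still unknown here; each explicit chain [g] turns the reproducing property at [y]
    into one equation for the derivatives of [Ks y] at [c] and for [kap y]. *)
Lemma sobolev_eval_chain (g : nat -> R -> R) (s L y : R) : I y -> 0 <= L ->
  g 0%N c = 0 ->
  (forall j x, (j < a.-1)%N -> I x -> unit_deriv (g j) x (g j.+1 x)) ->
  (forall x x', I x -> I x' -> `|g a.-1 x - g a.-1 x'| <= L * `|x - x'|) ->
  (forall x, I x -> x != s -> unit_deriv (g a.-1) x (g a x)) ->
  ubmf (g a) ->
  g 0%N y = \sum_(1 <= r < a) g r c * derivn_unitI r (Ks y) c +
    \int[leb]_(t in I) (g a t * kap y t).
Proof.
move=> Iy L0 g0 gS gL ga bga.
have [fS fr fa] := sobolev_chain a0 Ic L0 g0 gS gL ga bga.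
have := rk_eval hK fS Iy; rewrite patchE mem_set // => ->.
rewrite /sobolev_ip; congr (_ + _).
  by rewrite !big_nat; apply: eq_bigr => r /andP[_ ra]; rewrite fr.
apply: ae_eq_Rint.
- apply: measurable_funM; last exact: kap_measurable.
  by have [] := bmf_change_point bga fa.
- by apply: measurable_funM; [case: bga | exact: kap_measurable].
- by apply: filterS (ae_neq s) => x xs Ix; rewrite fa.
Qed.

(** Tested on [(x-c)^r/r!], whose derivatives at [c] form a Kronecker delta and whose [a]-th
    derivative vanishes, the equation isolates the [r]-th derivative. *)
Let Ks_deriv_anchor y r : I y -> (0 < r < a)%N ->
  derivn_unitI r (Ks y) c = (y - c) ^+ r / r`!%:R.
Proof.
move=> Iy /andP[r0 ra].
pose g j x : R := if (j <= r)%N then (x - c) ^+ (r - j) / (r - j)`!%:R else 0.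
have gS j x : unit_deriv (g j) x (g j.+1 x).
  rewrite /g; case: (ltngtP j r) => jr.
  - rewrite -[(r - j)%N]prednK ?subn_gt0 // -subnS.
    exact: unit_deriv_monomial.
  - by apply: is_derive_unit; exact: is_derive_cst.
  - by rewrite jr subnn; apply: is_derive_unit; exact: (is_derive_cst (1 / 1 : R)).
have gc k : g k c = (k == r)%:R.
  rewrite /g subrr expr0n subn_eq0; case: (ltngtP k r) => kr //=; first by rewrite mul0r.
  by rewrite kr subnn divr1.
have := @sobolev_eval_chain g c 0 y Iy (lexx _).
rewrite gc eq_sym gtn_eqF //= => /(_ erefl) h.
have {}h := h (fun j x _ _ => gS j x).
have <- : g 0%N y = (y - c) ^+ r / r`!%:R by rewrite /g leq0n subn0.
rewrite h.
- rewrite (bigD1_seq r) ?iota_uniq ?mem_index_iota ?r0 //= gc eqxx mul1r big1.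
    rewrite addr0 -[LHS]addr0; congr (_ + _).
    rewrite -[LHS](@uint_cst R 0); apply: eq_Rint => t _.
    by rewrite /g leqNgt ra mul0r.
  by move=> k kr; rewrite gc (negbTE kr) mul0r.
- move=> x x' _ _; rewrite mul0r normr_le0 /g.
  have : (r <= a.-1)%N by rewrite -ltnS prednK.
  rewrite leq_eqVlt => /predU1P[<-|ra']; first by rewrite subnn !expr0 subrr.
  by rewrite leqNgt ra' subrr.
- by move=> x _ _; rewrite -{2}(prednK a0).
- by rewrite /g leqNgt ra; exact: bmf_cst.
Qed.

Let tpow1_lipschitz x y : `|tpow 1 x - tpow 1 y| <= `|x - y| :> R.
Proof.
rewrite /tpow !expr1; case: (ltP 0 x) => x0; case: (ltP 0 y) => y0 //.
- by rewrite subr0 !ger0_norm; lra.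
- by rewrite sub0r normrN distrC !ger0_norm; lra.
- by rewrite subrr normr0.
Qed.

Let spline0_bmf s : ubmf (spline c 0 s).
Proof.
rewrite /spline; apply: bmfM; last exact: bmf_cst.
apply: bmfB; last by case: (s < c); exact: bmf_cst.
split.
  apply: (@measurable_funS _ _ MR R setT) => //.
  apply: measurableT_comp; first exact: measurable_tpow.
  by apply: measurable_funB => //; exact: measurable_cst.
by exists 1 => x _; rewrite /tpow; case: ifP; rewrite ?normr0 ?normr1.
Qed.

(** The derivatives of the spline below order [a] vanish at [c], so only the integral against its
    [a]-th derivative, a step function with jump at [s], survives. *)
Let spline_integral y s : I y ->
  spline c a s y = \int[leb]_(t in I) (spline c 0 s t * kap y t).
Proof.
move=> Iy; have := @sobolev_eval_chain (fun j => spline c (a - j) s) s 2 y Iy.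
rewrite subn0 subnn => ->; first last.
- exact: spline0_bmf.
- move=> x _ xs; have -> : (a - a.-1)%N = 1%N by case: a a0 => // n _; rewrite subSnn.
  by apply: unit_deriv_spline; right.
- move=> x x' _ _; have -> : (a - a.-1)%N = 1%N by case: a a0 => // n _; rewrite subSnn.
  rewrite /spline (_ : 1`!%N = 1%N) // !divr1 !expr1.
  have subACA (p q p' q' : R) : p - q - (p' - q') = (p - p') - (q - q') by ring.
  rewrite subACA.
  rewrite mulrDl mul1r; apply: le_trans (ler_normB _ _) _; apply: lerD.
    by apply: le_trans (tpow1_lipschitz _ _) _; rewrite opprB addrA subrK.
  case: ifP => _; last by rewrite subrr normr0.
  by rewrite opprB addrA subrK.
- move=> j x ja Ix; rewrite -[(a - j)%N]prednK ?subn_gt0; last first.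
    by apply: leq_trans ja _; exact: leq_pred.
  rewrite -subnS; apply: unit_deriv_spline; left.
  rewrite pnatr_eq1; apply/eqP => -[/eqP]; rewrite subn_eq0 leqNgt => /negP; apply.
  by rewrite -(prednK a0) ltnS.
- exact: spline_anchor.
- exact: ler0n.
- by rewrite big1 ?add0r // => r _; rewrite spline_anchor mul0r.
Qed.

Let is_derive_shiftX_rev m s y :
  is_derive s (1 : R) (fun s : R => (y - s) ^+ m.+1) (- (m.+1%:R * (y - s) ^+ m)).
Proof.
have e k z : (y - z) ^+ k = (-1) ^+ k * (z - y) ^+ k.
  by rewrite -exprMn mulN1r opprB.
have -> : (fun s : R => (y - s) ^+ m.+1) = (-1) ^+ m.+1 \*: (fun s => (s - y) ^+ m.+1).
  by apply/funext => z /=; rewrite e.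
apply: is_derive_eq (is_deriveZ _ (is_derive_shiftX y s m)) _.
by rewrite /GRing.scale /= e exprS; ring.
Qed.

Let is_derive_tpow_rev m s y : s != y ->
  is_derive s (1 : R) (fun s : R => tpow m.+1 (y - s)) (- (m.+1%:R * tpow m (y - s))).
Proof.
move=> sy.
have hX := is_derive_shiftX_rev m s y.
case: (ltP s y) => sy'.
  rewrite {2}/tpow subr_gt0 sy'; apply: near_is_derive hX _.
  near=> z; rewrite /tpow subr_gt0 ifT //.
  by near: z; exact: lt_nbhsl.
have {sy'}sy' : y < s by rewrite lt_neqAle eq_sym sy.
rewrite {2}/tpow subr_gt0 ltNge (ltW sy') mulr0 oppr0.
apply: near_is_derive (is_derive_cst 0 s 1) _.
near=> z; rewrite /tpow subr_gt0 ifF //; apply/negbTE; rewrite -leNgt ltW //.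
by near: z; exact: lt_nbhsr.
Unshelve. all: by end_near. Qed.

Let near_ltc_eq s : s != c -> \forall z \near s, (z < c) = (s < c).
Proof.
move=> sc; case: (ltP s c) => sc'; near=> z.
  by have -> : z < c by near: z; exact: lt_nbhsl.
apply/negbTE; rewrite -leNgt ltW //; near: z; apply: lt_nbhsr.
by rewrite lt_neqAle eq_sym sc.
Unshelve. all: by end_near. Qed.

Let is_derive_spline_rev s y : s != y -> s != c ->
  is_derive s (1 : R) (fun s : R => spline c a s y) (- peano a c y s).
Proof.
move=> sy sc; rewrite -(prednK a0) /spline /peano /=; set m := a.-1.
have hX := is_derive_shiftX_rev m s y.
pose b := if s < c then (1 : R) else 0.
have h : is_derive s (1 : R) ((m.+1)`!%:R^-1 \*: ((fun s : R => tpow m.+1 (y - s)) -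
    (b \*: (fun s : R => (y - s) ^+ m.+1))))
    (- ((tpow m (y - s) - (if s < c then (y - s) ^+ m else 0)) / m`!%:R)).
  apply: is_derive_eq (is_deriveZ _ (is_deriveB (is_derive_tpow_rev m sy) (is_deriveZ b hX))) _.
  rewrite /GRing.scale /= -(mul_div_factS _ m) /b.
  by case: ifP => _; ring.
apply: near_is_derive h _.
near=> z; rewrite /b /=; rewrite fctE /= mulrC /GRing.scale /=.
have -> : (z < c) = (s < c) by near: z; exact: near_ltc_eq.
by case: ifP => _; rewrite opprfctE /= /GRing.scale /= ?mul1r ?mul0r.
Unshelve. all: by end_near. Qed.

(* The splines are members of the space, so evaluating them through the kernel
   yields every primitive of [kap y]; Lebesgue differentiation does the rest. *)
Lemma kernel_deriv_ae y : I y -> {ae leb, forall t, I t -> kap y t = peano a c y t}.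
Proof.
move=> Iy; pose k : MR -> R := kap y \_ I.
pose Phi s := (\int[leb]_(t in `]-oo, s]) k t).
have ki := kap_integrable Iy.
have PhiE s : Phi s = \int[leb]_(t in I) ((kap y \_ `]-oo, s]) t).
  rewrite /Phi -Rintegral_mkcondr setIC Rintegral_mkcondr.
  by [].
(* For [s < c] the step function is minus the indicator of [t <= s]; otherwise it is the indicator
   of [t > s], and the total integral enters. [A] is locally constant off [c], so it does not affect
   the derivative of [Phi]. *)
pose A s := if s < c then 0 else \int[leb]_(t in I) kap y t.
have kI : leb.-integrable I (EFin \o kap y).
  by apply/(integrable_mkcond _ mI); rewrite restrict_EFin.
have PhiS s : Phi s = A s - spline c a s y.
  have mP : measurable (`]-oo, s]%classic : set MR) by exact: measurable_itv.
  have fI : leb.-integrable I (EFin \o (kap y \_ `]-oo, s])).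
    rewrite -restrict_EFin; apply: (iffLR (integrable_restrict _ mP mI _)).
    by apply: integrableS kI => //; exact: measurableI.
  have gI : leb.-integrable I (EFin \o (fun t => if s < c then 0 else kap y t)).
    by case: (s < c) => //; apply: uint_integrable; exact: bmf_cst.
  rewrite (spline_integral s Iy) PhiE.
  transitivity (A s - (A s - \int[leb]_(t in I) ((kap y \_ `]-oo, s]) t))).
    by rewrite opprB addrC subrK.
  congr (_ - _); have -> : A s = \int[leb]_(t in I) (if s < c then 0 else kap y t).
    by rewrite /A; case: (s < c) => //; rewrite uint_cst.
  rewrite -RintegralB //; apply: eq_Rint => t It.
  rewrite patchE /spline /tpow subr_gt0 !expr0 fact0 divr1.
  case: (leP t s) => ts.
    rewrite mem_set /= ?in_itv //= sub0r.
    by case: ifP => _; rewrite ?mulN1r ?sub0r ?oppr0 ?mul0r ?subrr.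
  rewrite memNset /= ?in_itv /=; last by apply/negP; rewrite -ltNge.
  by case: ifP => _; rewrite ?subrr ?subr0 ?mul0r ?mul1r.
have dPhi s : 0 < s -> s < 1 -> s != c -> s != y -> is_derive s 1 Phi (peano a c y s).
  move=> s0 s1 sc sy.
  have h : is_derive s (1 : R) (cst (A s) - (fun s : R => spline c a s y)) (peano a c y s).
    apply: is_derive_eq (is_deriveB (is_derive_cst (A s) s 1) (is_derive_spline_rev sy sc)) _.
    by rewrite sub0r opprK.
  apply: near_is_derive h _; near=> z; rewrite PhiS !fctE; congr (_ - _).
  have : (z < c) = (s < c) by near: z; exact: near_ltc_eq.
  by rewrite /A => ->.
have locf : locally_integrable setT k.
  exact: integrable_locally.
have ki' z : leb.-integrable `]-oo, z] (EFin \o k).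
  by apply: integrableS ki => //.
have := FTC1Ny ki' locf => /=.
move=> h; have h0 := ae_neq 0; have h1 := ae_neq 1; have hc := ae_neq c.
have hy := ae_neq y.
near=> s => Is.
have [] : derivable Phi s 1 /\ derive1 Phi s = k s by near: s.
move=> _; rewrite /k patchE mem_set // => <-.
have s0 : s != 0 by near: s.
have s1 : s != 1 by near: s.
have sc : s != c by near: s.
have sy : s != y by near: s.
move: Is; rewrite unitIE => /andP[s0' s1'].
have := dPhi s; rewrite !lt_neqAle s0' s1' eq_sym s0 s1 => /(_ erefl erefl sc sy) hd.
by rewrite derive1E; case: hd.
Unshelve. all: by end_near. Qed.

(** [K x y] is the inner product of the sections at [y] and [x]. Their derivatives at [c] are known
    exactly and their top derivatives almost everywhere, which suffices under the integral; hence an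
    identity at every pair of points. *)
Theorem sobolev_kernelE x y : I x -> I y -> K x y = pkernel a c x y.
Proof.
move=> Ix Iy.
have -> : K x y = Ks y x by rewrite /Ks patchE mem_set.
rewrite (rk_eval hK (Ks_mem Iy) Ix) -/(Ks x) /sobolev_ip /pkernel feature_pairingC.
congr (_ + _).
  rewrite !big_nat; apply: eq_bigr => r ra; rewrite !Ks_deriv_anchor //.
apply: ae_eq_Rint.
- by apply: measurable_funM; exact: kap_measurable.
- by have [] := bmfM (feature_fun_point a Ic Iy) (feature_fun_point a Ic Ix).
- have h1 := kernel_deriv_ae Ix; have h2 := kernel_deriv_ae Iy.
  near=> t => It; congr (_ * _); move: It; near: t => //.
Unshelve. all: by end_near. Qed.

End SobolevKernel.

(** * The product measure *)

Section ProductMeasure.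
Variable R : realType.
Notation leb := (@lebesgue_measure R).
Notation I := (@unitI R).
Notation MR := (measurableTypeR R).
Notation ubmf := (@bmf _ (measurableTypeR R) R (@unitI R)).

Lemma bmf_indic d (T : measurableType d) (D A : set T) : measurable A ->
  bmf D (\1_A : T -> R).
Proof.
move=> mA; split; first exact: measurable_indic.
by exists 1 => x _; rewrite indicE ger0_norm ?ler0n // lern1 leq_b1.
Qed.

(* Uniform approximation by sums of indicators of level sets. *)
Lemma ubmf_functional_eq0 (D : (MR -> R) -> R) (C : R) : 0 <= C ->
  (forall f g, ubmf f -> ubmf g -> D (fun x => f x + g x) = D f + D g) ->
  (forall r f, ubmf f -> D (fun x => r * f x) = r * D f) ->
  (forall f B, ubmf f -> (forall x, I x -> `|f x| <= B) -> `|D f| <= C * B) ->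
  (forall A, measurable A -> D \1_A = 0) ->
  forall f, ubmf f -> D f = 0.
Proof.
move=> C0 DD DZ DB D1 f bf.
apply/eqP; rewrite -normr_le0; apply/ler_addgt0Pr => e e0; rewrite add0r.
have [mf [B0 fB0]] := bf; pose B := Num.max B0 0.
have fB x : I x -> `|f x| <= B by move=> Ix; rewrite le_max fB0.
have B0' : 0 <= B by rewrite le_max lexx orbT.
pose d := e / (C + 1).
have d0 : 0 < d by rewrite divr_gt0 // ltr_wpDl.
pose n := (Num.truncn (2 * B / d)).+1.
(* [A i] is the part of [I] where [f + B >= (i+1) d], so [d] times the sum of the indicators is
   [f + B] rounded down to a multiple of [d]; [n] levels suffice because [f + B <= 2 B]. *)
pose A i : set MR := I `&` f @^-1` [set y | i.+1%:R <= (y + B) / d].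
have mA i : measurable (A i).
  apply: mf; first exact: measurable_unitI.
  rewrite (_ : [set y | _] = `[i.+1%:R * d - B, +oo[%classic) //.
  apply/seteqP; split => y /=; rewrite in_itv /= andbT ler_pdivlMr // lerBlDr //.
pose g x := \sum_(i < n) d * \1_(A i) x - B * \1_(setT : set MR) x.
have bA i : ubmf (\1_(A i)) by exact: bmf_indic.
have bT : ubmf (\1_(setT : set MR)) by exact: bmf_indic.
have bS (s : seq 'I_n) : ubmf (fun x => \sum_(i <- s) d * \1_(A i) x).
  by apply: bmf_sum => i; exact: bmfZ.
have DS (s : seq 'I_n) : D (fun x => \sum_(i <- s) d * \1_(A i) x) = 0.
  elim: s => [|i s IH].
    have -> : (fun x => \sum_(i <- [::] : seq 'I_n) d * \1_(A i) x) =
        (fun x => 0 * \1_(setT : set MR) x).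
      by apply/funext => x; rewrite big_nil mul0r.
    by rewrite DZ ?mul0r.
  under eq_fun do rewrite big_cons.
  by rewrite DD ?IH ?addr0 ?DZ ?D1 ?mulr0 //; exact: bmfZ.
have bg : ubmf g by apply: bmfB; [exact: bS | exact: bmfZ].
have Dg : D g = 0.
  have -> : g = fun x => \sum_(i < n) d * \1_(A i) x + (- B) * \1_(setT : set MR) x.
    by apply/funext => x; rewrite /g mulNr.
  rewrite DD ?DS ?DZ ?D1 ?mulr0 ?addr0 //; exact: bmfZ.
have fg x : I x -> `|f x + (-1) * g x| <= d.
  move=> Ix; have := fB x Ix; rewrite ler_norml => /andP[f1 f2].
  have z0 : 0 <= (f x + B) / d by apply: divr_ge0; [lra | exact: ltW].
  have -> : g x = d * (Num.truncn ((f x + B) / d))%:R - B.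
    rewrite /g indicE mem_set // mulr1; congr (_ - _); rewrite -mulr_sumr; congr (_ * _).
    transitivity (\sum_(i < n) (i < Num.truncn ((f x + B) / d))%N%:R : R).
      apply: eq_bigr => i _; rewrite indicE truncn_gt_nat; congr (_%:R).
      congr nat_of_bool; apply/idP/idP; first by rewrite inE => -[].
      by move=> h; rewrite mem_set.
    set k := Num.truncn _.
    have kn : (k <= n)%N.
      apply: leqW; apply: le_truncn; rewrite ler_pM2r ?invr_gt0 //; lra.
    rewrite -natr_sum; congr (_%:R).
    transitivity (\sum_(i < n | (i < k)%N) 1)%N.
      by rewrite [RHS]big_mkcond; apply: eq_bigr => i _; case: (i < k)%N.
    by rewrite -(big_ord_widen n (fun=> 1%N) kn) sum1_card card_ord.
  have /andP[t1 t2] := truncn_itv z0.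
  move: t1 t2; rewrite ler_pdivlMr // ltr_pdivrMr // -natr1 => t1 t2.
  rewrite ler_norml; lra.
have bh : ubmf (fun x => f x + (-1) * g x) by apply: bmfD => //; exact: bmfZ.
have : D (fun x => f x + (-1) * g x) = D f.
  by rewrite DD ?DZ ?Dg ?mulr0 ?addr0 //; exact: bmfZ.
move=> <-; apply: le_trans (DB _ _ bh fg) _.
by rewrite /d mulrA ler_pdivrMr ?ltr_wpDl // mulrDr mulr1 [e * C]mulrC lerDl ltW.
Qed.

Variable mu : {measure set (seqspace R) -> \bar R}.
Hypothesis hmu : is_product_uniform mu.

Definition cube : set (seqspace R) := [set x | forall j, I (x j)].

Lemma measurable_coord j (B : set MR) : measurable B ->
  measurable [set x : seqspace R | B (x j)].
Proof. by move=> mB; apply: sub_sigma_algebra; exists j, B. Qed.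

Lemma measurable_cube : measurable cube.
Proof.
rewrite (_ : cube = \bigcap_j [set x : seqspace R | I (x j)]).
  by apply: bigcapT_measurable => j; apply: measurable_coord; exact: measurable_unitI.
by apply/seteqP; split => x /=; [move=> h j _; exact: h | move=> h j; exact: (h j)].
Qed.

Lemma mu_setT : mu setT = 1%E.
Proof.
have := hmu fset0 (B := fun=> setT) (fun=> measurableT).
by rewrite big_nil => <-; congr (mu _); apply/seteqP; split.
Qed.

(** [is_product_uniform] speaks of finitely many coordinates; the complement of the cube is a
    countable union of null sets, each defined by one coordinate. *)
Lemma mu_cubeC : mu (~` cube) = 0%E.
Proof.
apply/eqP; rewrite -measure_le0.
have mI := @measurable_unitI R.
have : mu.-negligible (\bigcup_j [set x : seqspace R | ~ I (x j)]).
  apply: negligible_bigcup => j; exists [set x : seqspace R | (~` I) (x j)].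
  split => //; first exact: (measurable_coord j (measurableC mI)).
  have := hmu [fset j]%fset (B := fun=> ~` I) (fun=> measurableC mI).
  rewrite big_seq_fset1 setICl measure0 => e; etransitivity; last exact: e.
  congr (mu _).
  apply/seteqP; split => x /=; first by move=> h k; rewrite inE => /eqP ->.
  by move=> /(_ j); rewrite inE eqxx; exact.
move=> [N [mN N0 sN]]; rewrite -N0; apply: le_measure; rewrite ?inE //.
  by apply: measurableC; exact: measurable_cube.
apply: subset_trans sN => x /= /existsNP[j hj]; by exists j.
Qed.

Lemma mu_cube : mu cube = 1%E.
Proof.
have : (mu (cube `|` ~` cube) = mu cube + mu (~` cube))%E.
  apply: measureU; [exact: measurable_cube | | exact: setICr].
  by apply: measurableC; exact: measurable_cube.
by rewrite setUv mu_setT mu_cubeC adde0 => ->.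
Qed.

Lemma integral_indic_cube (A : set (seqspace R)) : measurable A ->
  \int[mu]_(x in cube) \1_A x = fine (mu A).
Proof.
move=> mA; rewrite /Rintegral integral_indic //; last exact: measurable_cube.
have mc := measurable_cube; have mcC := measurableC mc.
congr fine; have : (mu A = mu (A `&` cube) + mu (A `&` ~` cube))%E.
  rewrite -measureU; [by rewrite -setIUr setUv setIT | exact: measurableI | exact: measurableI |].
  by rewrite setIACA setICr setI0.
move=> ->; have -> : (mu (A `&` ~` cube) = 0)%E.
  apply: (@subset_measure0 _ _ _ mu _ (~` cube)) mu_cubeC => //.
  exact: measurableI.
by rewrite adde0.
Qed.

Notation cbmf := (@bmf _ (seqspace R) R cube).
Notation cint f := (\int[mu]_(x in cube) f x).

Definition cint_D := @bmf_intD _ (seqspace R) R mu cube measurable_cube mu_cube.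
Definition cint_Z := @bmf_intZ _ (seqspace R) R mu cube measurable_cube mu_cube.
Definition cint_cst := @bmf_int_cst _ (seqspace R) R mu cube measurable_cube mu_cube.
Definition cint_le := @bmf_int_le _ (seqspace R) R mu cube measurable_cube mu_cube.

Lemma cbmf_coord j (k : MR -> R) : ubmf k -> cbmf (fun x => k (x j)).
Proof.
move=> [mk [B kB]]; split; last by exists B => x hx; exact: kB.
move=> mc Y mY; rewrite (_ : _ `&` _ = cube `&` [set x : seqspace R | (I `&` k @^-1` Y) (x j)]).
  apply: measurableI => //; apply: measurable_coord; exact: mk (@measurable_unitI R) Y mY.
by apply/seteqP; split => x /= [hx]; [move=> h; split => //; split | case].
Qed.

(** The hypothesis on [mu] covers indicators only. Coordinates pass one at a time from [u2]
    (indicators) to [u1] (bounded functions): the difference of the two sides is linear and bounded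
    in the function at [j], and vanishes on indicators by induction. *)
Lemma integral_prod_coord_indic (k : nat -> MR -> R) (u1 : seq nat) :
  (forall j, ubmf (k j)) -> forall (u2 : seq nat) (B : nat -> set MR),
  uniq (u1 ++ u2) -> (forall j, measurable (B j)) ->
  \int[mu]_(x in cube) (\prod_(j <- u1) k j (x j) * \prod_(j <- u2) \1_(B j) (x j)) =
  \prod_(j <- u1) (\int[leb]_(t in I) k j t) *
  \prod_(j <- u2) (\int[leb]_(t in I) \1_(B j) t).
Proof.
move=> bk; elim: u1 => [|j u1 IH] u2 B /=.
  move=> uu mB; rewrite big_nil mul1r.
  under eq_Rintegral do rewrite big_nil mul1r.
  pose S : set (seqspace R) := [set x | forall j, j \in [fset j in u2]%fset -> B j (x j)].
  have Su x : S x <-> forall j, j \in u2 -> B j (x j).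
    by split => h j; have := h j; rewrite !inE.
  have mS : measurable S.
    rewrite (_ : S = \bigcap_(j in [set j | j \in u2]) [set x : seqspace R | B j (x j)]).
      by apply: bigcap_measurableType => j _; exact: measurable_coord.
    apply/seteqP; split => x; first by move=> /Su h j; exact: h.
    by move=> h; apply/Su => j; exact: h.
  transitivity (\int[mu]_(x in cube) \1_S x).
    apply: eq_Rint => x _; rewrite indicE.
    have -> : (x \in S) = all (fun j => x j \in B j) u2.
      apply/idP/allP; first by rewrite inE => /Su h j /h; rewrite inE.
      by move=> h; apply/mem_set/Su => j /h; rewrite inE.
    elim: (u2) => [|j s IH]; first by rewrite big_nil.
    by rewrite big_cons IH /= indicE; case: (x j \in B j); rewrite ?mul1r ?mul0r.
  rewrite integral_indic_cube // (hmu _ mB) /=.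
  rewrite (perm_big u2); last first.
    by apply: uniq_perm => //; [exact: fset_uniq | move=> j; rewrite !inE].
  apply: eq_bigr => j _; rewrite /Rintegral integral_indic //.
  exact: measurable_unitI.
move=> /andP[ju uu] mB.
pose w x := \prod_(l <- u1) k l (x l) * \prod_(l <- u2) \1_(B l) (x l).
pose W := \prod_(l <- u1) (\int[leb]_(t in I) k l t) *
  \prod_(l <- u2) (\int[leb]_(t in I) \1_(B l) t).
have bw : cbmf w.
  apply: bmfM; apply: bmf_prod => l; apply: cbmf_coord => //; exact: bmf_indic.
have [_ [Bw wB]] := bw.
have Bw0 : 0 <= Bw.
  by apply: le_trans (wB (fun=> 0) _) => // l; rewrite unitIE lexx ler01.
pose D (f : MR -> R) := (\int[mu]_(x in cube) (f (x j) * w x)) -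
  (\int[leb]_(t in I) f t) * W.
have bfw f : ubmf f -> cbmf (fun x => f (x j) * w x).
  by move=> bf; apply: bmfM => //; exact: cbmf_coord.
suff D0 : D (k j) = 0.
  rewrite !big_cons -[RHS]mulrA -/W; move/eqP: D0; rewrite subr_eq0 => /eqP <-.
  by apply: eq_Rint => x _; rewrite big_cons mulrA.
apply: (@ubmf_functional_eq0 D (Bw + `|W|)) => //.
- by rewrite addr_ge0.
- move=> f g bf bg; rewrite /D.
  transitivity ((\int[mu]_(x in cube) (f (x j) * w x + g (x j) * w x)) -
     (\int[leb]_(t in I) (f t + g t)) * W).
    by congr (_ - _); apply: eq_Rint => x _; rewrite mulrDl.
  rewrite cint_D ?uint_D //; [ring | exact: bfw | exact: bfw].
- move=> r f bf; rewrite /D.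
  transitivity ((\int[mu]_(x in cube) (r * (f (x j) * w x))) -
     (\int[leb]_(t in I) (r * f t)) * W).
    by congr (_ - _); apply: eq_Rint => x _; rewrite mulrA.
  rewrite cint_Z ?uint_Z //; [ring | exact: bfw].
- move=> f b bf fb; rewrite /D; apply: le_trans (ler_normB _ _) _.
  have b0 : 0 <= b.
    have I0 : I 0 by rewrite unitIE lexx ler01.
    exact: le_trans (fb 0 I0).
  rewrite mulrDl; apply: lerD.
    apply: cint_le; first exact: bfw.
    move=> x hx; rewrite normrM mulrC ler_pM //; [exact: wB | exact/fb/hx].
  by rewrite normrM mulrC ler_wpM2l // uint_le.
- move=> A mA.
  pose B' l := if l == j then A else B l.
  have uu' : uniq (u1 ++ j :: u2).
    by rewrite uniq_catC /= mem_cat orbC -mem_cat ju uniq_catC uu.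
  have mB' l : measurable (B' l) by rewrite /B'; case: ifP.
  have ju2 : j \notin u2 by move: ju; rewrite mem_cat negb_or => /andP[].
  have B'E l : l \in u2 -> B' l = B l.
    by move=> lu; rewrite /B'; case: eqP => // lj; rewrite -lj lu in ju2.
  have B'j : B' j = A by rewrite /B' eqxx.
  have e := IH (j :: u2) B' uu' mB'.
  rewrite /D; apply/eqP; rewrite subr_eq0; apply/eqP.
  transitivity (\int[mu]_(x in cube) (\prod_(l <- u1) k l (x l) *
      \prod_(l <- j :: u2) \1_(B' l) (x l))).
    apply: eq_Rint => x _; rewrite big_cons B'j mulrCA /w; congr (_ * (_ * _)).
    by apply: eq_big_seq => l lu; rewrite B'E.
  rewrite e big_cons B'j mulrCA /W; congr (_ * (_ * _)).
  by apply: eq_big_seq => l lu; rewrite B'E.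
Qed.

Theorem integral_prod_coord (k : nat -> MR -> R) (u : seq nat) : uniq u ->
  (forall j, ubmf (k j)) ->
  \int[mu]_(x in cube) (\prod_(j <- u) k j (x j)) =
  \prod_(j <- u) (\int[leb]_(t in I) k j t).
Proof.
move=> uu bk.
have := @integral_prod_coord_indic k u bk [::] (fun=> setT).
rewrite cats0 big_nil mulr1 => <- //.
by apply: eq_Rint => x _; rewrite big_nil mulr1.
Qed.

End ProductMeasure.

(** * Worst case error on the weighted space *)

Section AbsoluteSums.
Variables (R : realType) (T : choiceType).
Implicit Types (A : set T) (a g : T -> R).

Definition finite_part A (s : seq T) := uniq s /\ forall u, u \in s -> A u.

Lemma esum_le_bound A a (M : R) :
  (forall s, finite_part A s -> \sum_(u <- s) a u <= M) ->
  (\esum_(u in A) (a u)%:E <= M%:E)%E.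
Proof.
move=> h; apply: ge_ereal_sup => _ [X [finX XA] <-].
rewrite fsbig_finite //= sumEFin lee_fin; apply: h; split; first exact: fset_uniq.
by move=> u; rewrite in_fset_set // inE => /XA.
Qed.

Lemma le_esum_finite_part A a (s : seq T) : finite_part A s ->
  ((\sum_(u <- s) a u)%:E <= \esum_(u in A) (a u)%:E)%E.
Proof.
move=> [us sA]; apply: esum_ge; exists [set` s].
  by split; [exact: finite_seq | move=> u /= /sA].
by rewrite -fsbig_seq // sumEFin.
Qed.

Variables (A : set T) (g : T -> R) (G : R).
Hypotheses (g0 : forall u, A u -> 0 <= g u)
  (gG : forall s, finite_part A s -> \sum_(u <- s) g u <= G).

(** Infinite sums over active sets are handled through a finite [s] carrying all but [eta] of the
    weight. The same [s] serves all points, as the tensor kernels are uniformly bounded. *)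
Definition small_tail (s : seq T) (eta : R) := finite_part A s /\
  forall t, finite_part A t -> (forall u, u \in t -> u \notin s) ->
  \sum_(u <- t) g u <= eta.

Lemma small_tail_exists eta : 0 < eta -> exists s, small_tail s eta.
Proof.
move=> eta0; pose S := [set (\sum_(u <- s) g u) | s in finite_part A].
have hS : has_sup S.
  split; first by exists 0, [::] => //; rewrite big_nil.
  by exists G => _ [s hs <-]; exact: gG.
have [_ [s hs <-] hlt] := sup_adherent eta0 hS.
exists s; split => // t ht disj.
have hst : finite_part A (s ++ t).
  case: hs => us sA; case: ht => ut tA; split.
    rewrite cat_uniq us ut andbT /=; apply/hasPn => u ut'; exact: disj.
  by move=> u; rewrite mem_cat => /orP[/sA|/tA].
have : \sum_(u <- s ++ t) g u <= sup S.
  by apply: ub_le_sup; [case: hS | exists (s ++ t)].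
rewrite big_cat /=; lra.
Qed.

Let sum_le_tail (a : T -> R) (C eta : R) s t : 0 <= C -> small_tail s eta ->
  (forall u, A u -> 0 <= a u <= C * g u) -> finite_part A t ->
  \sum_(u <- t) a u <= \sum_(u <- s) a u + C * eta.
Proof.
move=> C0 [[us sA] htail] ha [ut tA].
rewrite (bigID (fun u => u \in s)) /=; apply: lerD.
  rewrite [leRHS](bigID (fun u => u \in t)) /= -big_filter -[X in _ <= X + _]big_filter.
  rewrite (perm_big [seq u <- s | u \in t]); last first.
    by apply: uniq_perm; rewrite ?filter_uniq // => u; rewrite !mem_filter andbC.
  rewrite lerDl big_seq_cond; apply: sumr_ge0 => u /andP[/sA /ha/andP[]//].
rewrite -big_filter.
apply: (@le_trans _ _ (\sum_(u <- [seq u <- t | u \notin s]) C * g u)).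
  rewrite !big_seq; apply: ler_sum => u; rewrite mem_filter => /andP[_ /tA /ha].
  by case/andP.
rewrite -mulr_sumr ler_wpM2l //; apply: htail.
  by split; [exact: filter_uniq | move=> u; rewrite mem_filter => /andP[_ /tA]].
by move=> u; rewrite mem_filter => /andP[].
Qed.

Let esum_tail (a : T -> R) (C eta : R) s : 0 <= C -> small_tail s eta ->
  (forall u, A u -> 0 <= a u <= C * g u) ->
  exists2 r : R, (\esum_(u in A) (a u)%:E = r%:E)%E &
    \sum_(u <- s) a u <= r <= \sum_(u <- s) a u + C * eta.
Proof.
move=> C0 hs ha; have [fs _] := hs.
have h1 := le_esum_finite_part a fs.
have h2 : (\esum_(u in A) (a u)%:E <= (\sum_(u <- s) a u + C * eta)%:E)%E.
  by apply: esum_le_bound => t ht; exact: sum_le_tail.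
move: h1 h2; case: (\esum_(u in A) (a u)%:E)%E => [r||] //= h1 h2.
by exists r => //; rewrite -!lee_fin h1 h2.
Qed.

Lemma abs_sum_tail (a : T -> R) (C eta : R) s : 0 <= C -> small_tail s eta ->
  (forall u, A u -> `|a u| <= C * g u) ->
  `|abs_sum A a - \sum_(u <- s) a u| <= C * eta.
Proof.
move=> C0 hs ha.
have [|p hp /andP[p1 p2]] := @esum_tail (fun u => Num.max (a u) 0) C eta s C0 hs.
  move=> u Au; rewrite le_max lexx orbT ge_max mulr_ge0 ?g0 // andbT.
  exact: le_trans (ler_norm _) (ha u Au).
have [|q hq /andP[q1 q2]] := @esum_tail (fun u => Num.max (- a u) 0) C eta s C0 hs.
  move=> u Au; rewrite le_max lexx orbT ge_max mulr_ge0 ?g0 // andbT.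
  by apply: le_trans (ler_norm _) _; rewrite normrN ha.
have -> : \sum_(u <- s) a u =
    \sum_(u <- s) Num.max (a u) 0 - \sum_(u <- s) Num.max (- a u) 0.
  rewrite -sumrB; apply: eq_bigr => u _.
  by case: (leP (a u) 0) => h; case: (leP (- a u) 0) => h'; lra.
rewrite /abs_sum hp hq /= ler_norml; lra.
Qed.

End AbsoluteSums.

(** * The error functional and its representer *)

Section WorstCaseError.
Variable R : realType.
Notation I := (@unitI R).
Notation ubmf := (@bmf _ (measurableTypeR R) R (@unitI R)).
Notation cbmf := (@bmf _ (seqspace R) R (@cube R)).
Variables (a : nat) (c : R) (K : R -> R -> R).
Hypotheses (a0 : (0 < a)%N) (Ic : I c).
Hypothesis hK : reproducing_kernel I (sobolev a c) (sobolev_ip a c) K.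
Variables (gam : {fset nat} -> R) (d : nat) (G : R).
Hypotheses (gam0 : forall u, 0 <= gam u)
  (gamd : forall u, active gam u -> (#|` u| <= d)%N)
  (gamG : forall s, finite_part (active gam) s -> \sum_(u <- s) gam u <= G).
Variables (mu : {measure set (seqspace R) -> \bar R}).
Hypothesis hmu : is_product_uniform mu.
Variables (H : set ((nat -> R) -> R)).
Variables (ip : ((nat -> R) -> R) -> ((nat -> R) -> R) -> R).
Hypothesis hH : is_rkhs (weighted_domain K gam) H ip (weighted_kernel K gam).
Implicit Types (u : {fset nat}) (x y : nat -> R).

Let KE := sobolev_kernelE a0 Ic hK.
Let g0 u : active gam u -> 0 <= gam u. Proof. by []. Qed.
Let kb : R := 4 * a%:R.
Let kb1 : 1 <= kb.
Proof. by rewrite /kb -natrM ler1n muln_gt0. Qed.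
Let Kb : R := kb ^+ d.
Let Kb0 : 0 <= Kb. Proof. by rewrite exprn_ge0 // (le_trans ler01). Qed.
Let G0 : 0 <= G.
Proof. by have := @gamG [::]; rewrite big_nil; apply; split. Qed.

Lemma feature_pairing_le phi psi :
  feature_fun phi -> feature_fun psi ->
  (forall tau, feature_index a tau -> `|phi tau| <= 2) ->
  (forall tau, feature_index a tau -> `|psi tau| <= 2) ->
  `|feature_pairing a phi psi| <= kb.
Proof.
move=> bp bs hp hs.
have h4 tau : feature_index a tau -> `|phi tau * psi tau| <= 4.
  move=> ht; rewrite normrM (_ : 4 = 2 * 2 :> R); last by ring.
  by rewrite ler_pM ?hp ?hs.
have -> : kb = (a.-1)%:R * 4 + 4.
  by rewrite /kb -{1}(prednK a0) -natr1; ring.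
apply: le_trans (ler_normD _ _) _; apply: lerD.
  apply: le_trans (ler_norm_sum _ _ _) _.
  apply: (@le_trans _ _ (\sum_(1 <= r < a) 4)).
    by rewrite !big_nat; apply: ler_sum => r ra; exact: h4.
  by rewrite sumr_const_nat subn1 mulr_natl.
apply: uint_le; first exact: bmfM.
by move=> t It; exact: h4.
Qed.

Lemma kernel_le (x y : R) : I x -> I y -> `|K x y| <= kb.
Proof.
move=> Ix Iy; rewrite KE //; apply: feature_pairing_le.
- exact: feature_fun_point.
- exact: feature_fun_point.
- by move=> tau ht; exact: feature_le.
- by move=> tau ht; exact: feature_le.
Qed.

Lemma tensor_kernel_le u x y : active gam u -> cube x -> cube y ->
  `|tensor_kernel K u x y| <= Kb.
Proof.
move=> Au hx hy; rewrite /tensor_kernel normr_prod.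
apply: (@le_trans _ _ (\prod_(j <- u) kb)).
  by apply: ler_prod => j _; rewrite normr_ge0 kernel_le.
rewrite big_const_seq count_predT iter_mulr_1.
by apply: ler_weXn2l => //; exact: gamd.
Qed.

(** Active sets have at most [d] elements, so the tensor kernels are bounded by [Kb] and the
    summability condition holds on the whole cube. *)
Lemma weighted_domainE : weighted_domain K gam = @cube R.
Proof.
apply/seteqP; split => x; first by case.
move=> hx; split => //; apply: le_lt_trans (ltry (Kb * G)).
apply: esum_le_bound => s fs; apply: le_trans (_ : \sum_(u <- s) Kb * gam u <= _).
  rewrite !big_seq; apply: ler_sum => u us; rewrite mulrC ler_wpM2r ?gam0 //.
  apply: le_trans (ler_norm _) _; apply: tensor_kernel_le => //.
  by case: fs => _; apply.
by rewrite -mulr_sumr ler_wpM2l // gamG.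
Qed.

Lemma weighted_kernel_tail s eta x y : small_tail (active gam) gam s eta ->
  cube x -> cube y ->
  `|weighted_kernel K gam x y - \sum_(u <- s) gam u * tensor_kernel K u x y|
    <= Kb * eta.
Proof.
move=> hs hx hy; apply: abs_sum_tail => //.
move=> u Au; rewrite normrM ger0_norm // mulrC ler_wpM2r ?gam0 //.
exact: tensor_kernel_le.
Qed.

Lemma weighted_kernel_le x y : cube x -> cube y ->
  `|weighted_kernel K gam x y| <= Kb * G.
Proof.
move=> hx hy; have := @weighted_kernel_tail [::] G x y.
rewrite big_nil subr0; apply => //; split; first by split.
by move=> t ft _; exact: gamG.
Qed.

Lemma kernel_section_bmf (y : R) : I y -> ubmf (fun t : R => K t y).
Proof.
move=> Iy; have [b _] := mean_pairing a Ic (feature_fun_point a Ic Iy).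
by apply: eq_bmf b => t It; rewrite KE.
Qed.

Lemma tensor_section_bmf u y : cube y -> cbmf (fun x => tensor_kernel K u x y).
Proof.
move=> hy; apply: bmf_prod => j.
exact: (@cbmf_coord R j (fun t => K t (y j)) (kernel_section_bmf (hy j))).
Qed.

Lemma weighted_section_measurable y : cube y ->
  measurable_fun (@cube R) (weighted_kernel K gam ^~ y : seqspace R -> R).
Proof.
move=> hy.
have /choice [s hs] : forall n : nat, exists s, small_tail (active gam) gam s n.+1%:R^-1.
  by move=> n; apply: (small_tail_exists gamG); rewrite invr_gt0 ltr0n.
apply: (@measurable_fun_cvg _ (seqspace R) R (@cube R)
  (fun n x => \sum_(u <- s n) gam u * tensor_kernel K u x y)).
  move=> n; have [] : cbmf (fun x => \sum_(u <- s n) gam u * tensor_kernel K u x y) => //.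
  by apply: bmf_sum => u; apply: bmfZ; exact: tensor_section_bmf.
move=> x hx; apply/cvgrPdist_lt => e e0.
have e0' : 0 < e / (Kb + 1) by rewrite divr_gt0 // ltr_wpDl.
have [N _ hN] := near_infty_natSinv_lt (PosNum e0').
exists N => // n /hN /= hn.
apply: le_lt_trans (weighted_kernel_tail (hs n) hx hy) _.
rewrite ltr_pdivlMr ?ltr_wpDl // in hn.
apply: le_lt_trans hn; rewrite mulrC ler_wpM2l ?invr_ge0 ?ler0n // lerDl.
exact: ler01.
Qed.

Let hfs := hH.1.
Let rk := hH.2.
Let dom x : cube x -> weighted_domain K gam x.
Proof. by rewrite weighted_domainE. Qed.

Lemma rkhs_member_le f x : H f -> cube x ->
  `|f x| <= ip_norm ip f * Num.sqrt (Kb * G).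
Proof.
move=> Hf hx; rewrite (rk_eval rk Hf (dom hx)).
apply: le_trans (cauchy_schwarz hfs Hf (rk_mem rk (dom hx))) _.
rewrite ler_wpM2l ?sqrtr_ge0 // /ip_norm ler_wsqrtr //.
rewrite -(rk_eval rk (rk_mem rk (dom hx)) (dom hx)) patchE mem_set; last exact: dom.
exact: le_trans (ler_norm _) (weighted_kernel_le hx hx).
Qed.

(** Measurability of an arbitrary member comes from [rkhs_ind]: it passes to pointwise limits and
    holds for kernel sections, which are limits of finite sums of tensor kernels. *)
Lemma rkhs_member_bmf f : H f -> cbmf f.
Proof.
move=> Hf; split; last first.
  by exists (ip_norm ip f * Num.sqrt (Kb * G)) => x hx; exact: rkhs_member_le.
move: f Hf.
apply: (rkhs_ind hfs rk (P := fun f => measurable_fun (@cube R) (f : seqspace R -> R))).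
- exact: measurable_cst.
- move=> r f g mf mg; apply: measurable_funD => //.
  by apply: measurable_funM => //; exact: measurable_cst.
- move=> w f mw wf; apply: (@measurable_fun_cvg _ (seqspace R) R _ w) => //.
- move=> y; rewrite weighted_domainE => hy.
  apply: eq_measurable_fun (weighted_section_measurable hy) => x.
  by rewrite patchE => ->.
Qed.

Variable Q : algorithm R.
Hypothesis hQ : admissible c Q.

Notation n := (alg_size Q).

Definition sample_point (i : 'I_n) : nat -> R :=
  anchored_pt c (alg_act i) (alg_node i).

Lemma sample_point_cube i : cube (sample_point i).
Proof.
by move=> j; rewrite /sample_point /anchored_pt; case: ifP => // /hQ[].
Qed.

Definition cube_error (f : seqspace R -> R) : R :=
  \int[mu]_(x in @cube R) f x - \sum_(i < n) alg_coef i * f (sample_point i).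

Let V : R := 1 + \sum_(i < n) `|alg_coef i|.
Let V0 : 0 <= V. Proof. by rewrite addr_ge0 // sumr_ge0. Qed.

Lemma cube_errorD f g : cbmf f -> cbmf g ->
  cube_error (fun x => f x + g x) = cube_error f + cube_error g.
Proof.
move=> bf bg; rewrite /cube_error (cint_D hmu bf bg).
have -> : \sum_(i < n) alg_coef i * (f (sample_point i) + g (sample_point i)) =
  \sum_(i < n) alg_coef i * f (sample_point i) +
  \sum_(i < n) alg_coef i * g (sample_point i).
  by rewrite -big_split; apply: eq_bigr => i _; rewrite mulrDr.
by ring.
Qed.

Lemma cube_errorZ r f : cbmf f -> cube_error (fun x => r * f x) = r * cube_error f.
Proof.
move=> bf; rewrite /cube_error (cint_Z hmu r bf) mulrBr; congr (_ - _).
by rewrite mulr_sumr; apply: eq_bigr => i _; rewrite mulrCA.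
Qed.

Lemma cube_error_sum (J : Type) (s : seq J) (F : J -> seqspace R -> R) :
  (forall j, cbmf (F j)) ->
  cube_error (fun x => \sum_(j <- s) F j x) = \sum_(j <- s) cube_error (F j).
Proof.
move=> bF; elim: s => [|j s IH].
  under eq_fun do rewrite big_nil; rewrite big_nil /cube_error (cint_cst hmu) sub0r.
  by rewrite big1 ?oppr0 // => i _; rewrite mulr0.
under eq_fun do rewrite big_cons.
by rewrite cube_errorD ?IH ?big_cons //; exact: bmf_sum.
Qed.

Lemma cube_error_le f B : cbmf f -> (forall x, cube x -> `|f x| <= B) ->
  `|cube_error f| <= B * V.
Proof.
move=> bf fB; apply: le_trans (ler_normB _ _) _; rewrite mulrDr mulr1.
apply: lerD; first exact: (cint_le hmu bf).
apply: le_trans (ler_norm_sum _ _ _) _; rewrite mulr_sumr; apply: ler_sum => i _.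
by rewrite normrM mulrC ler_wpM2r // fB //; exact: sample_point_cube.
Qed.

(** Index 0 stands for the integral, the others for the nodes with negated coefficients, so that the
    error functional becomes one combination of feature vectors. *)
Let b (i : 'I_n.+1) : R := if unlift ord0 i is Some k then - alg_coef k else 1.
Let Phi (i : 'I_n.+1) (j : nat) : nat + R -> R :=
  if unlift ord0 i is Some k then point_feature a c (sample_point k j)
  else mean_feature a c.

Let Phi_fun i j : feature_fun (Phi i j).
Proof.
rewrite /Phi; case: unliftP => [k _|_]; last exact: feature_fun_mean.
by apply: feature_fun_point => //; exact: sample_point_cube.
Qed.

Lemma cube_error_tensor u (psi : nat -> nat + R -> R) :
  (forall j, feature_fun (psi j)) ->
  let F x := \prod_(j <- u) feature_pairing a (point_feature a c (x j)) (psi j) in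
  cbmf F /\ cube_error F =
    \sum_(i < n.+1) b i * \prod_(j <- u) feature_pairing a (Phi i j) (psi j).
Proof.
move=> hpsi F.
have bj j : ubmf (fun t => feature_pairing a (point_feature a c t) (psi j)).
  by have [] := mean_pairing a Ic (hpsi j).
split; first by apply: bmf_prod => j; exact: (cbmf_coord _ (bj j)).
rewrite big_ord_recl /cube_error; congr (_ + _).
  rewrite /b /Phi unlift_none mul1r.
  rewrite (integral_prod_coord hmu (fset_uniq u) bj).
  by apply: eq_bigr => j _; have [_ ->] := mean_pairing a Ic (hpsi j).
rewrite -sumrN; apply: eq_bigr => i _.
by rewrite /b /Phi liftK mulNr.
Qed.

(** The error functional applied to both variables of [K_u], that is, the squared worst case error
    on [H(K_u)]. *)
Let nunu u : R := \sum_(i < n.+1) \sum_(k < n.+1) b i * b k *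
  \prod_(j <- u) feature_pairing a (Phi i j) (Phi k j).

Let section_error u y : R :=
  \sum_(i < n.+1) b i * \prod_(j <- u) feature_pairing a (Phi i j)
    (point_feature a c (y j)).

Let section_errorE u y : cube y ->
  cube_error (fun x => tensor_kernel K u x y) = section_error u y.
Proof.
move=> hy; have hp j : feature_fun (point_feature a c (y j)).
  by apply: feature_fun_point => //; exact: hy.
have [_ e] := cube_error_tensor u hp.
rewrite /section_error -e /cube_error; congr (_ - _).
  by apply: eq_Rint => x hx; apply: eq_bigr => j _; rewrite KE.
apply: eq_bigr => i _; congr (_ * _); apply: eq_bigr => j _.
by rewrite KE //; exact: sample_point_cube.
Qed.

Let section_error_bmf u : cbmf (section_error u).
Proof.
apply: bmf_sum => i; apply: bmfZ.
have [h _] := cube_error_tensor u (Phi_fun i).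
by apply: eq_bmf h => x _; apply: eq_bigr => j _; rewrite feature_pairingC.
Qed.

Let cube_error_section u : cube_error (section_error u) = nunu u.
Proof.
have h i := cube_error_tensor u (Phi_fun i).
have bh i : cbmf (fun y => \prod_(j <- u) feature_pairing a (Phi i j)
    (point_feature a c (y j))).
  by have [h1 _] := h i; apply: eq_bmf h1 => x _; apply: eq_bigr => j _; rewrite feature_pairingC.
rewrite /section_error cube_error_sum => [|i]; last exact: bmfZ.
apply: eq_bigr => i _; rewrite cube_errorZ //.
transitivity (b i * cube_error (fun x => \prod_(j <- u) feature_pairing a (point_feature a c (x j)) (Phi i j))).
  congr (_ * (_ - _)); first by apply: eq_Rint => x _; apply: eq_bigr => j _; rewrite feature_pairingC.
  by apply: eq_bigr => k _; congr (_ * _); apply: eq_bigr => j _; rewrite feature_pairingC.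
have [_ ->] := h i; rewrite mulr_sumr; apply: eq_bigr => k _; rewrite mulrA; congr (_ * _).
by apply: eq_bigr => j _; rewrite feature_pairingC.
Qed.

(** Let [xi] represent the error functional [nu]. Its squared norm is [nu xi], and [xi y] is [nu] of
    the kernel section at [y]; so [nu xi] is the double application of [nu] to the weighted kernel,
    approximated by finite weighted sums of the [nunu u]. *)
Theorem error_le (E : {fset nat} -> R) (e : R) : 0 <= e ->
  (forall u (tau : nat -> nat + R), active gam u -> (forall j, feature_index a (tau j)) ->
    `|\prod_(j <- u) feature_mean a c (tau j) -
      \sum_(i < n) alg_coef i * \prod_(j <- u) feature a c (tau j) (sample_point i j)| <= E u) ->
  (forall s, finite_part (active gam) s ->
    \sum_(u <- s) gam u * (a%:R ^+ #|` u| * (E u * E u)) <= e ^+ 2) ->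
  (wc_error mu c (weighted_domain K gam) H ip Q <= e%:E)%E.
Proof.
move=> e0 hE hsum.
have nunu_le u : active gam u -> `|nunu u| <= a%:R ^+ #|` u| * (E u * E u).
  move=> Au; have hEu tau : (forall j, feature_index a (tau j)) ->
      `|\sum_(i < n.+1) b i * \prod_(j <- u) Phi i j (tau j)| <= E u.
    move=> htau; apply: le_trans (hE u tau Au htau); rewrite big_ord_recl.
    rewrite /b /Phi unlift_none mul1r -sumrN.
    rewrite [X in `|_ + X| <= _](_ : _ = \sum_(i < n) - (alg_coef i *
      \prod_(j <- u) feature a c (tau j) (sample_point i j))) //.
    by apply: eq_bigr => i _; rewrite liftK mulNr.
  exact: (tensor_pairing_bound a0 (fset_uniq u) Phi_fun hEu hEu).
pose nu f := cube_error (f : seqspace R -> R).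
have [||xi Hxi hxi] := @riesz _ _ _ _ _ hfs nu (Num.sqrt (Kb * G) * V).
- move=> r f g Hf Hg; rewrite /nu cube_errorD ?cube_errorZ //; try exact: rkhs_member_bmf.
  by apply: bmfZ; exact: rkhs_member_bmf.
- move=> f Hf; rewrite mulrAC; apply: cube_error_le; first exact: rkhs_member_bmf.
  by move=> x hx; rewrite mulrC; exact: rkhs_member_le.
have xiE y : cube y -> xi y = cube_error (weighted_kernel K gam ^~ y).
  move=> hy; rewrite (rk_eval rk Hxi (dom hy)) (hfs_ipC hfs Hxi (rk_mem rk (dom hy))).
  rewrite -hxi; last exact: (rk_mem rk (dom hy)).
  rewrite /nu /cube_error weighted_domainE; congr (_ - _).
    by apply: eq_Rint => x hx; rewrite patchE mem_set.
  by apply: eq_bigr => i _; rewrite patchE mem_set //; exact: sample_point_cube.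
have nuxi : nu xi <= e ^+ 2.
  apply/ler_addgt0Pr => eps eps0.
  (* One factor [V] for each of the two applications of [nu], and [Kb] for the tensor kernels:
     truncating the kernel to [s] then costs at most [eps]. *)
  pose eta := eps / (Kb * V * V + 1).
  have KVV : 0 <= Kb * V * V by rewrite !mulr_ge0.
  have eta0 : 0 < eta by rewrite divr_gt0 // ltr_wpDl.
  have [s hs] := small_tail_exists gamG eta0.
  pose app y := \sum_(u <- s) gam u * section_error u y.
  have bapp : cbmf app by apply: bmf_sum => u; exact: bmfZ.
  have bxi := rkhs_member_bmf Hxi.
  have near_xi y : cube y -> `|xi y + (-1) * app y| <= Kb * eta * V.
    move=> hy.
    have bK : cbmf (weighted_kernel K gam ^~ y).
      split; first exact: weighted_section_measurable.
      by exists (Kb * G) => x hx; exact: weighted_kernel_le.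
    have bT : cbmf (fun x => \sum_(u <- s) gam u * tensor_kernel K u x y).
      by apply: bmf_sum => u; apply: bmfZ; exact: tensor_section_bmf.
    have -> : xi y + (-1) * app y = cube_error (fun x => weighted_kernel K gam x y +
        (-1) * \sum_(u <- s) gam u * tensor_kernel K u x y).
      rewrite cube_errorD ?cube_errorZ -?xiE //; last exact: bmfZ.
      rewrite cube_error_sum => [|u]; last by apply: bmfZ; exact: tensor_section_bmf.
      congr (_ + _ * _); apply: eq_bigr => u _; rewrite cube_errorZ.
        by rewrite section_errorE.
      exact: tensor_section_bmf.
    apply: cube_error_le; first by apply: bmfD => //; exact: bmfZ.
    by move=> x hx; rewrite mulN1r; exact: weighted_kernel_tail.
  have bdiff : cbmf (fun y => xi y + (-1) * app y) by apply: bmfD => //; exact: bmfZ.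
  have := cube_error_le bdiff near_xi.
  rewrite cube_errorD ?cube_errorZ //; last exact: bmfZ.
  have -> : cube_error app = \sum_(u <- s) gam u * nunu u.
    rewrite cube_error_sum => [|u]; last exact: bmfZ.
    by apply: eq_bigr => u _; rewrite cube_errorZ // cube_error_section.
  have hfin : \sum_(u <- s) gam u * nunu u <= e ^+ 2.
    have [[us sA] _] := hs; apply: le_trans (hsum s (conj us sA)).
    rewrite !big_seq; apply: ler_sum => u /sA Au; rewrite ler_wpM2l //.
    exact: le_trans (ler_norm _) (nunu_le u Au).
  have heps : Kb * eta * V * V <= eps.
    have -> : Kb * eta * V * V = Kb * V * V * eta by ring.
    rewrite /eta; move: (Kb * V * V) KVV => kv kv0.
    by rewrite mulrA ler_pdivrMr ?ltr_wpDl // mulrDr mulr1 [leLHS]mulrC lerDl ltW.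
  rewrite ler_norml mulN1r -/(nu xi) => /andP[_ h]; lra.
apply: ge_ereal_sup => _ [f [Hf f1] <-]; rewrite lee_fin.
have -> : integral_mu mu (weighted_domain K gam) f - alg_apply c Q f = nu f.
  by rewrite /integral_mu weighted_domainE.
rewrite hxi //; apply: le_trans (cauchy_schwarz hfs Hf Hxi) _.
apply: (@le_trans _ _ (1 * e)); last by rewrite mul1r.
apply: ler_pM; rewrite ?sqrtr_ge0 //.
rewrite /ip_norm -hxi // -(ger0_norm e0) -sqrtr_sqr; exact: ler_wsqrtr.
Qed.

End WorstCaseError.

(** * The multilevel Smolyak algorithm *)

Section Smolyak.
Variable R : realType.
Notation I := (@unitI R).
Implicit Types (f : R -> R).

Definition rule_eval (U : seq (R * R)) f : R := \sum_(p <- U) p.1 * f p.2.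

Definition rule_sub (U V : seq (R * R)) := U ++ [seq (- p.1, p.2) | p <- V].

Lemma rule_eval_sub U V f :
  rule_eval (rule_sub U V) f = rule_eval U f - rule_eval V f.
Proof.
rewrite /rule_eval big_cat big_map /= -sumrN; congr (_ + _).
by apply: eq_bigr => p _; rewrite mulNr.
Qed.

Definition upd (x : nat -> R) (d : nat) (t : R) : nat -> R :=
  fun i => if i == d then t else x i.

Variable U : nat -> seq (R * R).

Definition rule_diff (k : nat) : seq (R * R) :=
  if k is k'.+1 then rule_sub (U k) (U k') else U 0%N.

Lemma sum_rule_diff L f :
  \sum_(k < L.+1) rule_eval (rule_diff k) f = rule_eval (U L) f.
Proof.
elim: L => [|L IH]; first by rewrite big_ord_recr /= big_ord0 add0r.
by rewrite big_ord_recr /= IH rule_eval_sub addrC subrK.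
Qed.

(** The recursion A(d+1, L) = sum over k <= L of A(d, L-k) tensor Delta_k, with Delta_k the
    difference of consecutive rules. A node is a function on all of [nat], equal to 0 beyond its [d]
    coordinates. *)
Fixpoint smolyak (d L : nat) : seq (R * (nat -> R)) :=
  if d is d'.+1 then
    flatten [seq [seq (p.1 * q.1, upd p.2 d' q.2) | p <- smolyak d' (L - k), q <- rule_diff k]
            | k <- iota 0 L.+1]
  else [:: (1, fun=> 0)].

Lemma smolyakS d L : smolyak d.+1 L =
  flatten [seq [seq (p.1 * q.1, upd p.2 d q.2) | p <- smolyak d (L - k), q <- rule_diff k]
            | k <- index_iota 0 L.+1].
Proof. by rewrite /index_iota subn0. Qed.

Definition cubature_eval (A : seq (R * (nat -> R))) (d : nat) (f : nat -> R -> R) : R :=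
  \sum_(p <- A) p.1 * \prod_(i < d) f i (p.2 i).

Lemma smolyak_evalS d L (f : nat -> R -> R) :
  cubature_eval (smolyak d.+1 L) d.+1 f =
  \sum_(k < L.+1) cubature_eval (smolyak d (L - k)) d f * rule_eval (rule_diff k) (f d).
Proof.
rewrite /cubature_eval smolyakS big_flatten big_map big_mkord.
apply: eq_bigr => k _.
rewrite big_allpairs_dep /= mulr_suml; apply: eq_bigr => p _.
rewrite /rule_eval mulr_sumr; apply: eq_bigr => q _.
rewrite big_ord_recr /= /upd eqxx -!mulrA; congr (_ * _).
rewrite mulrCA; congr (_ * _); apply: eq_bigr => i _.
by rewrite ltn_eqF.
Qed.

Variable a : nat.
Notation q := (2^-1 ^+ a : R).

(** A difference contains two rules, hence [2 m]. The product [2^(L-k) 2^k] does not depend on [k],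
    so every coordinate costs one factor [L + 1], later absorbed by a small power of [2^L]. *)
Lemma smolyak_size d L (m : nat) : (forall k, (size (U k) <= m * 2 ^ k)%N) ->
  (size (smolyak d L) <= (2 * m) ^ d * L.+1 ^ d * 2 ^ L)%N.
Proof.
move=> hU; have hD k : (size (rule_diff k) <= (2 * m) * 2 ^ k)%N.
  case: k => [|k] /=.
    by apply: leq_trans (hU 0%N) _; rewrite !muln1 leq_pmull.
  rewrite size_cat size_map -mulnA mul2n -addnn leq_add //.
  by apply: leq_trans (hU k) _; rewrite leq_mul // leq_exp2l.
elim: d L => [|d IH] L; first by rewrite /= !expn0 !mul1n expn_gt0.
rewrite smolyakS size_flatten /shape -map_comp sumnE big_map big_mkord.
apply: (@leq_trans (\sum_(k < L.+1) ((2 * m) ^ d * L.+1 ^ d * 2 ^ L) * (2 * m))).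
  apply: leq_sum => k _; rewrite /= size_allpairs.
  apply: leq_trans (leq_mul (IH _) (hD k)) _.
  have kL : (k <= L)%N by rewrite -ltnS.
  have -> : (2 ^ L = 2 ^ (L - k) * 2 ^ k)%N by rewrite -expnD subnK.
  have Lk : ((L - k).+1 ^ d <= L.+1 ^ d)%N by case: (d) => // d'; rewrite leq_exp2r // ltnS leq_subr.
  move: (2 * m)%N (2 ^ (L - k))%N (2 ^ k)%N ((2 * m) ^ d)%N ((L - k).+1 ^ d)%N (L.+1 ^ d)%N Lk.
  move=> W Z T X Y Y' YY; have -> : (X * Y * Z * (W * T) = (X * Z * W * T) * Y)%N by ring.
  have -> : (X * Y' * (Z * T) * W = (X * Z * W * T) * Y')%N by ring.
  by rewrite leq_mul.
rewrite sum_nat_const card_ord.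
by rewrite !expnS; apply: eq_leq; ring.
Qed.

Lemma smolyak_node d L (p : R * (nat -> R)) : 
  (forall k b, b \in U k -> I b.2) -> p \in smolyak d L -> forall i, I (p.2 i).
Proof.
move=> hU; have hD k b : b \in rule_diff k -> I b.2.
  case: k => [|k] /=; first exact: hU.
  by rewrite mem_cat => /orP[|/mapP[b1 hb1 ->]] /=; [apply: hU | apply: (hU k)].
elim: d L p => [|d IH] L p.
  by rewrite inE => /eqP -> i /=; rewrite unitIE lexx ler01.
rewrite smolyakS => /flatten_mapP[k _ /allpairsP[[p' b] [hp' hb ->]]] i /=.
by rewrite /upd; case: eqP => _; [exact: (hD _ _ hb) | exact: (IH _ _ hp' i)].
Qed.

(* The error telescopes along the last coordinate:
   I_d x I_1 - A(d+1, L) = sum_k (I_d - A(d, L-k)) x Delta_k + I_d x (I_1 - U_L). *)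
Lemma smolyak_error d L (M : R) (f : nat -> R -> R) (m : nat -> R) :
  1 <= M -> (forall i, `|m i| <= M) ->
  (forall i k, `|m i - rule_eval (U k) (f i)| <= M * q ^+ k) ->
  `|\prod_(i < d) m i - cubature_eval (smolyak d L) d f| <=
    (2 * (M * (1 + 2 ^+ a))) ^+ d * L.+1%:R ^+ d * q ^+ L.
Proof.
(* [M'] is such that the [k]-th difference is at most [M' q^k]: for [k > 0] it is bounded by
   [M q^(k-1) + M q^k], and [1/q = 2^a]. *)
move=> M1 mM hU; set M' := M * (1 + 2 ^+ a).
have M0 : 0 <= M by lra.
have q0 : 0 < q by rewrite exprn_gt0 // invr_gt0.
have q0' := ltW q0.
have A1 : 0 <= 2 ^+ a :> R by rewrite exprn_ge0.
have MM' : M <= M' by rewrite /M' ler_peMr //; lra.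
have M'0 : 0 <= M' by apply: le_trans MM'.
have hD i k : `|rule_eval (rule_diff k) (f i)| <= M' * q ^+ k.
  case: k => [|k] /=.
    rewrite expr0 mulr1.
    have -> : rule_eval (U 0%N) (f i) = m i - (m i - rule_eval (U 0%N) (f i)) by ring.
    apply: le_trans (ler_normB _ _) _; rewrite /M' mulrDr mulr1.
    apply: lerD; first exact: mM.
    have := hU i 0%N; rewrite expr0 mulr1 => /le_trans; apply.
    by rewrite ler_peMr // exprn_ege1 // ler1n.
  rewrite rule_eval_sub.
  have -> : rule_eval (U k.+1) (f i) - rule_eval (U k) (f i) =
    (m i - rule_eval (U k) (f i)) - (m i - rule_eval (U k.+1) (f i)) by ring.
  apply: le_trans (ler_normB _ _) _.
  have -> : M' * q ^+ k.+1 = M * q ^+ k + M * q ^+ k.+1.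
    rewrite /M' exprS; have -> : (2 : R) ^+ a = q^-1 by rewrite exprVn invrK.
    by field; rewrite gt_eqF.
  by apply: lerD; exact: hU.
elim: d L => [|d IH] L.
  rewrite /cubature_eval /= big_seq1 !big_ord0 mulr1 subrr normr0 ?expr0 ?mul1r.
  by rewrite exprn_ge0 //.
rewrite smolyak_evalS big_ord_recr /=.
set P := \prod_(i < d) m i.
have -> : P * m d - \sum_(k < L.+1) cubature_eval (smolyak d (L - k)) d f *
    rule_eval (rule_diff k) (f d) =
  \sum_(k < L.+1) (P - cubature_eval (smolyak d (L - k)) d f) *
    rule_eval (rule_diff k) (f d) + P * (m d - rule_eval (U L) (f d)).
  rewrite -sum_rule_diff mulrBr mulr_sumr.
  under [in RHS]eq_bigr do rewrite mulrBl.
  by rewrite sumrB; ring.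
have PM : `|P| <= M' ^+ d.
  rewrite /P normr_prod -[d in leRHS]card_ord -prodr_const.
  by apply: ler_prod => i _; rewrite normr_ge0 (le_trans (mM i)).
set X := L.+1%:R ^+ d * q ^+ L.
have L1 : 1 <= L.+1%:R :> R by rewrite ler1n.
have X0 : 0 <= X by rewrite mulr_ge0 ?exprn_ge0 ?ler0n //.
apply: le_trans (ler_normD _ _) _.
(* The first summand collects the [L + 1] terms with a difference, the second the remainder in the
   last coordinate; the factor 2 in [2 M'] leaves room for both. *)
apply: (@le_trans _ _ (L.+1%:R * ((2 * M') ^+ d * M' * X) + M' ^+ d * (M' * q ^+ L))).
  apply: lerD.
    apply: le_trans (ler_norm_sum _ _ _) _.
    rewrite -[X in X%:R * _](card_ord L.+1) mulr_natl -sumr_const.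
    apply: ler_sum => k _; rewrite normrM.
    have kL : (k <= L)%N by rewrite -ltnS.
    apply: le_trans (ler_pM (normr_ge0 _) (normr_ge0 _) (IH (L - k)%N) (hD d k)) _.
    have -> : (2 * M') ^+ d * (L - k).+1%:R ^+ d * q ^+ (L - k) * (M' * q ^+ k) =
       (2 * M') ^+ d * M' * ((L - k).+1%:R ^+ d * q ^+ L).
      have -> : q ^+ L = q ^+ (L - k) * q ^+ k by rewrite -exprD subnK.
      by ring.
    rewrite ler_wpM2l ?mulr_ge0 ?exprn_ge0 ?mulr_ge0 //.
    rewrite ler_wpM2r ?exprn_ge0 // lerXn2r ?nnegrE ?ler0n // ler_nat ltnS.
    exact: leq_subr.
  rewrite normrM ler_pM //; apply: le_trans (hU d L) _.
  by rewrite ler_wpM2r ?exprn_ge0 //.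
have -> : (2 * M') ^+ d.+1 * L.+1%:R ^+ d.+1 * q ^+ L =
    L.+1%:R * ((2 * M') ^+ d * M' * X) + (2 * M') ^+ d * M' * (L.+1%:R * X).
  by rewrite /X !exprS; ring.
rewrite lerD2l mulrA; apply: ler_pM; rewrite ?mulr_ge0 ?exprn_ge0 //.
  by rewrite ler_wpM2r // lerXn2r ?nnegrE ?mulr_ge0 //; lra.
rewrite /X mulrA ler_peMl ?exprn_ge0 //.
by rewrite -exprS exprn_ege1.
Qed.

End Smolyak.

(** * From lists of nodes to admissible algorithms *)

Section CompositeSeq.
Variables (R : realType) (a : nat) (w : 'I_a -> R).
Hypothesis a0 : (0 < a)%N.
Notation I := (@unitI R).

Definition composite_seq (n : nat) : seq (R * R) :=
  [seq (w i / n%:R, rule_node R n q i) | q <- iota 0 n, i <- enum 'I_a].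

Lemma composite_seq_eval n f : rule_eval (composite_seq n) f = composite_rule w n f.
Proof.
rewrite /rule_eval /composite_seq big_allpairs_dep /= /composite_rule.
rewrite -{1}(subn0 n) -/(index_iota 0 n) big_mkord; apply: eq_bigr => q _.
by rewrite /cell_rule big_enum.
Qed.

Lemma composite_seq_size n : size (composite_seq n) = (a * n)%N.
Proof. by rewrite size_allpairs size_iota size_enum_ord mulnC. Qed.

Lemma composite_seq_node n b : b \in composite_seq n -> I b.2.
Proof.
move=> /allpairsP[[q i] [/= hq _ ->]] /=; rewrite unitIE.
by apply: (rule_node_unit R a0); move: hq; rewrite mem_iota.
Qed.

End CompositeSeq.

Section SeqAlgorithm.
Variables (R : realType) (c : R).
Notation I := (@unitI R).
Notation node := (R * {fset nat} * (nat -> R))%type.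

(** Admissibility forbids an active coordinate to equal [c], so such coordinates are dropped from
    the active set. The anchored point stays the same and the cost can only fall. *)
Definition seq_algorithm (s : seq node) : algorithm R :=
  @Algorithm R (size s) (fun i => (tnth (in_tuple s) i).1.1)
    (fun i => [fset j in (tnth (in_tuple s) i).1.2 | (tnth (in_tuple s) i).2 j != c]%fset)
    (fun i => (tnth (in_tuple s) i).2).

Lemma seq_algorithm_admissible s : (forall p, List.In p s -> forall j, I (p.2 j)) ->
  admissible c (seq_algorithm s).
Proof.
move=> hs i j; rewrite !inE /= => /andP[_ /eqP tc]; split => //.
apply: hs; rewrite (tnth_nth (0, fset0, fun=> 0)) /=.
by elim: (s) (nat_of_ord i) (ltn_ord i) => [|p s' IH] [|k] //= h; [left | right; exact: IH].
Qed.

Lemma seq_algorithm_sum s (F : (nat -> R) -> R) :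
  \sum_(i < alg_size (seq_algorithm s)) alg_coef i * F (@sample_point _ c (seq_algorithm s) i) =
  \sum_(p <- s) p.1.1 * F (anchored_pt c p.1.2 p.2).
Proof.
rewrite [RHS]big_tnth; apply: eq_bigr => i _; congr (_ * F _).
apply/funext => j; rewrite /sample_point /anchored_pt /= !inE /=.
by case: (j \in _) => //=; case: eqP => //= ->.
Qed.

Lemma seq_algorithm_cost s (cost : nat -> R) :
  (forall k l : nat, (k <= l)%N -> cost k <= cost l) ->
  cost_unr cost (seq_algorithm s) <= \sum_(p <- s) cost #|` p.1.2|.
Proof.
move=> hc; rewrite [leRHS]big_tnth; apply: ler_sum => i _; apply: hc => /=.
by apply: fsubset_leq_card; apply/fsubsetP => j; rewrite !inE => /andP[].
Qed.

End SeqAlgorithm.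

(** * The multilevel combination of Smolyak rules *)

Section Multilevel.
Variables (R : realType) (a : nat) (c : R) (w : 'I_a -> R).
Hypotheses (a0 : (0 < a)%N) (Ic : unitI c) (hw : moment_weights w).
Notation I := (@unitI R).
Variables (D : nat) (phi : nat -> 'I_D).
Variables (V : nat -> seq (R * {fset nat})) (chi : nat -> {fset nat} -> bool).
Variables (Lev : nat -> nat) (Lam : nat).

Let U k := composite_seq w (2 ^ k).

Definition level_diff (l : nat) : seq (R * {fset nat}) :=
  if l is l'.+1 then V l ++ [seq (- b.1, b.2) | b <- V l'] else V 0%N.

Definition multilevel_nodes : seq (R * {fset nat} * (nat -> R)) :=
  flatten [seq [seq (p.1 * b.1, b.2, fun j => p.2 (phi j : nat)) |
     p <- smolyak U D (Lev l), b <- level_diff l] | l <- index_iota 0 Lam.+1].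

Definition multilevel_algorithm := seq_algorithm c multilevel_nodes.

Lemma multilevel_admissible : admissible c multilevel_algorithm.
Proof.
apply: seq_algorithm_admissible => p hp j.
suff : p.2 j \in [set t | I t] by rewrite inE.
have hU := smolyak_node (fun k => @composite_seq_node R a w a0 (2 ^ k)).
move: hp; rewrite /multilevel_nodes.
elim: (index_iota _ _) => [//|l s IH] /=; rewrite List.in_app_iff => -[|//].
have : forall x, x \in smolyak U D (Lev l) -> forall i, I (x.2 i) by move=> x; exact: hU.
elim: (smolyak _ _ _) => [//|x t IH2] hx /=; rewrite List.in_app_iff => -[|].
  elim: (level_diff l) => [//|b v IH3] /= [<-|//] /=.
  by apply/mem_set; apply: hx; rewrite mem_head.
by apply: IH2 => y yt; apply: hx; rewrite inE yt orbT.
Qed.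

Lemma multilevel_cost (cost : nat -> R) (N : nat -> R) (S : nat -> R) :
  (forall k, 1 <= cost k) ->
  (forall k l : nat, (k <= l)%N -> cost k <= cost l) ->
  (forall l, (size (smolyak U D (Lev l)))%:R <= N l) ->
  (forall l, \sum_(b <- V l) cost #|` b.2| <= S l) ->
  cost_unr cost multilevel_algorithm <=
    \sum_(l < Lam.+1) N l * (S l + S l.-1).
Proof.
move=> c1 cm hN hS; apply: le_trans (seq_algorithm_cost _ _ cm) _.
have S0 l : 0 <= S l.
  apply: le_trans (hS l); apply: sumr_ge0 => b _; apply: le_trans (c1 _); exact: ler01.
rewrite /multilevel_nodes big_flatten big_map big_mkord; apply: ler_sum => l _.
rewrite big_allpairs_dep /= big_const_seq count_predT iter_addr_0 -mulr_natl.
have N0 : 0 <= N l by apply: le_trans (hN l).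
have hd : \sum_(b <- level_diff l) cost #|` b.2| <= S l + S l.-1.
  case: (nat_of_ord l) => [|k] /=; first by rewrite -[leLHS]addr0 lerD.
  by rewrite big_cat big_map /= lerD.
apply: ler_pM => //; apply: sumr_ge0 => b _; apply: le_trans (c1 _); exact: ler01.
Qed.

(** [chi] is a step function of the level, so its increments select the single level [l0]: each
    component is treated by one Smolyak rule, or by none if [l0 > Lam]. *)
Lemma first_level_sum (x : nat -> R) (u : {fset nat}) l0 :
  (forall l, chi l u -> chi l.+1 u) -> chi l0 u -> (forall l, (l < l0)%N -> ~~ chi l u) ->
  \sum_(l < Lam.+1) x l * ((chi l u)%:R - (if nat_of_ord l is l'.+1 then chi l' u else false)%:R) =
  if (l0 <= Lam)%N then x l0 else 0.
Proof.
move=> hm h0 hlt.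
have chiE l : chi l u = (l0 <= l)%N.
  case: (leqP l0 l) => [|/hlt/negbTE//].
  elim: l => [|l IH]; first by rewrite leqn0 => /eqP <-.
  by rewrite leq_eqVlt => /predU1P[<-//|/IH/hm].
have dE (l : nat) : (chi l u)%:R - (if l is l'.+1 then chi l' u else false)%:R = (l == l0)%:R :> R.
  case: l => [|l]; rewrite !chiE; first by rewrite subr0 leqn0 eq_sym.
  by rewrite -(ltnS l0 l); have [h|h|h] := ltngtP l.+1 l0; rewrite ?subrr ?subr0.
under eq_bigr do rewrite dE.
case: ifP => h.
  rewrite (bigD1 (Ordinal (h : (l0 < Lam.+1)%N))) //= eqxx mulr1 big1 ?addr0 // => i.
  by rewrite -val_eqE /= => /negbTE ->; rewrite mulr0.
rewrite big1 // => i _; case: eqP => [il|]; last by rewrite mulr0.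
by rewrite -il -ltnS ltn_ord in h.
Qed.

(** Large enough for the means of features (2), the empty product (1) and the error constant
    [weight_sum w + 1], the three needs of [coord_bounds]. *)
Let M := weight_sum w + 3.

Definition smolyak_bound (L : nat) : R :=
  (2 * (M * (1 + 2 ^+ a))) ^+ D * L.+1%:R ^+ D * (2^-1 ^+ a) ^+ L.

(** Groups the coordinates of [u] by class. Injectivity of [phi] on [u] leaves at most one factor,
    and a class missed by [u] carries the constant 1, whose exact integration is [rule_one]. *)
Let coord_feature (u : {fset nat}) (tau : nat -> nat + R) (i : nat) (x : R) : R :=
  \prod_(j <- u | phi j == i :> nat) feature a c (tau j) x.

Let coord_mean (u : {fset nat}) (tau : nat -> nat + R) (i : nat) : R :=
  \prod_(j <- u | phi j == i :> nat) feature_mean a c (tau j).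

Let W0 : 0 <= weight_sum w. Proof. exact: sumr_ge0. Qed.

Let rule_one n : (0 < n)%N -> composite_rule w n (fun=> 1) = 1.
Proof.
move=> n0; have := composite_rule_poly a0 hw 0 n0 a0.
by rewrite subr0 expr1 oppr0 expr1 subr0 divr1.
Qed.

Let coord_bounds u tau i k : {in u &, injective phi} ->
  (forall j, feature_index a (tau j)) ->
  `|coord_mean u tau i| <= M /\
  `|coord_mean u tau i - rule_eval (U k) (coord_feature u tau i)| <=
    M * (2^-1 ^+ a) ^+ k.
Proof.
move=> phiI htau.
have qE : (2^-1 ^+ a) ^+ k = (2 ^ k)%N%:R^-1 ^+ a :> R.
  by rewrite natrX -exprVn -!exprM mulnC.
have q0 : 0 <= (2^-1 ^+ a) ^+ k :> R by rewrite !exprn_ge0 // invr_ge0.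
rewrite composite_seq_eval.
pose s := [seq j <- u | phi j == i :> nat].
have -> : coord_feature u tau i = fun x => \prod_(j <- s) feature a c (tau j) x.
  by apply/funext => x; rewrite /coord_feature -big_filter.
have -> : coord_mean u tau i = \prod_(j <- s) feature_mean a c (tau j).
  by rewrite /coord_mean -big_filter.
have us : uniq s by rewrite filter_uniq ?fset_uniq.
have hs j : j \in s -> j \in u /\ phi j = i :> nat.
  by rewrite mem_filter => /andP[/eqP].
have n0 : (0 < 2 ^ k)%N by rewrite expn_gt0.
have M3 : 3 <= M by rewrite /M lerDr.
case: s us hs => [|j [|j' s]] /= us hs.
- rewrite big_nil; under [X in composite_rule _ _ X]eq_fun do rewrite big_nil.
  rewrite rule_one // subrr normr0 normr1; split; first by lra.
  by apply: mulr_ge0 => //; lra.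
- rewrite big_seq1; under [X in composite_rule _ _ X]eq_fun do rewrite big_seq1.
  split; first by apply: le_trans (feature_mean_le Ic (htau j)) _; lra.
  have := feature_rule_error c a0 hw (htau j) n0; rewrite -qE => /le_trans; apply.
  by rewrite ler_wpM2r // /M; lra.
- have [ju pj] := hs j (mem_head _ _).
  have [] := hs j'; first by rewrite !inE eqxx orbT.
  move=> ju' pj'; have jj : j = j'.
    by apply: phiI => //; apply: val_inj; rewrite /= pj pj'.
  by rewrite jj inE eqxx in us.
Qed.

Let prod_coord (u : {fset nat}) tau (x : nat -> R) :
  \prod_(i < D) coord_feature u tau i (x i) =
  \prod_(j <- u) feature a c (tau j) (x (phi j)).
Proof.
rewrite [RHS](partition_big phi xpredT) //=; apply: eq_bigr => i _.
rewrite /coord_feature; apply: eq_big => [j|j /eqP]; first by rewrite val_eqE.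
by move=> <-.
Qed.

Let prod_coord_mean (u : {fset nat}) tau :
  \prod_(i < D) coord_mean u tau i = \prod_(j <- u) feature_mean a c (tau j).
Proof.
rewrite [RHS](partition_big phi xpredT) //=; apply: eq_bigr => i _.
Qed.

Let prod_anchored (u : {fset nat}) tau (v : {fset nat}) (t : nat -> R) :
  (forall j, feature_index a (tau j)) ->
  \prod_(j <- u) feature a c (tau j) (anchored_pt c v t j) =
  (u `<=` v)%fset%:R * \prod_(j <- u) feature a c (tau j) (t j).
Proof.
move=> htau; rewrite /anchored_pt; have [/fsubsetP uv|] := boolP (u `<=` v)%fset.
  by rewrite mul1r; apply: eq_big_seq => j /uv ->.
rewrite mul0r => /fsubsetPn[j ju jv].
by rewrite (big_rem j) //= (negbTE jv) feature_anchor // mul0r.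
Qed.

(** Features vanish at [c], so a projection whose variables do not contain [u] contributes 0 and
    [V l] acts as [chi l u]; the increments leave the Smolyak rule of the first level admitting [u].
    Beyond [Lam] the algorithm returns 0, and the means are bounded by 2 per factor. *)
Lemma multilevel_error (u : {fset nat}) tau l0 : {in u &, injective phi} ->
  (forall j, feature_index a (tau j)) ->
  (forall l, \sum_(b <- V l) b.1 * (u `<=` b.2)%fset%:R = (chi l u)%:R) ->
  (forall l, chi l u -> chi l.+1 u) -> chi l0 u ->
  (forall l, (l < l0)%N -> ~~ chi l u) ->
  `|\prod_(j <- u) feature_mean a c (tau j) -
    \sum_(i < alg_size multilevel_algorithm) alg_coef i *
      \prod_(j <- u) feature a c (tau j) (@sample_point _ c multilevel_algorithm i j)| <=
  if (l0 <= Lam)%N then smolyak_bound (Lev l0) else 2 ^+ #|` u|.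
Proof.
move=> phiI htau hV hm h0 hlt.
have -> : \sum_(i < alg_size multilevel_algorithm) alg_coef i *
      \prod_(j <- u) feature a c (tau j) (@sample_point _ c multilevel_algorithm i j) =
   if (l0 <= Lam)%N then cubature_eval (smolyak U D (Lev l0)) D (coord_feature u tau) else 0.
  rewrite (seq_algorithm_sum c multilevel_nodes
    (fun x => \prod_(j <- u) feature a c (tau j) (x j))).
  rewrite -(first_level_sum (fun l => cubature_eval (smolyak U D (Lev l)) D
    (coord_feature u tau)) hm h0 hlt).
  rewrite /multilevel_nodes big_flatten big_map big_mkord; apply: eq_bigr => l _.
  have -> : (chi l u)%:R - (if nat_of_ord l is l'.+1 then chi l' u else false)%:R =
      \sum_(b <- level_diff l) b.1 * (u `<=` b.2)%fset%:R.
    case: (nat_of_ord l) => [|k]; first by rewrite subr0 -hV.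
    rewrite big_cat big_map /= -!hV -sumrN; congr (_ + _).
    by apply: eq_bigr => b _; rewrite mulNr.
  rewrite big_allpairs_dep /= /cubature_eval mulr_suml; apply: eq_bigr => p _.
  rewrite mulr_sumr; apply: eq_bigr => b _.
  by rewrite prod_anchored // prod_coord; ring.
case: ifP => _; last first.
  rewrite subr0 normr_prod -[X in _ <= X](_ : \prod_(j <- u) 2 = _).
    apply: ler_prod => j _; rewrite normr_ge0; exact: feature_mean_le.
  by rewrite big_const_seq count_predT iter_mulr_1.
rewrite -prod_coord_mean; apply: smolyak_error.
- by apply: (@le_trans _ _ 3); [rewrite ler1n | rewrite lerDr].
- by move=> i; have [] := coord_bounds i 0 phiI htau.
- by move=> i k; have [] := coord_bounds i k phiI htau.
Qed.

End Multilevel.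

(** * Complexity *)

Section RealPowers.
Variable R : realType.
Implicit Types x y t : R.

Lemma pow2D x y : 2 `^ (x + y) = 2 `^ x * 2 `^ y.
Proof. by rewrite powRD // pnatr_eq0 implybT. Qed.

Lemma pow2_le x y : x <= y -> 2 `^ x <= 2 `^ y.
Proof. by move=> xy; apply: ler_powR => //; rewrite ler1n. Qed.

Lemma pow2_nat n : 2 `^ n%:R = 2 ^+ n :> R.
Proof. by rewrite powR_mulrn. Qed.

Lemma pow2_ge1 x : 0 <= x -> 1 <= 2 `^ x.
Proof. by move=> /pow2_le; rewrite powRr0. Qed.

Lemma pow2E x : 2 `^ x = expR (x * ln 2).
Proof. by rewrite /powR ifF // pnatr_eq0. Qed.

Lemma linear_le_pow2 (A B eta : R) : 0 <= A -> 0 <= B -> 0 < eta ->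
  exists2 C, 0 <= C & forall t, 0 <= t -> A * t + B <= C * 2 `^ (eta * t).
Proof.
move=> A0 B0 eta0; have l2 : 0 < ln (2 : R) by rewrite ln_gt0 // ltr1n.
have el : 0 < eta * ln 2 by rewrite mulr_gt0.
exists (A / (eta * ln 2) + B); first by rewrite addr_ge0 // divr_ge0 // ltW.
move=> t t0; rewrite mulrDl; apply: lerD; last first.
  by rewrite ler_peMr // pow2_ge1 // mulr_ge0 // ltW.
have : eta * t * ln 2 <= 2 `^ (eta * t).
  by rewrite pow2E; have := expR_ge1Dx (eta * t * ln 2); lra.
move: (2 `^ _) => X hX; rewrite mulrAC ler_pdivlMr // -!mulrA ler_wpM2l //.
by apply: le_trans hX; rewrite mulrCA mulrA.
Qed.

Lemma poly_le_pow2 (D : nat) (eta : R) : 0 < eta ->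
  exists2 C, 0 <= C & forall L : nat, L.+1%:R ^+ D <= C * 2 `^ (eta * L%:R).
Proof.
move=> eta0; have e' : 0 < eta / D.+1%:R by rewrite divr_gt0 // ltr0n.
have [C C0 hC] := linear_le_pow2 ler01 ler01 e'.
exists (C ^+ D); first by rewrite exprn_ge0.
move=> L; have := hC L%:R (ler0n _ _); rewrite mul1r natr1 => h.
apply: (@le_trans _ _ ((C * 2 `^ (eta / D.+1%:R * L%:R)) ^+ D)).
  by rewrite lerXn2r ?nnegrE ?ler0n // mulr_ge0 // powR_ge0.
rewrite exprMn ler_wpM2l ?exprn_ge0 // -powR_mulrn ?powR_ge0 // -powRrM.
apply: pow2_le.
have -> : eta / D.+1%:R * L%:R * D%:R = eta * L%:R * (D%:R / D.+1%:R) by ring.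
rewrite ler_piMr ?mulr_ge0 ?ler0n ?(ltW eta0) //.
by rewrite ler_pdivrMr ?ltr0n // mul1r ler_nat.
Qed.

(** Dyadic blocks: the [2^n] terms from [2^n] on are at most [2^(-n (1+delta))] each, which leaves a
    geometric series of ratio [2^-delta]. *)
Lemma zeta_bound (delta : R) : 0 < delta ->
  exists2 Z, 0 <= Z & forall N : nat, \sum_(i < N) i.+1%:R `^ (- (1 + delta)) <= Z.
Proof.
move=> d0; pose r : R := 2 `^ (- delta).
have r1 : r < 1.
  by rewrite /r pow2E expR_lt1 mulNr oppr_lt0 mulr_gt0 // ln_gt0 // ltr1n.
have r0 : 0 <= r by exact: powR_ge0.
exists (1 - r)^-1; first by rewrite invr_ge0 subr_ge0 ltW.
pose h (j : nat) : R := j%:R `^ (- (1 + delta)).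
have h0 j : 0 <= h j by exact: powR_ge0.
have blk n : \sum_(1 <= j < 2 ^ n) h j <= \sum_(k < n) r ^+ k.
  elim: n => [|n IH]; first by rewrite expn0 big_geq // big_ord0.
  rewrite (@big_cat_nat _ _ _ (2 ^ n)) ?expn_gt0 ?leq_exp2l //= big_ord_recr /=.
  apply: lerD => //; apply: (@le_trans _ _ (\sum_(2 ^ n <= j < 2 ^ n.+1) h (2 ^ n)%N)).
    rewrite !big_nat; apply: ler_sum => j /andP[nj _]; rewrite /h !powRN.
    have j0 : (0 < j)%N by apply: leq_trans nj; rewrite expn_gt0.
    rewrite lef_pV2 ?posrE ?powR_gt0 ?ltr0n ?expn_gt0 //.
    apply: ge0_ler_powR; rewrite ?nnegrE ?ler0n ?ler_nat //; lra.
  rewrite sumr_const_nat expnS mul2n -addnn addnK /h -[leLHS]mulr_natl !natrX -!pow2_nat.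
  have -> : r ^+ n = 2 `^ (- delta * n%:R) by rewrite /r -powR_mulrn ?powR_ge0 // -powRrM.
  rewrite -powRrM -pow2D.
  by apply: pow2_le; rewrite le_eqVlt; apply/orP; left; apply/eqP; ring.
have geo n : \sum_(k < n) r ^+ k <= (1 - r)^-1.
  have h1r : 0 < 1 - r by rewrite subr_gt0.
  have r1n : 1 - r != 0 by rewrite gt_eqF.
  have := subrX1 r n; rewrite -opprB -[r - 1]opprB mulNr => /oppr_inj e.
  rewrite -(ler_pM2l h1r) -e divff // lerBlDr lerDl exprn_ge0 //.
move=> N; apply: le_trans (geo N); apply: le_trans (blk N).
have -> : \sum_(i < N) i.+1%:R `^ (- (1 + delta)) = \sum_(1 <= j < N.+1) h j.
  by rewrite big_add1 big_mkord.
rewrite [leRHS](@big_cat_nat _ _ _ N.+1) //=; last by rewrite ltn_expl.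
by rewrite lerDl sumr_ge0.
Qed.

End RealPowers.

Lemma sum_uniq_le (R : realType) (F : nat -> R) (s : seq nat) :
  (forall i, 0 <= F i) -> uniq s -> exists N, \sum_(i <- s) F i <= \sum_(i < N) F i.
Proof.
move=> F0 us; exists (\max_(i <- s) i).+1.
rewrite -(big_mkord xpredT F) [leRHS](bigID (fun i => i \in s)) /=.
have -> : \sum_(0 <= i < (\max_(i <- s) i).+1 | i \in s) F i = \sum_(i <- s) F i.
  rewrite -[LHS]big_filter; apply: perm_big; apply: uniq_perm => //.
    by rewrite filter_uniq // iota_uniq.
  move=> i; rewrite mem_filter mem_index_iota /= ltnS; case: (boolP (i \in s)) => //= h.
  exact: (leq_bigmax_seq (F := id)) h _.
by rewrite lerDl sumr_ge0.
Qed.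

Lemma active_card (R : realType) (gam : {fset nat} -> R) (D : nat) (phi : nat -> 'I_D) :
  (forall u : {fset nat}, 0 < gam u -> {in u &, injective phi}) ->
  forall u, active gam u -> (#|` u| <= D)%N.
Proof.
move=> hphi u Au; have inj := hphi u Au.
rewrite -[X in (_ <= X)%N](card_ord D) -(size_map phi).
have us : uniq [seq phi i | i <- u] by rewrite map_inj_in_uniq ?fset_uniq.
by rewrite -(card_uniqP us) max_card.
Qed.

(** * Choice of the parameters and bound on the complexity *)

Section Complexity.
Variable R : realType.
Notation I := (@unitI R).
Variables (a : nat) (c : R) (K : R -> R -> R).
Hypotheses (a0 : (0 < a)%N) (Ic : I c).
Hypothesis hK : reproducing_kernel I (sobolev a c) (sobolev_ip a c) K.
Variables (gam : {fset nat} -> R).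
Hypotheses (gam0 : forall u, 0 <= gam u).
Variables (mu : {measure set (seqspace R) -> \bar R}).
Hypothesis hmu : is_product_uniform mu.
Variables (H : set ((nat -> R) -> R)).
Variables (ip : ((nat -> R) -> R) -> ((nat -> R) -> R) -> R).
Hypothesis hH : is_rkhs (weighted_domain K gam) H ip (weighted_kernel K gam).
Variables (cost : nat -> R).
Hypotheses (cost1 : forall k, 1 <= cost k)
  (cost_mono : forall k l : nat, (k <= l)%N -> cost k <= cost l).
Variables (D : nat) (phi : nat -> 'I_D).
Hypothesis hphi : forall u : {fset nat}, 0 < gam u -> {in u &, injective phi}.
Variables (idx : {fset nat} -> nat) (Cg q : R).
Hypotheses (idx_inj : forall u v, active gam u -> active gam v -> idx u = idx v -> u = v)
  (Cg0 : 0 <= Cg) (q1 : 1 < q)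
  (gam_le : forall u, active gam u -> gam u <= Cg * (idx u).+1%:R `^ (- q)).
Variables (V : nat -> seq (R * {fset nat})) (chi : nat -> {fset nat} -> bool).
Variables (Cv sg : R).
Hypotheses
  (hV : forall l u, active gam u ->
    \sum_(b <- V l) b.1 * (u `<=` b.2)%fset%:R = (chi l u)%:R)
  (chi_mono : forall l u, active gam u -> chi l u -> chi l.+1 u)
  (chi_idx : forall l u, active gam u -> (idx u < 2 ^ l)%N -> chi l u)
  (Cv0 : 0 <= Cv) (sg0 : 0 <= sg)
  (hVcost : forall l, \sum_(b <- V l) cost #|` b.2| <= Cv * 2 `^ (sg * l%:R)).

Let gamd u : active gam u -> (#|` u| <= D)%N.
Proof. exact: (active_card hphi). Qed.

Let idx_sum (delta : R) : 0 < delta -> exists2 Z, 0 <= Z &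
  forall s, finite_part (active gam) s ->
    \sum_(u <- s) (idx u).+1%:R `^ (- (1 + delta)) <= Z.
Proof.
move=> d0; have [Z Z0 hZ] := zeta_bound d0; exists Z => // s [us sA].
have um : uniq (map idx s).
  rewrite map_inj_in_uniq // => u v /sA Au /sA Av; exact: idx_inj.
have [|N hN] := @sum_uniq_le R (fun i => i.+1%:R `^ (- (1 + delta))) _ _ um.
  by move=> i; exact: powR_ge0.
by rewrite big_map in hN; apply: le_trans (hZ N).
Qed.

Let gam_bounded : exists2 G, 0 <= G & forall s, finite_part (active gam) s ->
  \sum_(u <- s) gam u <= G.
Proof.
have d0 : 0 < q - 1 by rewrite subr_gt0.
have [Z Z0 hZ] := idx_sum d0; exists (Cg * Z); first exact: mulr_ge0.
move=> s fs; apply: le_trans (ler_wpM2l Cg0 (hZ s fs)).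
rewrite mulr_sumr !big_seq; apply: ler_sum => u us.
have -> : - (1 + (q - 1)) = - q by ring.
by apply: gam_le; case: fs => _; apply.
Qed.

(** Only an upper bound on the first level is claimed: when levels are unions, a set may be covered
    before its rank requires it. *)
Let first_level u : active gam u -> exists l0, [/\ chi l0 u,
  forall l, (l < l0)%N -> ~~ chi l u & 2 ^+ l0 <= 2 * (idx u).+1%:R :> R].
Proof.
move=> Au; have ex : exists l, chi l u.
  by exists (idx u); apply: chi_idx => //; exact: ltn_expl.
exists (ex_minn ex); case: ex_minnP => l0 h0 hmin; split => //.
  by move=> l ll0; apply/negP => /hmin; rewrite leqNgt ll0.
case: l0 h0 hmin => [_ _|l0 _ hmin].
  by rewrite expr0 -natrM ler1n.
have : ~~ chi l0 u by apply/negP => /hmin; rewrite ltnn.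
move=> /(contra (chi_idx Au)); rewrite -leqNgt => hl.
by rewrite exprS ler_wpM2l // -natrX ler_nat leqW.
Qed.

Variable p : R.
Hypotheses (pa : a%:R^-1 < p) (psg : 2 * sg < p * (q - 1)).

Let p0 : 0 < p. Proof. by apply: lt_trans pa; rewrite invr_gt0 ltr0n. Qed.

Lemma multilevel_rate : exists C3 C7 : R, [/\ 0 <= C3, 0 <= C7 &
  forall t, 0 <= t -> exists Q : algorithm R, [/\ admissible c Q,
    (wc_error mu c (weighted_domain K gam) H ip Q <= (C3 * 2 `^ (- t))%:E)%E &
    cost_unr cost Q <= C7 * 2 `^ (p * t)]].
Proof.
have [w hw] := moment_weights_exist R a0.
have [G G0 gamG] := gam_bounded.
(* Halfway between [1 + 2 sg / p] and [q]. With [2 th = q1' - 1] this gives both [sg < p th], for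
   the cost, and [2 th - q = -(1 + del)], for the convergence of the squared errors. *)
pose q1' := (q + 1 + 2 * sg / p) / 2.
have sgp : 2 * sg / p < q - 1 by rewrite ltr_pdivrMr // [X in _ < X]mulrC.
have sgp0 : 0 <= 2 * sg / p by rewrite divr_ge0 ?mulr_ge0 // ltW.
pose th := (q1' - 1) / 2.
have th0 : 0 < th by rewrite /th /q1'; lra.
pose del := q - q1'.
have del0 : 0 < del by rewrite /del /q1'; lra.
have sgth : sg < p * th.
  have : 2 * sg / p < 2 * th by rewrite /th /q1'; lra.
  rewrite ltr_pdivrMr //; lra.
have aR0 : 0 < a%:R :> R by rewrite ltr0n.
(* Strictly between the lower bounds and [p]; the slack [p - pp] pays for the number of levels. *)
pose pp := (Num.max a%:R^-1 (sg / th) + p) / 2.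
have mxp : Num.max a%:R^-1 (sg / th) < p.
  by rewrite gt_max pa ltr_pdivrMr.
have ppp : pp < p by rewrite /pp; lra.
have mxpp : Num.max a%:R^-1 (sg / th) < pp by rewrite /pp; lra.
have [pp1 pp2] : a%:R^-1 < pp /\ sg / th < pp.
  by move: mxpp; rewrite gt_max => /andP[].
have pp0 : 0 < pp by apply: lt_trans pp1; rewrite invr_gt0.
have sgpp : sg <= pp * th by move: pp2; rewrite ltr_pdivrMr // => /ltW.
(* Exponent granted to the powers of [L + 1]. It solves [1 + kap = pp (a - kap)]: up to constants, a
   Smolyak rule has size [2^((1+kap) L)] and error [2^(-(a-kap) L)], so its size is its error to the
   power [-pp]. *)
pose kap := (pp * a%:R - 1) / (1 + pp).
have ppa : 1 < pp * a%:R by rewrite -ltr_pdivrMr // mul1r.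
have opp0 : 0 < 1 + pp by lra.
have kap0 : 0 < kap by rewrite divr_gt0 // subr_gt0.
pose al := a%:R - kap.
have alE : al = (a%:R + 1) / (1 + pp) by rewrite /al /kap; field; rewrite gt_eqF.
have al0 : 0 < al by rewrite alE divr_gt0 // addr_gt0.
have kapE : 1 + kap = pp * al by rewrite alE /kap; field; rewrite gt_eqF.
have [Ck Ck0 hCk] := poly_le_pow2 D kap0.
pose B0 : R := (2 * ((weight_sum w + 3) * (1 + 2 ^+ a))) ^+ D.
have W0 : 0 <= weight_sum w by exact: sumr_ge0.
have B00 : 0 <= B0.
  by rewrite exprn_ge0 // mulr_ge0 // mulr_ge0 ?addr_ge0 ?exprn_ge0.
have bound_le L : smolyak_bound w D L <= B0 * Ck * 2 `^ (- (al * L%:R)).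
  rewrite /smolyak_bound -/B0 -!mulrA ler_wpM2l //.
  have -> : (2^-1 ^+ a) ^+ L = 2 `^ (- (a%:R * L%:R)) :> R.
    by rewrite -exprM exprVn -pow2_nat natrM powRN.
  apply: le_trans (ler_wpM2r (powR_ge0 _ _) (hCk L)) _.
  rewrite -mulrA -pow2D; apply: ler_wpM2l => //.
  by apply: pow2_le; rewrite /al; lra.
pose U k := composite_seq w (2 ^ k).
have size_le L : (size (smolyak U D L))%:R <=
    (2 * a%:R) ^+ D * Ck * 2 `^ ((1 + kap) * L%:R).
  have hU k : (size (U k) <= a * 2 ^ k)%N by rewrite composite_seq_size.
  have := smolyak_size D L hU; rewrite -(ler_nat R) => /le_trans; apply.
  rewrite !natrM !natrX natrM -!mulrA ler_wpM2l ?exprn_ge0 ?mulr_ge0 ?ler0n //.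
  apply: le_trans (ler_wpM2r _ (hCk L)) _; first by rewrite exprn_ge0.
  rewrite -mulrA -pow2_nat -pow2D; apply: ler_wpM2l => //.
  by apply: pow2_le; lra.
have [Z Z0 hZ] := idx_sum del0.
(* [B0 * Ck] serves the sets treated by a Smolyak rule, [2 ^+ D] those beyond the last level; [2^th]
   converts the level [l0] into the rank. *)
pose C2 := (B0 * Ck + 2 ^+ D) * 2 `^ th.
have C20 : 0 <= C2 by apply: mulr_ge0; [apply: addr_ge0; [exact: mulr_ge0 | exact: exprn_ge0] | exact: powR_ge0].
pose C3 := Num.sqrt (Cg * a%:R ^+ D * Z) * C2.
have thi0 : 0 <= th^-1 by rewrite invr_ge0 ltW.
have ppp0 : 0 < p - pp by rewrite subr_gt0.
have [C6 C60 hC6] := linear_le_pow2 thi0 (ler0n R 2) ppp0.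
pose C4 := (2 * a%:R) ^+ D * Ck.
have C40 : 0 <= C4 by rewrite mulr_ge0 // exprn_ge0 // mulr_ge0 ?ler0n.
pose C7 := C6 * (2 * (C4 * Cv) * 2 `^ (1 + kap + sg)).
exists C3, C7; split.
- by apply: mulr_ge0 => //; exact: sqrtr_ge0.
- apply: mulr_ge0 => //; apply: mulr_ge0; last exact: powR_ge0.
  by apply: mulr_ge0 => //; exact: mulr_ge0.
move=> t t0.
(* Real level at which [2^(- al L)] equals the target accuracy [2^(l th - t)]. [Lev] rounds it up,
   and is 1 once it is negative, by the default value of [truncn]. *)
pose x (l : nat) := (t - l%:R * th) / al.
pose Lev l := (Num.truncn (x l)).+1.
pose Lam := (Num.truncn (t / th)).+1.
pose Q := multilevel_algorithm c w phi V Lev Lam.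
have tth0 : 0 <= t / th by rewrite divr_ge0 // ltW.
have LamE : t <= Lam%:R * th /\ Lam%:R <= t / th + 1.
  have /andP[h1 h2] := truncn_itv tth0; split.
    by move: h2; rewrite ltr_pdivrMr // => /ltW.
  by rewrite /Lam -natr1 lerD2r.
have LevE l : x l <= (Lev l)%:R by exact: ltW (truncnS_gt _).
have hQ : admissible c Q by exact: multilevel_admissible.
exists Q; split => //.
- pose E (u : {fset nat}) := C2 * 2 `^ (- t) * (idx u).+1%:R `^ th.
  apply: (error_le a0 Ic hK gam0 gamd gamG hmu hH hQ (E := E)).
  + by apply: mulr_ge0; [apply: mulr_ge0 => //; exact: sqrtr_ge0 | exact: powR_ge0].
  + move=> u tau Au htau.
    have [l0 [h0 hlt h2]] := first_level Au.
    apply: le_trans (multilevel_error a0 Ic hw Lev Lam (hphi Au) htau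
      (fun l => hV l Au) (fun l => @chi_mono l u Au) h0 hlt) _.
    have hl0 : 2 `^ (l0%:R * th) <= 2 `^ th * (idx u).+1%:R `^ th.
      rewrite -powRM ?ler0n // powRrM pow2_nat.
      by apply: (ge0_ler_powR (ltW th0)); rewrite ?nnegrE ?exprn_ge0 ?mulr_ge0 ?ler0n.
    have E2 : (B0 * Ck + 2 ^+ D) * 2 `^ (- t) * 2 `^ (l0%:R * th) <= E u.
      have -> : E u = (B0 * Ck + 2 ^+ D) * 2 `^ (- t) * (2 `^ th * (idx u).+1%:R `^ th).
        by rewrite /E /C2; ring.
      apply: ler_wpM2l hl0; apply: mulr_ge0; last exact: powR_ge0.
      by apply: addr_ge0; [exact: mulr_ge0 | exact: exprn_ge0].
    apply: le_trans E2; rewrite -mulrA -pow2D.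
    case: ifP => hL.
      apply: le_trans (bound_le _) _; apply: ler_pM; rewrite ?mulr_ge0 ?powR_ge0 //.
        by rewrite lerDl exprn_ge0.
      apply: pow2_le.
      have := LevE l0; rewrite /x ler_pdivrMr //; lra.
    (* Here [l0 > Lam], hence [l0 th >= t], and the claimed error is no smaller than the trivial
       bound. *)
    apply: (@le_trans _ _ (2 ^+ D * 1)).
      by rewrite mulr1 ler_weXn2l ?ler1n // gamd.
    apply: ler_pM; rewrite ?exprn_ge0 //.
      by rewrite lerDr mulr_ge0.
    apply: pow2_ge1; have [h _] := LamE.
    have : Lam%:R * th <= l0%:R * th by rewrite ler_wpM2r ?(ltW th0) // ler_nat ltnW // ltnNge hL.
    lra.
  + move=> s fs.
    have -> : (C3 * 2 `^ (- t)) ^+ 2 = (Cg * a%:R ^+ D * (C2 * 2 `^ (- t)) ^+ 2) * Z.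
      rewrite /C3 -mulrA exprMn sqr_sqrtr ?mulr_ge0 ?exprn_ge0 ?ler0n //; ring.
    have A0 : 0 <= Cg * a%:R ^+ D * (C2 * 2 `^ (- t)) ^+ 2.
      by rewrite mulr_ge0 ?sqr_ge0 // mulr_ge0 ?exprn_ge0 ?ler0n.
    apply: le_trans (ler_wpM2l A0 (hZ s fs)).
    rewrite mulr_sumr !big_seq; apply: ler_sum => u us.
    have Au : active gam u by case: fs => _; apply.
    have EE : E u * E u = (C2 * 2 `^ (- t)) ^+ 2 * (idx u).+1%:R `^ (2 * th).
      have -> : 2 * th = th + th by ring.
      by rewrite powRD ?pnatr_eq0 ?implybT // /E; ring.
    have -> : - (1 + del) = - q + 2 * th by rewrite /del /th /q1'; field; rewrite gt_eqF.
    rewrite powRD ?pnatr_eq0 ?implybT // EE.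
    set Y := (C2 * 2 `^ (- t)) ^+ 2.
    have -> : Cg * a%:R ^+ D * Y * ((idx u).+1%:R `^ (- q) * (idx u).+1%:R `^ (2 * th)) =
      (Cg * (idx u).+1%:R `^ (- q)) * (a%:R ^+ D * (Y * (idx u).+1%:R `^ (2 * th))) by ring.
    have Y0 : 0 <= Y * (idx u).+1%:R `^ (2 * th) by rewrite mulr_ge0 ?sqr_ge0 ?powR_ge0.
    apply: ler_pM; [exact: gam0 | | exact: gam_le |].
      by apply: mulr_ge0 => //; rewrite exprn_ge0.
    by apply: ler_wpM2r => //; rewrite ler_weXn2l ?ler1n // gamd.
- pose N l := C4 * 2 `^ ((1 + kap) * (Lev l)%:R).
  pose S (l : nat) := Cv * 2 `^ (sg * l%:R).
  apply: le_trans (multilevel_cost c phi Lam cost1 cost_mono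
    (fun l => size_le (Lev l) : _ <= N l) (hVcost : forall l, _ <= S l)) _.
  (* The exponents balance on every level: [(1 + kap) x l = pp (t - l th)] while [sg l <= pp th l].
     Rounding in [Lev] and [Lam] accounts for [1 + kap + sg]. *)
  have term (l : 'I_Lam.+1) : N l * (S l + S l.-1) <=
      2 * (C4 * Cv) * 2 `^ (1 + kap + sg) * 2 `^ (pp * t).
    have lL : l%:R <= t / th + 1.
      by have [_ h] := LamE; apply: le_trans h; rewrite ler_nat -ltnS.
    have SS : S l.-1 <= S l.
      by rewrite ler_wpM2l // pow2_le // ler_wpM2l // ler_nat leq_pred.
    apply: (@le_trans _ _ (N l * (2 * S l))).
      rewrite ler_wpM2l ?mulr_ge0 ?powR_ge0 //; lra.
    have -> : N l * (2 * S l) = 2 * (C4 * Cv) * 2 `^ ((1 + kap) * (Lev l)%:R + sg * l%:R).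
      by rewrite /N /S pow2D; ring.
    rewrite -[leRHS]mulrA -pow2D; apply: ler_wpM2l; first by rewrite mulr_ge0 ?mulr_ge0.
    apply: pow2_le.
    have sgl : sg * l%:R <= pp * t + sg.
      apply: le_trans (ler_wpM2l sg0 lL) _; rewrite mulrDr mulr1 lerD2r.
      by rewrite mulrA ler_pdivrMr // mulrAC ler_wpM2r.
    case: (leP 0 (x l)) => xl.
      have LL : (Lev l)%:R <= x l + 1.
        by rewrite /Lev -natr1 lerD2r truncn_le.
      have k1 : (1 + kap) * (Lev l)%:R <= (1 + kap) * (x l + 1).
        by rewrite ler_wpM2l //; lra.
      have k2 : (1 + kap) * x l = pp * (t - l%:R * th).
        by rewrite kapE /x; field; rewrite gt_eqF.
      have k3 : sg * l%:R <= pp * th * l%:R by rewrite ler_wpM2r ?ler0n.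
      have k4 : (1 + kap) * (x l + 1) + pp * th * l%:R = pp * t + (1 + kap).
        by rewrite mulrDr mulr1 k2; ring.
      by apply: le_trans (lerD k1 k3) _; rewrite k4 [leLHS]addrC lerD2r lerDl.
    have -> : Lev l = 1%N.
      by rewrite /Lev; congr _.+1; apply/eqP; rewrite -leqn0 truncn_le_nat; lra.
    lra.
  apply: le_trans (ler_sum _ (fun l _ => term l)) _.
  rewrite sumr_const card_ord -[leLHS]mulr_natl.
  have hL : Lam.+1%:R <= C6 * 2 `^ ((p - pp) * t).
    apply: le_trans (hC6 t t0); have [_ h] := LamE; rewrite -natr1 [th^-1 * t]mulrC; lra.
  set W := 2 * (C4 * Cv) * 2 `^ (1 + kap + sg).
  have W00 : 0 <= W.
    by apply: mulr_ge0; [apply: mulr_ge0 => //; exact: mulr_ge0 | exact: powR_ge0].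
  have W1 : 0 <= W * 2 `^ (pp * t) by apply: mulr_ge0 => //; exact: powR_ge0.
  apply: le_trans (ler_wpM2r W1 hL) _.
  have -> : C6 * 2 `^ ((p - pp) * t) * (W * 2 `^ (pp * t)) =
    C6 * W * (2 `^ ((p - pp) * t) * 2 `^ (pp * t)) by ring.
  by rewrite -pow2D -mulrDl subrK.
Qed.

(** As [eps] grows the bound tends to 0 while every node costs at least 1, so large [eps] must be
    served by the empty algorithm; otherwise [t] is defined by [2^-t = eps / B1]. *)
Theorem comp_unr_le : exists2 C : R, 0 <= C & forall eps, 0 < eps ->
  (comp_unr mu c (weighted_domain K gam) H ip cost eps <= (C * eps `^ (- p))%:E)%E.
Proof.
have [C3 [C7 [C30 C70 hrate]]] := multilevel_rate.
have [G G0 gamG] := gam_bounded.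
pose B := Num.sqrt (G * a%:R ^+ D * 4 ^+ D).
have B0 : 0 <= B by exact: sqrtr_ge0.
have comp_le eps C (Q : algorithm R) : admissible c Q ->
    (wc_error mu c (weighted_domain K gam) H ip Q <= eps%:E)%E ->
    cost_unr cost Q <= C ->
    (comp_unr mu c (weighted_domain K gam) H ip cost eps <= C%:E)%E.
  move=> hQ he hc; apply: (@le_trans _ _ (cost_unr cost Q)%:E); last by rewrite lee_fin.
  by apply: ereal_inf_lbound; exists Q.
(* Dominates [B], the error of the empty algorithm, and [C3], so that [C3 2^-t <= eps]; the 1 keeps
   it positive. *)
pose B1 := 1 + C3 + B.
have B10 : 0 < B1 by rewrite /B1; lra.
exists (C7 * B1 `^ p); first by rewrite mulr_ge0 ?powR_ge0.
move=> eps e0; case: (leP B1 eps) => eB.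
  pose Q := seq_algorithm c ([::] : seq (R * {fset nat} * (nat -> R))).
  have hQ : admissible c Q by exact: seq_algorithm_admissible.
  apply: (comp_le _ _ Q) => //; last first.
    by rewrite /cost_unr big_ord0 !mulr_ge0 ?powR_ge0.
  apply: (@le_trans _ _ B%:E); last by rewrite lee_fin; rewrite /B1 in eB; lra.
  apply: (error_le a0 Ic hK gam0 gamd gamG hmu hH hQ (E := fun u => 2 ^+ #|` u|)) => //.
    move=> u tau Au htau; rewrite big_ord0 subr0 normr_prod.
    have -> : 2 ^+ #|` u| = \prod_(j <- u) (2 : R).
      by rewrite big_const_seq count_predT iter_mulr_1.
    by apply: ler_prod => j _; rewrite normr_ge0; exact: feature_mean_le.
  move=> s fs; rewrite /B sqr_sqrtr ?mulr_ge0 ?exprn_ge0 ?ler0n //.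
  rewrite -mulrA; apply: le_trans (ler_wpM2r _ (gamG s fs)); last first.
    by rewrite mulr_ge0 ?exprn_ge0 ?ler0n.
  rewrite mulr_suml !big_seq; apply: ler_sum => u us.
  have Au : active gam u by case: fs => _; apply.
  rewrite ler_wpM2l // -exprMn (_ : 2 * 2 = 4 :> R); last by ring.
  by apply: ler_pM; rewrite ?exprn_ge0 ?ler0n // ler_weXn2l ?ler1n ?gamd.
pose t := - (ln (eps / B1) / ln 2).
have l2 : 0 < ln (2 : R) by rewrite ln_gt0 // ltr1n.
have eB0 : 0 < eps / B1 by rewrite divr_gt0.
have tE : 2 `^ (- t) = eps / B1.
  by rewrite pow2E /t opprK divfK ?gt_eqF // lnK.
have t0 : 0 <= t.
  rewrite /t oppr_ge0 pmulr_lle0 ?invr_gt0 // ln_le0 // ler_pdivrMr // mul1r.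
  exact: ltW.
have [Q [hQ he hc]] := hrate t t0.
apply: (comp_le _ _ Q) => //.
  apply: le_trans he _; rewrite lee_fin tE mulrA ler_pdivrMr // mulrC.
  by rewrite ler_wpM2l ?ltW // /B1; lra.
apply: le_trans hc _; rewrite -mulrA ler_wpM2l //.
have -> : p * t = - t * - p by ring.
rewrite powRrM tE powRM ?(ltW e0) ?invr_ge0 ?(ltW B10) //.
have -> : B1^-1 `^ (- p) = B1 `^ p.
  by rewrite -powR_inv1 ?(ltW B10) // -powRrM mulN1r opprK.
by rewrite mulrC.
Qed.

End Complexity.

Lemma kernel_C0_gt0 (R : realType) (a : nat) (c : R) (K : R -> R -> R) :
  (0 < a)%N -> unitI c ->
  reproducing_kernel (@unitI R) (sobolev a c) (sobolev_ip a c) K -> 0 < kernel_C0 K.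
Proof.
move=> a0 Ic hK; have KE := sobolev_kernelE a0 Ic hK.
suff -> : kernel_C0 K = feature_pairing a (mean_feature a c) (mean_feature a c).
  exact: mean_pairing_gt0.
have [_ <-] := mean_pairing a Ic (feature_fun_mean a Ic).
rewrite /kernel_C0; apply: eq_Rint => x Ix.
have [_ h] := mean_pairing a Ic (feature_fun_point a Ic Ix).
rewrite feature_pairingC -h; apply: eq_Rint => y Iy.
by rewrite KE // /pkernel feature_pairingC.
Qed.

(** * Ranking of the active sets from the decay *)

Section Ranking.
Variables (R : realType) (K : R -> R -> R) (gam : {fset nat} -> R) (D : nat).
Hypotheses (gam0 : forall u, 0 <= gam u) (C00 : 0 < kernel_C0 K).
Hypothesis gamd : forall u, active gam u -> (#|` u| <= D)%N.

Definition ranking (q : R) (idx : {fset nat} -> nat) (Cg : R) :=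
  [/\ forall u v, active gam u -> active gam v -> idx u = idx v -> u = v, 0 <= Cg &
      forall u, active gam u -> gam u <= Cg * (idx u).+1%:R `^ (- q)].

Lemma finite_ranking q : finite_set (active_nonempty gam) ->
  exists idx Cg, ranking q idx Cg.
Proof.
move=> fin; pose s := fset0 :: enum_fset (fset_set (active_nonempty gam)).
have sA u : active gam u -> u \in s.
  move=> Au; rewrite inE; have [//|u0] := eqVneq u fset0.
  by rewrite in_fset_set // mem_set //; split => //; apply/eqP.
exists (index^~ s), (\sum_(v <- s) gam v * (index v s).+1%:R `^ q); split.
- by move=> u v /sA us /sA vs; exact: index_inj.
- by apply: sumr_ge0 => v _; rewrite mulr_ge0 ?powR_ge0.
- move=> u /sA us; rewrite powRN ler_pdivlMr ?powR_gt0 ?ltr0n //.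
  by rewrite (big_rem u) //= lerDl sumr_ge0 // => v _; rewrite mulr_ge0 ?powR_ge0.
Qed.

(** The empty set is absent from the enumeration and takes rank 0, so [e j] has rank [j + 1]; the
    shift costs [2^q], from [j + 2 <= 2 (j + 1)]. As active sets have at most [D] elements, [gam] is
    at most a fixed multiple of [gam_hat]. *)
Lemma enum_ranking q (e : nat -> {fset nat}) : 0 < q ->
  decreasing_enum K gam e ->
  gam_hat K gam (e j) * j.+1%:R `^ q @[j --> \oo] --> (0 : R) ->
  exists idx Cg, ranking q idx Cg.
Proof.
move=> q0 [bij _] cv.
have [B B0 hB] : exists2 B, 0 <= B & forall j, gam_hat K gam (e j) * j.+1%:R `^ q <= B.
  have /cvg_seq_bounded [M [_ hM]] : cvgn (fun j => gam_hat K gam (e j) * j.+1%:R `^ q).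
    by apply/cvg_ex; exists 0.
  exists (`|M| + 1); first by rewrite addr_ge0.
  move=> j; apply: le_trans (ler_norm _) _; apply: hM => //.
  by apply: le_lt_trans (ler_norm M) _; rewrite ltrDl.
pose m := Num.max 1 (kernel_C0 K)^-1.
have m1 : 1 <= m by rewrite le_max lexx.
have gam_le u : active gam u -> gam u <= gam_hat K gam u * m ^+ D.
  move=> Au; rewrite /gam_hat -mulrA ler_peMr //.
  apply: (@le_trans _ _ (kernel_C0 K ^+ #|` u| * m ^+ #|` u|)).
    rewrite -exprMn exprn_ege1 // -(ler_pM2l (_ : 0 < (kernel_C0 K)^-1)) ?invr_gt0 //.
    by rewrite mulr1 mulKf ?gt_eqF // le_max lexx orbT.
  by rewrite ler_wpM2l ?exprn_ge0 ?(ltW C00) // ler_weXn2l // gamd.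
have /choice [idx hidx] : forall u, exists n : nat, active gam u ->
    (u = fset0 /\ n = 0%N) \/ (exists j, u = e j /\ n = j.+1).
  move=> u; have [Au|nAu] := pselect (active gam u); last by exists 0%N.
  have [->|u0] := eqVneq u fset0; first by exists 0%N => _; left.
  have [_ _ surj] := bij.
  have [j _ ej] := surj u (conj Au (elimN eqP u0)).
  by exists j.+1 => _; right; exists j.
exists idx, (gam fset0 + B * m ^+ D * 2 `^ q); split.
- move=> u v Au Av.
  case: (hidx u Au) => [[-> ->]|[j [-> ->]]]; case: (hidx v Av) => [[-> ->]|[k [-> ->]]] //.
  by move=> [->].
- by rewrite addr_ge0 ?mulr_ge0 ?powR_ge0 ?exprn_ge0 // (le_trans ler01).
move=> u Au; case: (hidx u Au) => [[-> ->]|[j [uj ->]]].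
  by rewrite powR1 mulr1 lerDl !mulr_ge0 ?powR_ge0 ?exprn_ge0 // (le_trans ler01).
apply: (@le_trans _ _ (B * m ^+ D * 2 `^ q * j.+2%:R `^ (- q))); last first.
  by rewrite ler_wpM2r ?powR_ge0 // lerDr.
apply: le_trans (gam_le u Au) _; rewrite uj.
have j0 : 0 < j.+1%:R `^ q :> R by rewrite powR_gt0 ?ltr0n.
have h1 : gam_hat K gam (e j) <= B / j.+1%:R `^ q by rewrite ler_pdivlMr.
apply: le_trans (ler_wpM2r _ h1) _; first by rewrite exprn_ge0 // (le_trans ler01).
have -> : B * m ^+ D * 2 `^ q * j.+2%:R `^ (- q) = B * (2 `^ q * j.+2%:R `^ (- q)) * m ^+ D.
  by ring.
rewrite ler_wpM2r ?exprn_ge0 ?(le_trans ler01) // ler_wpM2l //.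
have j20 : 0 < j.+2%:R `^ q :> R by rewrite powR_gt0 ?ltr0n.
rewrite powRN ler_pdivlMr // mulrC ler_pdivrMr //.
rewrite -powRM ?ler0n //; apply: (ge0_ler_powR (ltW q0)); rewrite ?nnegrE ?mulr_ge0 ?ler0n //.
rewrite -natrM ler_nat; by rewrite mul2n -addnn -[leqLHS]addn1 leq_add2l.
Qed.

End Ranking.

Lemma decay_ranking (R : realType) (K : R -> R -> R) (gam : {fset nat} -> R) (D : nat) (r : R) :
  (forall u, 0 <= gam u) -> 0 < kernel_C0 K ->
  (forall u, active gam u -> (#|` u| <= D)%N) ->
  0 < r -> (r%:E < decay K gam)%E ->
  exists q idx Cg, r < q /\ ranking gam q idx Cg.
Proof.
move=> gam0 C00 gamd r0; rewrite /decay; case: pselect => [fin _|nfin].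
  have [idx [Cg h]] := finite_ranking gam0 (r + 1) fin.
  by exists (r + 1), idx, Cg; split => //; rewrite ltrDl.
move=> /ereal_sup_gt [_ [q [e he cv] <-]]; rewrite lte_fin => rq.
have [idx [Cg h]] := enum_ranking gam0 C00 gamd (lt_trans r0 rq) he cv.
by exists q, idx, Cg.
Qed.

(** The estimate holds only eventually, so the first values are added to the constant; [k + 1]
    replaces [k] because [k^s] may vanish at 0. *)
Lemma cost_growth (R : realType) (cost : nat -> R) (s : R) :
  0 <= s ->
  (cost : nat -> R^o) =O_\oo (fun k : nat => (k%:R `^ s : R^o)) ->
  exists2 C, 0 <= C & forall k, cost k <= C * k.+1%:R `^ s.
Proof.
move=> s0 /eqO_exP [C C0 [N _ hN]].
exists (C + \sum_(j < N) `|cost j|).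
  by rewrite addr_ge0 ?sumr_ge0 // ltW.
move=> k; have p1 : 1 <= k.+1%:R `^ s :> R.
  apply: (@le_trans _ _ (1 `^ s)); first by rewrite powR1.
  by apply: (ge0_ler_powR s0); rewrite ?nnegrE ?ler1n.
rewrite mulrDl; case: (leqP N k) => hk.
  have := hN k hk; rewrite /= [X in _ <= C * X]ger0_norm ?powR_ge0 // => h.
  apply: le_trans (ler_norm _) _; apply: le_trans h _.
  apply: (@le_trans _ _ (C * k.+1%:R `^ s)).
    rewrite ler_wpM2l ?(ltW C0) //.
    by apply: (ge0_ler_powR s0); rewrite ?nnegrE ?ler_nat.
  by rewrite lerDl mulr_ge0 ?sumr_ge0 ?(le_trans ler01).
apply: le_trans (ler_norm _) _.
apply: (@le_trans _ _ (\sum_(j < N) `|cost j|)).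
  by rewrite (bigD1 (Ordinal hk)) //= lerDl sumr_ge0.
apply: (@le_trans _ _ ((\sum_(j < N) `|cost j|) * k.+1%:R `^ s)).
  by rewrite ler_peMr ?sumr_ge0.
by rewrite lerDr mulr_ge0 ?(ltW C0) ?powR_ge0.
Qed.

(* A pair [(r, v)] in [V l] stands for [r] times the projection [f |-> f(., c)] on the
   variables in [v], whose value at the component [f_u] is [f_u] if [u] is contained in [v] and [0]
   otherwise; so [V l] cuts [f] down to the components with [chi l u]. *)
Definition level_scheme (R : realType) (gam : {fset nat} -> R) (idx : {fset nat} -> nat)
    (cost : nat -> R) (sg Cv : R) (V : nat -> seq (R * {fset nat}))
    (chi : nat -> {fset nat} -> bool) :=
  [/\ forall l u, active gam u -> \sum_(b <- V l) b.1 * (u `<=` b.2)%fset%:R = (chi l u)%:R,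
      forall l u, active gam u -> chi l u -> chi l.+1 u,
      forall l u, active gam u -> (idx u < 2 ^ l)%N -> chi l u,
      0 <= Cv &
      forall l, \sum_(b <- V l) cost #|` b.2| <= Cv * 2 `^ (sg * l%:R)].

Lemma ler_sum_seq (R : realType) (T : eqType) (s : seq T) (f g : T -> R) :
  (forall x, x \in s -> f x <= g x) -> \sum_(x <- s) f x <= \sum_(x <- s) g x.
Proof. by move=> h; rewrite !big_seq; exact: ler_sum. Qed.

(** * Isolating the first active sets, by unions or by inclusion-exclusion *)

Section Levels.
Variables (R : realType) (gam : {fset nat} -> R) (idx : {fset nat} -> nat) (D : nat).
Hypothesis idx_inj : forall u v, active gam u -> active gam v -> idx u = idx v -> u = v.
Hypothesis gamd : forall u, active gam u -> (#|` u| <= D)%N.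
Variable cost : nat -> R.
Hypotheses (cost1 : forall k, 1 <= cost k)
  (cost_mono : forall k l : nat, (k <= l)%N -> cost k <= cost l).

Lemma first_active : exists F : nat -> seq {fset nat}, forall n,
  [/\ uniq (F n), (size (F n) <= n)%N &
      forall u, u \in F n <-> active gam u /\ (idx u < n)%N].
Proof.
have /choice [g hg] : forall n, exists o : option {fset nat}, forall u,
    o = Some u <-> active gam u /\ idx u = n.
  move=> n; have [[u [Au un]]|h] := pselect (exists u, active gam u /\ idx u = n).
    exists (Some u) => v; split=> [[<-] //|[Av vn]].
    by congr Some; apply: idx_inj => //; rewrite un.
  by exists None => u; split => // -[Au un]; case: h; exists u.
exists (fun n => pmap g (iota 0 n)) => n.
have memF u : u \in pmap g (iota 0 n) <-> active gam u /\ (idx u < n)%N.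
  rewrite mem_pmap; split=> [/mapP[m]|[Au un]].
    by rewrite mem_iota /= => mn /esym/hg[Au um]; rewrite um.
  apply/mapP; exists (idx u); first by rewrite mem_iota.
  by apply/esym/hg.
split => //; last by rewrite size_pmap (leq_trans (count_size _ _)) // size_iota.
elim: n {memF} (iota_uniq 0 n) => [|n _]; first by [].
move: (iota 0 n.+1) => s; elim: s => //= m s IH /andP[ms us].
case E : (g m) => [u|] /=; last exact: IH.
rewrite IH // andbT mem_pmap; apply/negP => /mapP[k ks /esym/hg[_ ku]].
by move/hg: E ms => [_ <-]; rewrite ku ks.
Qed.

(** One projection suffices: the union of the first [2^l] sets has at most [D 2^l] variables.
    Inclusion in the union may also admit sets of higher rank. [D + 1] comes from
    [D 2^l + 1 <= (D + 1) 2^l]. *)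
Lemma union_levels (s C : R) : 0 <= s -> 0 <= C ->
  (forall k, cost k <= C * k.+1%:R `^ s) ->
  exists Cv V chi, level_scheme gam idx cost s Cv V chi.
Proof.
move=> s0 C0 hC; have [F hF] := first_active.
pose v l := (\bigcup_(u <- F (2 ^ l)%N) u)%fset.
have in_v l u : active gam u -> (idx u < 2 ^ l)%N -> (u `<=` v l)%fset.
  move=> Au hu; have [_ _ h] := hF (2 ^ l)%N.
  by by apply: bigfcup_sup => //; apply/h.
exists (C * D.+1%:R `^ s), (fun l => [:: (1, v l)]), (fun l u => (u `<=` v l)%fset).
split => //.
- by move=> l u _; rewrite big_seq1 mul1r.
- move=> l u _ /fsubset_trans; apply; apply/bigfcupsP => w wF _; apply: in_v.
    by have [_ _ h] := hF (2 ^ l)%N; case/h: wF.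
  have [_ _ h] := hF (2 ^ l)%N; case/h: wF => _ /leq_trans; apply.
  by rewrite leq_exp2l.
- by rewrite mulr_ge0 ?powR_ge0.
move=> l; rewrite big_seq1 /=.
have hv : (#|` v l| <= D * 2 ^ l)%N.
  have [_ sz h] := hF (2 ^ l)%N.
  rewrite (leq_trans _ (leq_mul (leqnn D) sz)) // /v.
  have : forall u, u \in F (2 ^ l)%N -> active gam u by move=> u /h[].
  elim: (F _) {h sz} => [|u r IH] hr; first by rewrite big_nil cardfs0.
  rewrite big_cons mulnS (leq_trans (leq_card_fsetU _ _)) //.
  by apply: leq_add; [apply: gamd; apply: hr; exact: mem_head |
    apply: IH => w wr; apply: hr; rewrite inE wr orbT].
apply: le_trans (hC _) _; rewrite -mulrA ler_wpM2l //.
have -> : 2 `^ (s * l%:R) = (2 ^ l)%:R `^ s :> R by rewrite mulrC powRrM pow2_nat natrX.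
rewrite -powRM ?ler0n //; apply: (ge0_ler_powR s0); rewrite ?nnegrE ?mulr_ge0 ?ler0n //.
by rewrite -natrM ler_nat mulSn addnC -addn1 leq_add // expn_gt0.
Qed.

(** Signed sum over the subsets of [s] adjoined to [z], the sign counting omitted elements. With [z]
    empty it is the formula for the component [f_s] of the anchored decomposition. *)
Fixpoint inclusion_exclusion (s : seq nat) (z : {fset nat}) : seq (R * {fset nat}) :=
  if s is j :: s' then
    inclusion_exclusion s' (j |` z)%fset ++
    [seq (- b.1, b.2) | b <- inclusion_exclusion s' z]
  else [:: (1, z)].

Lemma inclusion_exclusion_sum s (z w : {fset nat}) :
  uniq s -> (forall j, j \in s -> j \notin z) ->
  \sum_(b <- inclusion_exclusion s z) b.1 * (w `<=` b.2)%fset%:R =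
  (all (mem w) s && all [pred i | (i \in z) || (i \in s)] w)%:R :> R.
Proof.
elim: s z => [|j s IH] z /=.
  move=> _ _; rewrite big_seq1 mul1r /=; congr (nat_of_bool _)%:R.
  apply/fsubsetP/allP => h i iw /=; first by rewrite h.
  by have := h i iw; rewrite /= orbF.
move=> /andP[js us] hz; rewrite big_cat big_map /=.
have hzs i : i \in s -> i \notin z by move=> si; apply: hz; rewrite inE si orbT.
under [X in _ + X]eq_bigr do rewrite mulNr.
rewrite sumrN !IH //; last first.
  move=> i si; rewrite !inE negb_or hzs // andbT.
  by apply: contraNneq js => <-.
have jz : j \notin z by apply: hz; exact: mem_head.
have -> : all [pred i | (i \in (j |` z)%fset) || (i \in s)] w =
    all [pred i | (i \in z) || (i \in j :: s)] w.
  by apply: eq_all => i /=; rewrite !inE -orbA orbCA.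
(* If [j] is in [w], the sets that omit [j] contribute nothing; otherwise adding [j] changes no
   inclusion and the two halves cancel. *)
case: (boolP (j \in w)) => jw /=.
  have -> : all [pred i | (i \in z) || (i \in s)] w = false.
    by apply/negP => /allP/(_ j jw) /=; rewrite (negbTE jz) (negbTE js).
  by rewrite andbF subr0.
have -> : all [pred i | (i \in z) || (i \in j :: s)] w =
    all [pred i | (i \in z) || (i \in s)] w.
  apply: eq_in_all => i iw /=; rewrite inE.
  by have -> : (i == j) = false by apply: contraNF jw => /eqP <-.
by rewrite subrr.
Qed.

Lemma inclusion_exclusion_card s (z : {fset nat}) b :
  b \in inclusion_exclusion s z -> (#|` b.2| <= size s + #|` z|)%N.
Proof.
elim: s z b => [|j s IH] z b /=; first by rewrite inE => /eqP ->.
rewrite mem_cat => /orP[/IH h|/mapP[b' /IH h ->] /=].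
  apply: leq_trans h _; rewrite addSnnS leq_add2l cardfsU1; by case: (j \notin z).
by apply: leq_trans h _; rewrite leq_add2r.
Qed.

Lemma size_inclusion_exclusion s (z : {fset nat}) :
  size (inclusion_exclusion s z) = (2 ^ size s)%N.
Proof. by elim: s z => //= j s IH z; rewrite size_cat size_map !IH addnn -mul2n -expnS. Qed.

(** A component takes at most [2^D] projections on at most [D] variables each, so [cost] enters only
    through the constant [cost D], and the exponent is 1 whatever its growth. *)
Lemma inclusion_exclusion_levels : exists Cv V chi, level_scheme gam idx cost 1 Cv V chi.
Proof.
have [F hF] := first_active.
exists (2 ^+ D * cost D),
  (fun l => flatten [seq inclusion_exclusion (enum_fset u) fset0 | u <- F (2 ^ l)%N]),
  (fun l u => (idx u < 2 ^ l)%N).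
have c0 : 0 <= cost D by exact: le_trans (cost1 D).
split => //.
- move=> l u Au; have [uF _ h] := hF (2 ^ l)%N.
  rewrite big_flatten /= big_map.
  rewrite (eq_bigr (fun w => (w == u)%:R)); last first.
    move=> w _; rewrite inclusion_exclusion_sum ?fset_uniq //.
    congr (nat_of_bool _)%:R; apply/andP/eqP => [[/allP h1 /allP h2]|->].
      by apply/fsetP => i; apply/idP/idP => [/h1 //|/h2 /=]; rewrite ?inE.
    by split; apply/allP => i //= ->; rewrite orbT.
  rewrite -natr_sum.
  have -> : (\sum_(w <- F (2 ^ l)) (w == u) = count_mem u (F (2 ^ l)))%N.
    by rewrite -sum1_count [RHS]big_mkcond; apply: eq_bigr => w _; rewrite /=; case: (w == u).
  rewrite count_uniq_mem //; congr (nat_of_bool _)%:R.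
  by apply/idP/idP => [/h[]//|hu]; apply/h.
- by move=> l u _ /leq_trans; apply; rewrite leq_exp2l.
- by rewrite mulr_ge0 ?exprn_ge0.
move=> l; have [_ sz h] := hF (2 ^ l)%N.
rewrite big_flatten /= big_map mul1r pow2_nat.
apply: (@le_trans _ _ (\sum_(u <- F (2 ^ l)%N) 2 ^+ D * cost D)).
  apply: (@ler_sum_seq R {fset nat} (F (2 ^ l)%N) (fun u => \sum_(b <- inclusion_exclusion (enum_fset u) fset0) cost #|` b.2|) (fun=> 2 ^+ D * cost D)) => u /h[Au _].
  apply: (@le_trans _ _ (\sum_(b <- inclusion_exclusion (enum_fset u) fset0) cost D)).
    rewrite !big_seq; apply: ler_sum => b /inclusion_exclusion_card.
    rewrite cardfs0 addn0 => hb; apply: cost_mono; apply: leq_trans hb _; exact: gamd.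
  rewrite big_const_seq count_predT iter_addr_0 size_inclusion_exclusion -[leLHS]mulr_natl.
  by rewrite natrX ler_wpM2r // ler_weXn2l ?ler1n // gamd.
rewrite big_const_seq count_predT iter_addr_0 -[leLHS]mulr_natl [leRHS]mulrC.
by rewrite ler_wpM2r ?mulr_ge0 ?exprn_ge0 // -natrX ler_nat.
Qed.

End Levels.

(** * From a fixed exponent to the infimum *)

Lemma lt_decay (R : realType) (d : \bar R) (sg p : R) :
  (1 < d)%E -> 0 < p -> ((2 * sg)%:E / (d - 1) < p%:E)%E ->
  ((1 + 2 * sg / p)%:E < d)%E.
Proof.
case: d => [d| |] //.
- rewrite lte_fin => d1 p0.
  have d10 : 0 < d - 1 by rewrite subr_gt0.
  rewrite -EFinB inver gt_eqF // -EFinM !lte_fin ltr_pdivrMr // => h.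
  by rewrite -ltrBrDl ltr_pdivrMr // [X in _ < X]mulrC.
- by move=> _ _ _; exact: ltry.
Qed.

Theorem corollary7 (R : realType) (alpha : nat) (halpha : (1 <= alpha)%N)
  (c : R) (hc : unitI c)
  (K : R -> R -> R)
  (hK : reproducing_kernel (@unitI R) (sobolev alpha c) (sobolev_ip alpha c) K)
  (gam : {fset nat} -> R) (hgam : is_weights K gam)
  (mu : {measure set (seqspace R) -> \bar R}) (hmu : is_product_uniform mu)
  (H : set ((nat -> R) -> R)) (ip : ((nat -> R) -> R) -> ((nat -> R) -> R) -> R)
  (hH : is_rkhs (weighted_domain K gam) H ip (weighted_kernel K gam))
  (cost : nat -> R) (hcost1 : forall k, 1 <= cost k)
  (hcost_mono : forall k l : nat, (k <= l)%N -> cost k <= cost l)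
  (s : R) (hs : 0 <= s)
  (hcostO : (cost : nat -> R^o) =O_\oo (fun k : nat => (k%:R `^ s : R^o)))
  (hdim : finite_algorithmic_dimension gam)
  (hdecay : (1 < decay K gam)%E) :
  (p_unr mu c (weighted_domain K gam) H ip cost <=
   maxe (alpha%:R^-1)%:E ((2 * Num.min 1 s)%:E / (decay K gam - 1)))%E.
Proof.
have [gam0 _ _] := hgam; have [D [phi hphi]] := hdim.
have C00 := kernel_C0_gt0 halpha hc hK.
have gamd := active_card hphi.
have [Cc Cc0 hCc] := cost_growth hs hcostO.
set sg := Num.min 1 s.
have sg0 : 0 <= sg by rewrite le_min ler01.
set rhs := maxe _ _.
(* [p_unr] is an infimum, so it is enough to reach every real [p] strictly above the right-hand
   side; strictness leaves room for the choice of exponents. *)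
have key p : (rhs < p%:E)%E -> (p_unr mu c (weighted_domain K gam) H ip cost <= p%:E)%E.
  rewrite /rhs gt_max lte_fin => /andP[pa psg].
  have p0 : 0 < p by apply: lt_trans pa; rewrite invr_gt0 ltr0n.
  have sgp0 : 0 <= 2 * sg / p by rewrite divr_ge0 ?mulr_ge0 // ltW.
  have r0 : 0 < 1 + 2 * sg / p by lra.
  have [q [idx [Cg [rq [idx_inj Cg0 gam_le]]]]] :=
    decay_ranking gam0 C00 gamd r0 (lt_decay hdecay p0 psg).
  have q1 : 1 < q by lra.
  have psq : 2 * sg < p * (q - 1).
    by move: rq; rewrite -ltrBrDl ltr_pdivrMr // [X in _ < X]mulrC.
  have [Cv [V [chi [hV chi_mono chi_idx Cv0 hVc]]]] :
      exists Cv V chi, level_scheme gam idx cost sg Cv V chi.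
    (* Inclusion-exclusion serves [1 <= s], unions serve [s < 1]. *)
    rewrite /sg; case: leP => _.
      exact: (inclusion_exclusion_levels idx_inj gamd hcost1 hcost_mono).
    exact: (union_levels idx_inj gamd hs Cc0 hCc).
  apply: ereal_inf_lbound; exists p => //; split; first exact: ltW.
  exact: (comp_unr_le halpha hc hK gam0 hmu hH hcost1 hcost_mono hphi idx_inj Cg0 q1 gam_le
    hV chi_mono chi_idx Cv0 sg0 hVc pa psq).
(* Nonnegativity excludes [-oo], and at [+oo] there is nothing to prove. *)
have a0 : (0 <= rhs)%E by rewrite /rhs le_max lee_fin invr_ge0 ler0n.
case E : rhs a0 key => [r| |] // _ key; last by rewrite leey.
apply/lee_addgt0Pr => e e0; rewrite -EFinD; apply: key.
by rewrite lte_fin ltrDl.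
Qed.
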